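(* Let $\mathbf X_{[0,T]}$ be a random continuous geometric $p$-rough path over $\mathbb R^d$ defined on some probability space and on a (deterministic or random) time interval $[0,T]$. Assume that $\mathbf X_{[0,T]}$ satisfies the following Conditions (ROC): (1) the expected signature $\mathrm{ESig}(\mathbf X_{[0,T]})$ exists and has a positive radius of convergence $r_2(\mathbf X_{[0,T]})>0$; (2) for every bounded subset $\mathbf K\subset\mathbb R$, every $k\ge 1$ and every $M\in\mathcal L(\mathbb R^d,\mathfrak{so}(k))$ there exists $r=r(\mathbf K,M)>0$ such that the function $\lambda\in\mathbb R\mapsto \phi_{\mathbf X_{[0,T]}}(\lambda M)=\mathbb E[\widetilde{\lambda M}(S(\mathbf X)_{0,T})]$ is entrywise real analytic in $(\lambda_0-r,\lambda_0+r)$ for all $\lambda_0\in\mathbf K$. Then the distribution $\mu_{S(\mathbf X)_{0,T}}$ of the signature is determined by $\mathrm{ESig}(\mathbf X_{[0,T]})$ within the class of random geometric rough paths satisfying Conditions (ROC); that is, if $\mathbf Y$ is another random continuous geometric rough path over $\mathbb R^d$ (with its own terminal time $T'$, deterministic or random) which also satisfies Conditions (ROC), and $\mathrm{ESig}(\mathbf Y)=\mathrm{ESig}(\mathbf X_{[0,T]})$, then $\mu_{S(\mathbf Y)_{0,T'}}=\mu_{S(\mathbf X)_{0,T}}$.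
   Context: Tensor algebra. $V=\mathbb R^d$ with Euclidean norm $|\cdot|$; $T((V))=\prod_{n\ge 0}V^{\otimes n}$ with elements $x=(x^0,x^1,\dots)$; $T^N(V)=\bigoplus_{n=0}^N V^{\otimes n}$; multiplication is $\otimes$; $\|\cdot\|_{\otimes n}$ is the projective tensor norm on $V^{\otimes n}$. $E=\{x\in T((V)):\sum_n\lambda^n\|x^n\|_{\otimes n}<\infty\ \forall\lambda\ge 0\}$, topologised by the seminorms $x\mapsto\sum_n m^n\|x^n\|_{\otimes n}$, $m\in\mathbb N$. Rough paths. For $p\ge 1$, $T>0$, a $p$-rough path is a continuous map $\mathbf X:\{(s,t):0\le s\le t\le T\}\to T^{\lfloor p\rfloor}(V)$ with $\mathbf X^0_{s,t}=1$, $\mathbf X_{s,u}\otimes\mathbf X_{u,t}=\mathbf X_{s,t}$ for $s\le u\le t$, and for which there is a control $w$ (continuous, superadditive, vanishing on the diagonal) with $\sup_{1\le n\le\lfloor p\rfloor}\big((n/p)!\,\gamma_p\|\mathbf X^n_{s,t}\|_{\otimes n}\big)^{p/n}\le w(s,t)$, where $(n/p)!=\Gamma(n/p+1)$ and $\gamma_p$ is a constant depending only on $p$. The $p$-variation distance is $\|\mathbf X;\mathbf Y\|_{p\text{-var};[0,T]}^p=\sum_{n=1}^{\lfloor p\rfloor}\sup_{\mathcal D}\sum_{t_j\in\mathcal D}\|\mathbf X^n_{t_j,t_{j+1}}-\mathbf Y^n_{t_j,t_{j+1}}\|_{\otimes n}^{p/n}$, the supremum being over dissections $\mathcal D$ of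 $[0,T]$. The signature path $S(\mathbf X)$ is the unique (Lyons) multiplicative extension of $\mathbf X$ to $T((V))$ satisfying the same bound for all $n\ge 1$; it is $E$-valued; $S(\mathbf X)_{0,T}$ is the signature, with level-$n$ component $S(\mathbf X)^n_{0,T}$. For a continuous bounded variation path $X$, $S(X)^n_{s,t}=\int_{s<s_1<\dots<s_n<t}dX_{s_1}\otimes\cdots\otimes dX_{s_n}$. The space $G\Omega_p(V)$ of geometric $p$-rough paths is the closure, in $p$-variation distance, of the set of truncated signatures $S_{\lfloor p\rfloor}(X)=(1,S(X)^1,\dots,S(X)^{\lfloor p\rfloor})$ of continuous bounded variation paths $X$. A random continuous geometric $p$-rough path is a random element $\mathbf X_{[0,T]}(\omega)$ of geometric $p$-rough paths on $[0,T(\omega)]$ ($T$ may be random and finite), so that $S(\mathbf X)_{0,T}$ is an $E$-valued random variable; $\mu_{S(\mathbf X)_{0,T}}$ is its law on $E$. Expected signature. $\mathrm{ESig}(\mathbf X_{[0,T]})=(1,\mathbb E[S(\mathbf X)^1_{0,T}],\mathbb E[S(\mathbf X)^2_{0,T}],\dots)\in T((V))$, which exists if every $S(\mathbf X)^n_{0,T}$ is (weakly, i.e. coordinatewise) integrable; $r_2(\mathbf X_{[0,T]})$ is the radius of convergence of $\sum_n\|\mathbb E[S(\mathbf X)^n_{0,T}]\|_{\otimes n}\lambda^n$. Developments. $\mathfrak{so}(k)$ is the space of real antisymmetric $k\times k$ matrices; $\mathcal L(\cdot,\cdot)$ denotes linear maps. For linear $M:\mathbb R^d\to\mathbb C^{k\times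 k}$ and $x\in E$, $\widetilde M(x)=\sum_{n\ge 0}M^{\otimes n}(x^n)$ where $M^{\otimes n}(z_1\otimes\dots\otimes z_n)=M(z_1)\cdots M(z_n)$ and $M^{\otimes 0}(1)=I_k$. *)

(* Defs.v *)
From HB Require Import structures.
From mathcomp Require Import all_boot all_order all_algebra.
From mathcomp Require Import all_classical all_reals all_analysis.

Set Implicit Arguments.
Unset Strict Implicit.
Unset Printing Implicit Defensive.

Import Order.TTheory GRing.Theory Num.Theory.
Import numFieldNormedType.Exports.

Local Open Scope classical_set_scope.
Local Open Scope ring_scope.

(* In the basis e_(w_1) (x) ... (x) e_(w_n) of V^(x)n, V = R^d, an n-tensor is
   a function on words of length n over 'I_d, and an element of
   T((V)) = prod_n V^(x)n is a function on all words. *)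
Definition tensor (R : realType) (d n : nat) := n.-tuple 'I_d -> R.

Definition tseries (R : realType) (d : nat) := seq 'I_d -> R.

Section TensorAlgebra.
Variables (R : realType) (d : nat).
Local Notation tseries := (tseries R d).

Definition level (x : tseries) (n : nat) : tensor R d n := fun w => x w.
Arguments level : clear implicits.

Definition tmul (x y : tseries) : tseries :=
  fun w => \sum_(0 <= i < (size w).+1) x (take i w) * y (drop i w).

(* T^N(V) is embedded in T((V)) as the series supported on words of length at
   most N; its product is [truncate N (tmul x y)]. *)
Definition truncate (N : nat) (x : tseries) : tseries :=
  fun w => if (size w <= N)%N then x w else 0.

Definition enorm (v : 'rV[R]_d) : R := Num.sqrt (\sum_(i < d) v ord0 i ^+ 2).

(* The scalar coefficients l only matter for n = 0, where the elementary
   tensors reduce to 1 and the norm has to be the absolute value on R. *)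
Definition pnorm_reprs n (a : tensor R d n) : set R :=
  [set c | exists m (l : 'I_m -> R) (v : 'I_m -> 'I_n -> 'rV[R]_d),
     (forall w, a w = \sum_j l j * \prod_i v j i ord0 (tnth w i)) /\
     c = \sum_j `|l j| * \prod_i enorm (v j i)].

Definition pnorm n (a : tensor R d n) : R := inf (pnorm_reprs a).

Definition weighted_norm (lam : R) (x : tseries) : \bar R :=
  (\sum_(0 <= n <oo) (lam ^+ n * pnorm (level x n))%:E)%E.

End TensorAlgebra.

Arguments level {R d} x n _.

Record Espace (R : realType) (d : nat) := MkEspace {
  eseries : tseries R d ;
  eseriesP : forall lam : R, 0 <= lam -> (weighted_norm lam eseries < +oo)%E
}.

Section EspaceTopology.
Variables (R : realType) (d : nat).
Local Notation E := (Espace R d).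

Lemma pnorm0 n : pnorm (level (fun=> 0 : R) n : tensor R d n) = 0.
Proof.
have r0 : pnorm_reprs (level (fun=> 0 : R) n : tensor R d n) 0.
  exists 0%N, (fun=> 0), (fun _ _ => 0); split; last by rewrite big_ord0.
  by move=> w; rewrite big_ord0.
have lb : lbound (pnorm_reprs (level (fun=> 0 : R) n : tensor R d n)) 0.
  move=> c [m [l [v [_ ->]]]]; apply: sumr_ge0 => j _.
  by rewrite mulr_ge0 ?normr_ge0// prodr_ge0// => i _; exact: sqrtr_ge0.
apply/eqP; rewrite eq_le; apply/andP; split.
  by apply: ge_inf => //; exists 0.
by apply: lb_le_inf => //; exists 0.
Qed.

Lemma weighted_norm0 (lam : R) :
  0 <= lam -> (weighted_norm lam ((fun=> 0%R) : tseries R d) < +oo)%E.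
Proof.
move=> _; rewrite /weighted_norm eseries0 ?ltry//.
by move=> n _ _; rewrite pnorm0 mulr0.
Qed.

HB.instance Definition _ := gen_eqMixin E.
HB.instance Definition _ := gen_choiceMixin E.
HB.instance Definition _ := isPointed.Build E (MkEspace weighted_norm0).

(* The topology generated by the seminorms x |-> sum_n m^n ||x^n||, m in nat:
   a basis of neighbourhoods of x is given by finitely many seminorm balls. *)
Definition Eopen : set (set E) := [set A | forall x : E, A x ->
  exists (m : nat) (eps : R), 0 < eps /\
    forall y : E,
      (forall j, (j <= m)%N -> (weighted_norm j%:R (eseries y \- eseries x)%R < eps%:E)%E) ->
      A y].

Lemma EopenT : Eopen setT.
Proof. by move=> x _; exists 0%N, 1; split. Qed.

Lemma EopenI : setI_closed Eopen.
Proof.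
move=> A B oA oB x [/oA[m [e [e0 hA]]] /oB[m' [e' [e'0 hB]]]].
exists (maxn m m'), (Num.min e e'); split; first by rewrite lt_min e0.
move=> y hy; split.
- apply: hA => j jm; apply: lt_le_trans (hy j _) _.
    by rewrite leq_max jm.
  by rewrite lee_fin ge_min lexx.
- apply: hB => j jm; apply: lt_le_trans (hy j _) _.
    by rewrite leq_max jm orbT.
  by rewrite lee_fin ge_min lexx orbT.
Qed.

Lemma Eopen_bigU (I : Type) (f : I -> set E) :
  (forall i, Eopen (f i)) -> Eopen (\bigcup_i f i).
Proof.
move=> fo x [i _ /(fo i)[m [e [e0 h]]]]; exists m, e; split=> // y hy.
by exists i => //; exact: h.
Qed.

HB.instance Definition _ := isOpenTopological.Build E EopenT EopenI Eopen_bigU.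

Definition Eborel : measurableType (@open E).-sigma :=
  g_sigma_algebraType (@open E).

End EspaceTopology.

Section RoughPaths.
Variables (R : realType) (d : nat).
Local Notation tseries := (tseries R d).

Definition simplex (T : R) : set (R * R) :=
  [set st | 0 <= st.1 /\ st.1 <= st.2 /\ st.2 <= T].

Definition Gamma_fun (x : R) : R :=
  \int[lebesgue_measure]_(t in `]0, +oo[) (t `^ (x - 1) * expR (- t)).

(* (n/p)! *)
Definition frac_fact (p : R) (n : nat) : R := Gamma_fun (n%:R / p + 1).

Definition is_control (T : R) (w : R -> R -> R) : Prop :=
  [/\ {within simplex T, continuous (fun st : R * R => w st.1 st.2)},
      forall s t, 0 <= s -> s <= t -> t <= T -> 0 <= w s t,
      forall s u t, 0 <= s -> s <= u -> u <= t -> t <= T ->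
        w s u + w u t <= w s t &
      forall s, 0 <= s -> s <= T -> w s s = 0].

(* The bound is required at the levels n >= 1 such that [L n].  The function
   [gam] is the map p |-> gamma_p. *)
Definition is_controlled (gam : R -> R) (p T : R) (L : pred nat)
    (X : R -> R -> tseries) : Prop :=
  exists w, is_control T w /\
    forall s t n, 0 <= s -> s <= t -> t <= T -> (1 <= n)%N -> L n ->
      (frac_fact p n * gam p * pnorm (level (X s t) n)) `^ (p / n%:R) <= w s t.

(* Only the values X s t with 0 <= s <= t <= T are meaningful. *)
Definition is_rough_path (gam : R -> R) (p T : R) (X : R -> R -> tseries) :
    Prop :=
  let N := Num.truncn p in
  [/\ forall s t w, 0 <= s -> s <= t -> t <= T -> (N < size w)%N ->
        X s t w = 0,
      forall w, {within simplex T, continuous (fun st : R * R => X st.1 st.2 w)},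
      forall s t, 0 <= s -> s <= t -> t <= T -> X s t [::] = 1,
      forall s u t, 0 <= s -> s <= u -> u <= t -> t <= T ->
        truncate N (tmul (X s u) (X u t)) = X s t &
      is_controlled gam p T (fun n => n <= N)%N X].

(* [S] is the signature path S(X), i.e. the Lyons extension of [X].  A control
   can be multiplied by a constant, so that neither the value of gam p > 0 nor
   the choice of the control affects this notion; it determines S s t for
   0 <= s <= t <= T. *)
Definition is_signature_path (gam : R -> R) (p T : R)
    (X S : R -> R -> tseries) : Prop :=
  [/\ forall s t, 0 <= s -> s <= t -> t <= T ->
        truncate (Num.truncn p) (S s t) = X s t,
      forall s u t, 0 <= s -> s <= u -> u <= t -> t <= T ->
        tmul (S s u) (S u t) = S s t &
      is_controlled gam p T predT S].

Definition is_RS_integral (f g : R -> R) (a b I : R) : Prop :=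
  forall eps, 0 < eps -> exists2 delta, 0 < delta &
    forall (n : nat) (t xi : nat -> R),
      t 0%N = a -> t n = b ->
      (forall i, (i < n)%N ->
         [/\ t i <= xi i, xi i <= t i.+1 & t i.+1 - t i < delta]) ->
      `|\sum_(0 <= i < n) f (xi i) * (g (t i.+1) - g (t i)) - I| < eps.

Definition RS_integral (f g : R -> R) (a b : R) : R :=
  get (is_RS_integral f g a b).

(* The word is read from its last letter, which is the outermost integral. *)
Fixpoint iterated_integral (X : R -> 'rV[R]_d) (w : seq 'I_d) (s t : R) : R :=
  match w with
  | [::] => 1
  | i :: w' => RS_integral (fun u => iterated_integral X w' s u)
                           (fun u => X u ord0 i) s t
  end.

Definition bv_signature (X : R -> 'rV[R]_d) (s t : R) : tseries :=
  fun w => iterated_integral X (rev w) s t.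

Definition is_continuous_bv (T : R) (X : R -> 'rV[R]_d) : Prop :=
  forall i, {within `[0, T], continuous (fun t => X t ord0 i)} /\
            bounded_variation 0 T (fun t => X t ord0 i).

(* Sum over the dissection 0 = t_0 < ... < t_m = T with [D = [:: t_1; ...; t_m]]
   of the p/n-th powers of the level-n differences. *)
Definition pvar_sum (p T : R) (X Y : R -> R -> tseries) (n : nat) (D : seq R) :
    R :=
  let t := nth T (0 :: D) in
  \sum_(0 <= j < size D)
     pnorm (level (X (t j) (t j.+1) \- Y (t j) (t j.+1)) n) `^ (p / n%:R).

Definition pvar_distance (p T : R) (X Y : R -> R -> tseries) : \bar R :=
  ((\sum_(1 <= n < (Num.truncn p).+1)
      ereal_sup [set (pvar_sum p T X Y n D)%:E | D in itv_partition 0%R T])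
     `^ p^-1)%E.

Definition is_geometric_rough_path (gam : R -> R) (p T : R)
    (X : R -> R -> tseries) : Prop :=
  is_rough_path gam p T X /\
  forall eps, 0 < eps -> exists2 x : R -> 'rV[R]_d, is_continuous_bv T x &
    (pvar_distance p T X
       (fun s t => truncate (Num.truncn p) (bv_signature x s t)) < eps%:E)%E.

End RoughPaths.

(* Since the interval [0, T(omega)] may be random, the measurability of the
   path is expressed through the paths stopped at T(omega). *)
Record random_geometric_rough_path (R : realType) (d : nat) (gam : R -> R)
    (p : R) (dO : measure_display) (Omega : measurableType dO) := {
  rtime : Omega -> R ;
  rpath : Omega -> R -> R -> tseries R d ;
  rsig_path : Omega -> R -> R -> tseries R d ;
  rsig : {mfun Omega >-> Eborel R d} ;
  rtime_gt0 : forall omega, 0 < rtime omega ;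
  rtime_measurable : measurable_fun setT rtime ;
  rpath_geometric : forall omega,
    is_geometric_rough_path gam p (rtime omega) (rpath omega) ;
  rpath_measurable : forall s t w, 0 <= s -> s <= t ->
    measurable_fun setT (fun omega =>
      rpath omega (Num.min s (rtime omega)) (Num.min t (rtime omega)) w) ;
  rsig_pathP : forall omega,
    is_signature_path gam p (rtime omega) (rpath omega) (rsig_path omega) ;
  rsigE : forall omega,
    eseries (rsig omega) = rsig_path omega 0 (rtime omega)
}.

Definition sig_coord (R : realType) (d : nat) (gam : R -> R) (p : R)
    (dO : measure_display) (Omega : measurableType dO)
    (X : random_geometric_rough_path d gam p Omega) (w : seq 'I_d) :
    Omega -> R :=
  fun omega => eseries (rsig X omega) w.

Section ExpectedSignature.
Variables (R : realType) (d : nat) (gam : R -> R) (p : R).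
Variables (dO : measure_display) (Omega : measurableType dO).
Variables (P : probability Omega R).
Variable X : random_geometric_rough_path d gam p Omega.

Definition ESig_exists : Prop :=
  forall w, P.-integrable setT (EFin \o sig_coord X w).

(* The component of level 0 is E[1] = 1. *)
Definition ESig : tseries R d := fun w => fine ('E_P[sig_coord X w])%E.

Definition r2 : \bar R :=
  ereal_sup [set lam%:E | lam in [set lam : R | 0 <= lam /\
    cvgn (series (fun n => pnorm (level ESig n) * lam ^+ n))]].

Definition sig_law : set (Eborel R d) -> \bar R := distribution P (rsig X).

End ExpectedSignature.

Section Developments.
Variables (R : realType) (d k : nat).

Definition so : set 'M[R]_k := [set A | A^T = - A].

Definition mx_tensor_power (M : 'rV[R]_d -> 'M[R]_k) n (a : tensor R d n) :
    'M[R]_k :=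
  \sum_(w : n.-tuple 'I_d)
     a w *: \big[mulmx/1%:M]_(i <- w) M (delta_mx ord0 i).

(* The map written M with a tilde: the series converges entrywise on E. *)
Definition development (M : 'rV[R]_d -> 'M[R]_k) (x : Espace R d) : 'M[R]_k :=
  \matrix_(i, j)
    limn (fun N => \sum_(0 <= n < N) mx_tensor_power M (level (eseries x) n) i j).

End Developments.

Definition phi (R : realType) (d k : nat) (gam : R -> R) (p : R)
    (dO : measure_display) (Omega : measurableType dO)
    (P : probability Omega R) (X : random_geometric_rough_path d gam p Omega)
    (M : 'rV[R]_d -> 'M[R]_k) : 'M[R]_k :=
  \matrix_(i, j) fine ('E_P[fun omega => development M (rsig X omega) i j])%E.

Definition real_analytic_on (R : realType) (U : set R) (f : R -> R) : Prop :=
  forall x, U x -> exists (a : nat -> R) (rho : R), 0 < rho /\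
    forall y, `|y - x| < rho ->
      series (fun n => a n * (y - x) ^+ n) @ \oo --> f y.

Definition ROC (R : realType) (d : nat) (gam : R -> R) (p : R)
    (dO : measure_display) (Omega : measurableType dO)
    (P : probability Omega R) (X : random_geometric_rough_path d gam p Omega) :
    Prop :=
  [/\ ESig_exists P X,
      (0 < r2 P X)%E &
      forall (K : set R) (k : nat) (M : {linear 'rV[R]_d -> 'M[R]_k}),
        bounded_set K -> (1 <= k)%N -> (forall v, so (M v)) ->
        exists2 r : R, 0 < r &
          forall lam0, K lam0 -> forall i j,
            real_analytic_on `]lam0 - r, lam0 + r[
              (fun lam => phi P X (fun v => lam *: M v) i j)].

(* Main.v *)
(* For a group-like element x, the square of the coordinate of x at a word w of
   length n is a sum of 4^n coordinates of level 2n (shuffle product).  A positive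
   radius of convergence of the expected signature therefore bounds the first
   absolute moments E|S^w| geometrically in the length of w, so that for small
   lambda expectation and summation can be interchanged in phi(lambda M), which
   thus depends on the expected signature only.  By analytic continuation this
   remains true at lambda = 1, for all antisymmetric M.

   The entries of the developments are bounded by 1 on group-like elements, since
   the development of an antisymmetric M is orthogonal, and they are closed under
   products, since the tensor product of two developments is the development of
   M (x) 1 + 1 (x) M'.  Hence their expectations determine the law on the
   sigma-algebra that they generate.  The coordinate of x at w is a limit of
   rescaled corner entries of developments along a tridiagonal matrix built from
   w, and the coordinates generate the Borel sets of E.

   The signature of a geometric rough path is group-like: the defect of the
   shuffle relation at the lowest level where it could fail is additive in the
   time interval and is bounded by a power greater than 1 of a control, hence
   vanishes. This is applied with p = 1 to bounded variation paths, and then to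
   the limit in p-variation above level p. *)
Require Import Defs.
From HB Require Import structures.
From mathcomp Require Import all_boot all_order all_algebra.
From mathcomp Require Import all_classical all_reals all_analysis.
From mathcomp Require Import measurable_realfun mxtens ring lra.
Import Order.TTheory GRing.Theory Num.Theory.
Import numFieldNormedType.Exports.
Set Implicit Arguments.
Unset Strict Implicit.
Unset Printing Implicit Defensive.
Local Open Scope ring_scope.
Local Open Scope classical_set_scope.

(** * Shuffles and words *)

(** The product formula for developments and their bound by 1 hold only on group-like elements,
    whereas the laws live on E, where the entries of developments are neither bounded by 1 nor
    closed under products. A monotone class argument on E is therefore replaced by one that looks
    only at the values along the two random signatures. It is formulated with multipliers: functions
    such that multiplication by them preserves the equality, under the two laws, of all correlations
    with the entries of developments. Multipliers form an algebra that is closed under limits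
    bounded along the laws, and the iteration of a cubic polynomial that converges to the sign
    function turns an entry f into the indicator of {f > c}.

    Since iterated integrals are defined by Riemann sums, Chen's relation and the factorial-free
    bound om^n for them are derived by identifying each Riemann-Stieltjes integral with an additive
    function of the interval, built from Lebesgue-Stieltjes measures. *)

Section Shuffle.
Variable T : Type.
Implicit Types u v w : seq T.

(** The sum of [F] over all interleavings of the two words, with multiplicity. The letters already
    emitted are stored in [F], so that no formal sums of words occur; the inner [fix] makes the
    recursion on either word structural. *)
Fixpoint shuffle_sum (V : zmodType) u : seq T -> (seq T -> V) -> V :=
  match u with
  | [::] => fun v F => F v
  | a :: u' => fix aux v F :=
      match v with
      | [::] => F u
      | b :: v' => shuffle_sum u' v (fun w => F (a :: w)) +
                   aux v' (fun w => F (b :: w))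
      end
  end.

Arguments shuffle_sum : simpl never.

Lemma shuffle_sum0l (V : zmodType) v (F : seq T -> V) :
  shuffle_sum [::] v F = F v.
Proof. by []. Qed.

Lemma shuffle_sum0r (V : zmodType) u (F : seq T -> V) :
  shuffle_sum u [::] F = F u.
Proof. by case: u. Qed.

Lemma shuffle_sum_cons (V : zmodType) a u b v (F : seq T -> V) :
  shuffle_sum (a :: u) (b :: v) F =
  shuffle_sum u (b :: v) (F \o cons a) + shuffle_sum (a :: u) v (F \o cons b).
Proof. by []. Qed.

Lemma shuffle_ind (P : seq T -> seq T -> Prop) :
  (forall v, P [::] v) -> (forall u, P u [::]) ->
  (forall a u b v, P u (b :: v) -> P (a :: u) v -> P (a :: u) (b :: v)) ->
  forall u v, P u v.
Proof.
move=> P0l P0r Pc; elim=> [//|a u IHu]; elim=> [//|b v IHv].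
by apply: Pc => //; exact: IHu.
Qed.

Lemma eq_shuffle_sum (V : zmodType) u v (F G : seq T -> V) :
  (forall w, size w = (size u + size v)%N -> F w = G w) ->
  shuffle_sum u v F = shuffle_sum u v G.
Proof.
move: u v F G; apply: shuffle_ind => [v|u|a u b v IHu IHv] F G FG.
- by rewrite !shuffle_sum0l FG.
- by rewrite !shuffle_sum0r FG // addn0.
- rewrite !shuffle_sum_cons; congr (_ + _).
  + by apply: IHu => w sw /=; apply: FG; rewrite /= sw.
  + by apply: IHv => w sw /=; apply: FG; rewrite /= sw addnS.
Qed.

Lemma shuffle_sumD (V : zmodType) u v (F G : seq T -> V) :
  shuffle_sum u v (fun w => F w + G w) =
  shuffle_sum u v F + shuffle_sum u v G.
Proof.
move: u v F G; apply: shuffle_ind => [v|u|a u b v IHu IHv] F G.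
- by rewrite !shuffle_sum0l.
- by rewrite !shuffle_sum0r.
- by rewrite !shuffle_sum_cons /comp IHu IHv addrACA.
Qed.

Lemma shuffle_sumMl (R : pzRingType) c u v (F : seq T -> R) :
  shuffle_sum u v (fun w => c * F w) = c * shuffle_sum u v F.
Proof.
move: u v F; apply: shuffle_ind => [v|u|a u b v IHu IHv] F.
- by rewrite !shuffle_sum0l.
- by rewrite !shuffle_sum0r.
- by rewrite !shuffle_sum_cons /comp IHu IHv mulrDr.
Qed.

Lemma shuffle_sumMr (R : pzRingType) c u v (F : seq T -> R) :
  shuffle_sum u v (fun w => F w * c) = shuffle_sum u v F * c.
Proof.
move: u v F; apply: shuffle_ind => [v|u|a u b v IHu IHv] F.
- by rewrite !shuffle_sum0l.
- by rewrite !shuffle_sum0r.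
- by rewrite !shuffle_sum_cons /comp IHu IHv mulrDl.
Qed.

(** The deconcatenation coproduct paired with [F]; [tmul x y] is the case where [F p q] is
    [x p * y q]. *)
Definition split_sum (V : zmodType) (F : seq T -> seq T -> V) w : V :=
  \sum_(0 <= i < (size w).+1) F (take i w) (drop i w).

Lemma split_sum_cons (V : zmodType) (F : seq T -> seq T -> V) a w :
  split_sum F (a :: w) = F [::] (a :: w) + split_sum (F \o cons a) w.
Proof. by rewrite /split_sum /= big_nat_recl. Qed.

(* Deconcatenation is a morphism for the shuffle product. *)
Lemma shuffle_sum_split (V : zmodType) u v (F : seq T -> seq T -> V) :
  shuffle_sum u v (split_sum F) =
  \sum_(0 <= i < (size u).+1) \sum_(0 <= j < (size v).+1)
    shuffle_sum (take i u) (take j v) (fun p =>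
      shuffle_sum (drop i u) (drop j v) (F p)).
Proof.
move: u v F; apply: shuffle_ind => [v|u|a u b v IHu IHv] F.
- by rewrite big_nat1.
- rewrite shuffle_sum0r; apply: eq_bigr => i _.
  by rewrite big_nat1 /= !shuffle_sum0r.
rewrite shuffle_sum_cons.
rewrite (@eq_shuffle_sum _ u (b :: v) (split_sum F \o cons a)
  (fun w => F [::] (a :: w) + split_sum (F \o cons a) w)); last first.
  by move=> w _; exact: split_sum_cons.
rewrite (@eq_shuffle_sum _ (a :: u) v (split_sum F \o cons b)
  (fun w => F [::] (b :: w) + split_sum (F \o cons b) w)); last first.
  by move=> w _; exact: split_sum_cons.
rewrite !shuffle_sumD IHu IHv addrACA -shuffle_sum_cons.
pose A F u v i j := shuffle_sum (take i u) (take j v) (fun p =>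
  shuffle_sum (drop i u) (drop j v) (F p) : V).
have AS0 i : A F (a :: u) (b :: v) i.+1 0%N = A (F \o cons a) u (b :: v) i 0%N.
  by rewrite /A /= !shuffle_sum0r.
have ASS i j : A F (a :: u) (b :: v) i.+1 j.+1 =
    A (F \o cons a) u (b :: v) i j.+1 + A (F \o cons b) (a :: u) v i.+1 j.
  by rewrite /A /= shuffle_sum_cons.
(* The corner i = j = 0, the two edges and the interior are separated: the shuffle recursion applies
   to the two prefixes only in the interior, where neither is empty. *)
have split2 (f : nat -> nat -> V) m n :
    \sum_(0 <= i < m.+1) \sum_(0 <= j < n.+1) f i j = f 0%N 0%N +
    (\sum_(0 <= j < n) f 0%N j.+1 + \sum_(0 <= i < m) f i.+1 0%N +
     \sum_(0 <= i < m) \sum_(0 <= j < n) f i.+1 j.+1).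
  rewrite big_nat_recl // big_nat_recl // -!addrA; congr (_ + (_ + _)).
  by rewrite -big_split; apply: eq_bigr => i _; rewrite big_nat_recl.
rewrite [RHS](split2 (A F (a :: u) (b :: v))); congr (_ + _).
under [X in _ = X + _ + _]eq_bigr => j _ do
  rewrite -/(A (F \o cons b) (a :: u) v 0%N j).
under [X in _ = _ + X + _]eq_bigr => i _ do rewrite AS0.
under [X in _ = _ + _ + X]eq_bigr => i _.
  under eq_bigr => j _ do rewrite ASS.
  rewrite big_split; over.
rewrite big_split [X in _ = _ + X]addrC addrACA [LHS]addrC; congr (_ + _).
- by rewrite [LHS]big_nat_recl.
- rewrite -big_split; apply: eq_bigr => i _.
  by rewrite [LHS]big_nat_recl.
Qed.

(** The adjoint of [shuffle_sum]: every letter of [w] goes to one of two subwords, in 2^n ways. *)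
Fixpoint unshuffle_sum (V : zmodType) w (G : seq T -> seq T -> V) : V :=
  if w is a :: w' then
    unshuffle_sum w' (fun u v => G (a :: u) v) +
    unshuffle_sum w' (fun u v => G u (a :: v))
  else G [::] [::].

End Shuffle.

Section Words.
Variable d : nat.

Fixpoint words n : seq (seq 'I_d) :=
  if n is n'.+1 then [seq c :: w | c <- enum 'I_d, w <- words n'] else [:: [::]].

Lemma big_words0 (V : zmodType) (F : seq 'I_d -> V) :
  \sum_(w <- words 0) F w = F [::].
Proof. by rewrite big_seq1. Qed.

Lemma big_wordsS (V : zmodType) n (F : seq 'I_d -> V) :
  \sum_(w <- words n.+1) F w = \sum_c \sum_(w <- words n) F (c :: w).
Proof. by rewrite /= big_allpairs_dep /= big_enum. Qed.

Lemma mem_words n w : (w \in words n) = (size w == n).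
Proof.
elim: n w => [|n IHn] [|c w] /=; rewrite ?inE //.
- by apply/negbTE/allpairsPdep => -[x [y [_ _]]].
- rewrite eqSS -IHn; apply/allpairsPdep/idP => [[x [y [_ yw [_ ->]]]]//|wn].
  by exists c, w; rewrite mem_enum.
Qed.

Lemma words_uniq n : uniq (words n).
Proof.
elim: n => //= n IHn; apply: allpairs_uniq_dep => //; first exact: enum_uniq.
by move=> [a x] [b y] _ _ /= [-> ->].
Qed.

Lemma size_words n : size (words n) = (d ^ n)%N.
Proof. by elim: n => //= n IHn; rewrite size_allpairs IHn size_enum_ord expnS. Qed.

Lemma big_tuple_words (V : zmodType) n (F : seq 'I_d -> V) :
  \sum_(w : n.-tuple 'I_d) F w = \sum_(w <- words n) F w.
Proof.
rewrite -big_enum -(big_map val xpredT F) /=; apply: perm_big.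
apply: uniq_perm; [|exact: words_uniq|].
- by rewrite map_inj_uniq ?enum_uniq //; exact: val_inj.
- move=> w; rewrite mem_words; apply/mapP/eqP => [[t _ ->]|sw].
    by rewrite size_tuple.
  by exists (tcast sw (in_tuple w)); rewrite ?mem_enum //= val_tcast.
Qed.

(** Both sides pair [F w] with [G u v] once for every way of interleaving [u] and [v] into [w]. *)
Lemma big_words_unshuffle (R : pzRingType) (V : lmodType R) n
    (F : seq 'I_d -> R) (G : seq 'I_d -> seq 'I_d -> V) :
  \sum_(w <- words n) F w *: unshuffle_sum w G =
  \sum_(0 <= a < n.+1) \sum_(u <- words a) \sum_(v <- words (n - a))
    shuffle_sum u v F *: G u v.
Proof.
elim: n F G => [|n IHn] F G.
  by rewrite big_words0 big_nat1 !big_words0.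
rewrite big_wordsS.
transitivity (\sum_c \sum_(0 <= a < n.+1) \sum_(u <- words a)
    \sum_(v <- words (n - a)) shuffle_sum u v (F \o cons c) *: G (c :: u) v +
  \sum_c \sum_(0 <= a < n.+1) \sum_(u <- words a)
    \sum_(v <- words (n - a)) shuffle_sum u v (F \o cons c) *: G u (c :: v)).
  rewrite -big_split /=; apply: eq_bigr => c _.
  under eq_bigr => w _ do rewrite scalerDr.
  by rewrite big_split /= !(IHn (F \o cons c)).
(* [L] and [Q] collect the shuffles whose first letter comes from [u] and from [v] respectively;
   they are 0 if that word is empty. *)
pose L u v := if u is c :: u' then shuffle_sum u' v (F \o cons c) else 0.
pose Q u v := if v is c :: v' then shuffle_sum u v' (F \o cons c) else 0.
transitivity (\sum_(0 <= a < n.+2) \sum_(u <- words a)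
    \sum_(v <- words (n.+1 - a)) L u v *: G u v +
  \sum_(0 <= a < n.+2) \sum_(u <- words a)
    \sum_(v <- words (n.+1 - a)) Q u v *: G u v); last first.
  rewrite -big_split; apply: eq_big_nat => a /andP[_ an] /=.
  rewrite -big_split; apply: eq_big_seq => u /=; rewrite mem_words => /eqP su.
  rewrite -big_split; apply: eq_big_seq => v /=; rewrite mem_words => /eqP sv.
  rewrite -scalerDl; congr (_ *: _).
  case: u su => [|b u] su; case: v sv => [|c v] sv; rewrite /L /Q ?add0r //.
  - by move: an; rewrite -su subn0 in sv *.
  - by rewrite !shuffle_sum0r addr0.
congr (_ + _).
- rewrite [RHS]big_nat_recl // [X in _ = X + _]big1_seq ?add0r; last first.
    move=> u; rewrite mem_words => /andP[_ /nilP ->] /=.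
    by apply: big1 => v _; rewrite scale0r.
  rewrite exchange_big; apply: eq_bigr => a _ /=.
  by rewrite big_wordsS.
- rewrite [RHS]big_nat_recr //= [X in _ = _ + X]big1 ?addr0; last first.
    by move=> u _; rewrite subnn big_words0 scale0r.
  rewrite exchange_big; apply: eq_big_nat => a /andP[_ an] /=.
  rewrite exchange_big; apply: eq_bigr => u _ /=.
  by rewrite subSn // big_wordsS.
Qed.

End Words.

(** * Additive defects and the shuffle relation *)

Section AdditiveDefect.
Variable R : realType.

(** Compactness of the interval as an induction principle. At the supremum c of the t with [Q a t],
    a short interval around c can be glued on, which carries [Q a] beyond c unless c = b. *)
Lemma cousin (a b : R) (Q : R -> R -> Prop) : a <= b ->
  (forall s r t, a <= s -> s <= r -> r <= t -> t <= b ->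
    Q s r -> Q r t -> Q s t) ->
  (forall r, a <= r -> r <= b -> exists2 delta, 0 < delta &
    forall s t, a <= s -> s <= r -> r <= t -> t <= b -> t - s < delta -> Q s t) ->
  Q a b.
Proof.
move=> ab Qtrans Qloc.
pose S := [set t | a <= t <= b /\ Q a t].
have Sa : S a.
  split; first by rewrite lexx.
  have [del del0 h] := Qloc a (lexx a) ab.
  by apply: h => //; rewrite subrr.
have supS : has_sup S by split; [exists a|exists b => t [/andP[]]].
set c := sup S.
have ac : a <= c by apply: ub_le_sup; [exact: supS.2|].
have cb : c <= b by apply: ge_sup; [exists a|move=> t [/andP[]]].
have [del del0 h] := Qloc c ac cb.
have [t [/andP[at_ tb] Qat] ct] : exists2 t, S t & c - del / 2 < t.
  by apply: sup_adherent => //; rewrite divr_gt0.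
have tc : t <= c by apply: ub_le_sup; [exact: supS.2|split => //; rewrite at_].
pose t' := Num.min b (c + del / 4).
have ct' : c <= t' by rewrite le_min cb /=; lra.
have t'b : t' <= b by rewrite ge_min lexx.
have t'c : t' <= c + del / 4 by rewrite ge_min lexx orbT.
have Qat' : Q a t'.
  apply: (Qtrans a t) => //; first by rewrite (le_trans tc).
  by apply: h => //; lra.
have : t' <= c.
  by apply: ub_le_sup; [exact: supS.2|split => //; rewrite t'b (le_trans ac)].
rewrite ge_min => /orP[bc|]; last by lra.
by have <- : t' = b by apply/eqP; rewrite eq_le t'b (le_trans bc).
Qed.

Definition small_near_diag (T : R) (om : R -> R -> R) :=
  forall r eps, 0 <= r -> r <= T -> 0 < eps -> exists2 delta, 0 < delta &
    forall s t, 0 <= s -> s <= r -> r <= t -> t <= T -> t - s < delta ->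
      om s t < eps.

Definition superadditive (T : R) (om : R -> R -> R) :=
  forall s u t, 0 <= s -> s <= u -> u <= t -> t <= T -> om s u + om u t <= om s t.

Definition nonneg_on (T : R) (om : R -> R -> R) :=
  forall s t, 0 <= s -> s <= t -> t <= T -> 0 <= om s t.

(** On short intervals om^theta is a small multiple of om because theta > 1. The bound of |D| by eps
    * om glues by additivity of [D] and superadditivity of [om], hence holds on every interval for
    every eps. *)
Lemma additive_defect_eq0 (T : R) (om : R -> R -> R) (theta C : R)
    (D : R -> R -> R) :
  nonneg_on T om -> superadditive T om -> small_near_diag T om ->
  1 < theta -> 0 <= C ->
  (forall s u t, 0 <= s -> s <= u -> u <= t -> t <= T -> D s t = D s u + D u t) ->
  (forall s t, 0 <= s -> s <= t -> t <= T -> `|D s t| <= C * om s t `^ theta) ->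
  forall s t, 0 <= s -> s <= t -> t <= T -> D s t = 0.
Proof.
move=> om0 omD oms th1 C0 Dadd Dbd a b a0 ab bT.
have key eps : 0 < eps -> `|D a b| <= eps * om a b.
  move=> eps0; apply: (@cousin a b (fun s t => `|D s t| <= eps * om s t)) => //.
    move=> s r t as_ sr rt tb h1 h2.
    have s0 := le_trans a0 as_; have tT := le_trans tb bT.
    rewrite (Dadd s r t) //; apply: le_trans (ler_normD _ _) _.
    apply: le_trans (lerD h1 h2) _; rewrite -mulrDr ler_wpM2l ?(ltW eps0) //.
    exact: omD.
  move=> r ar rb.
  (* Chosen so that om < eta implies C * om^(theta - 1) <= eps; C + 1 avoids a division by 0. *)
  pose eta := (eps / (C + 1)) `^ (theta - 1)^-1.
  have C1 : 0 < C + 1 by rewrite ltr_wpDl.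
  have eta0 : 0 < eta by rewrite powR_gt0 // divr_gt0.
  have [del del0 h] := oms r eta (le_trans a0 ar) (le_trans rb bT) eta0.
  exists del => // s t as_ sr rt tb ts.
  have s0 := le_trans a0 as_; have tT := le_trans tb bT.
  have st := le_trans sr rt.
  apply: le_trans (Dbd s t s0 st tT) _.
  have o0 := om0 s t s0 st tT.
  have oeta := h s t s0 sr rt tT ts.
  have [->|on0] := eqVneq (om s t) 0.
    by rewrite powR0 ?mulr0 // gt_eqF // (lt_trans _ th1).
  rewrite -[theta](subrK 1) powRD; last by rewrite on0 implybT.
  rewrite powRr1 // mulrA ler_wpM2r //.
  apply: (@le_trans _ _ (C * (eps / (C + 1)))).
    apply: ler_wpM2l => //.
    apply: (@le_trans _ _ (eta `^ (theta - 1))).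
      by apply: ge0_ler_powR; rewrite ?nnegrE ?(ltW eta0) ?(ltW oeta) ?subr_ge0 ?(ltW th1).
    rewrite /eta -powRrM mulVf ?powRr1 ?(ltW (divr_gt0 _ _)) //.
    by rewrite gt_eqF // subr_gt0.
  rewrite mulrCA ger_pMr // ler_pdivrMr // mul1r; lra.
apply/eqP; rewrite -normr_le0; apply/ler_addgt0Pl => e e0; rewrite addr0.
have o1 : 0 < om a b + 1 by rewrite ltr_wpDl // om0.
apply: le_trans (key (e / (om a b + 1)) _) _; first by rewrite divr_gt0.
rewrite -mulrA ger_pMr // mulrC ler_pdivrMr // mul1r; lra.
Qed.

End AdditiveDefect.

(** * Group-like elements and propagation of the shuffle relation to higher levels *)

Section GroupLike.
Variables (R : realType) (d : nat).
Implicit Types (x y : tseries R d) (u v w : seq 'I_d).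

(** The recursion branches in two at each letter, so there are at most 2^(|u| + |v|) shuffles. *)
Lemma ler_norm_shuffle_sum u v (F : seq 'I_d -> R) M :
  (forall w, size w = (size u + size v)%N -> `|F w| <= M) ->
  `|shuffle_sum u v F| <= 2 ^+ (size u + size v) * M.
Proof.
have M0 n (G : seq 'I_d -> R) (w : seq 'I_d) M' : size w = n -> (forall w, size w = n -> `|G w| <= M') ->
    `|G w| <= 2 ^+ n * M'.
  move=> sw h; apply: le_trans (h _ sw) _; rewrite ler_peMl ?exprn_ege1 ?ler1n //.
  exact: le_trans (h _ sw).
move: u v F M; apply: shuffle_ind => [v|u|a u b v IHu IHv] F M h.
- by rewrite shuffle_sum0l; exact: M0.
- by rewrite shuffle_sum0r; apply: M0; rewrite ?addn0 // => w sw; apply: h; rewrite addn0.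
- rewrite shuffle_sum_cons; apply: le_trans (ler_normD _ _) _.
  rewrite -[(size (a :: u) + size (b :: v))%N]/(size u + size (b :: v)).+1.
  rewrite exprS -mulrA mulr2n mulrDl mul1r; apply: lerD.
    by apply: IHu => w sw; apply: h; rewrite /= sw.
  have -> : (size u + size (b :: v) = size (a :: u) + size v)%N.
    by rewrite /= addnS.
  by apply: IHv => w sw; apply: h; rewrite /= sw addnS.
Qed.

Definition group_like x :=
  x [::] = 1 /\ forall u v, x u * x v = shuffle_sum u v x.

Lemma shuffle_sum_tmul x y u v :
  shuffle_sum u v (tmul x y) =
  \sum_(0 <= i < (size u).+1) \sum_(0 <= j < (size v).+1)
    shuffle_sum (take i u) (take j v) x * shuffle_sum (drop i u) (drop j v) y.
Proof.
rewrite -[tmul x y]/(split_sum (fun p q => x p * y q)) shuffle_sum_split.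
apply: eq_bigr => i _; apply: eq_bigr => j _.
under [X in shuffle_sum _ _ X]eq_fun => p do rewrite shuffle_sumMl.
by rewrite shuffle_sumMr.
Qed.

Lemma big_nat_pair1 (f : nat -> nat -> R) m n a b : (a <= m)%N -> (b <= n)%N ->
  (forall i j, (i <= m)%N -> (j <= n)%N -> (i, j) != (a, b) -> f i j = 0) ->
  \sum_(0 <= i < m.+1) \sum_(0 <= j < n.+1) f i j = f a b.
Proof.
move=> am bn h.
have row i : (i <= m)%N -> i != a -> \sum_(0 <= j < n.+1) f i j = 0.
  move=> im ia; apply: big1_seq => j; rewrite mem_index_iota => /andP[_ /andP[_ jn]].
  by apply: h => //; rewrite xpair_eqE negb_and ia.
rewrite (bigD1_seq a) ?mem_index_iota ?iota_uniq //=.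
rewrite [X in _ + X]big1_seq ?addr0; last first.
  by move=> i /andP[ia]; rewrite mem_index_iota => /andP[_ im]; exact: row.
rewrite (bigD1_seq b) ?mem_index_iota ?iota_uniq //=.
rewrite [X in _ + X]big1_seq ?addr0 // => j /andP[jb].
rewrite mem_index_iota => /andP[_ jn]; apply: h => //.
by rewrite xpair_eqE negb_and jb orbT.
Qed.

Definition defect x u v := x u * x v - shuffle_sum u v x.

(** For each pair of cuts of [u] and [v], the difference of products splits into a defect of [x] on
    the prefixes and a defect of [y] on the suffixes. The defects of shorter pairs vanish by
    hypothesis, which leaves the full prefixes and the full suffixes. *)
Lemma defect_tmul x y u v : x [::] = 1 -> y [::] = 1 ->
  (forall u' v', (size u' + size v' < size u + size v)%N ->
    defect x u' v' = 0 /\ defect y u' v' = 0) ->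
  defect (tmul x y) u v = defect x u v + defect y u v.
Proof.
move=> x1 y1 h.
rewrite {1}/defect shuffle_sum_tmul {1 2}/tmul big_distrlr /= -sumrB.
under eq_bigr => i _ do rewrite -sumrB.
transitivity (\sum_(0 <= i < (size u).+1) \sum_(0 <= j < (size v).+1)
   defect x (take i u) (take j v) * (y (drop i u) * y (drop j v)) +
   \sum_(0 <= i < (size u).+1) \sum_(0 <= j < (size v).+1)
   shuffle_sum (take i u) (take j v) x * defect y (drop i u) (drop j v)).
  rewrite -big_split; apply: eq_bigr => i _; rewrite -big_split.
  by apply: eq_bigr => j _ /=; rewrite /defect; ring.
rewrite (@big_nat_pair1 _ _ _ (size u) (size v)) //; last first.
  move=> i j iu jv ij; rewrite (h _ _ _).1 ?mul0r // !size_takel //.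
  move: ij; rewrite xpair_eqE negb_and => /orP[] ij.
    by rewrite -addSn leq_add // ltn_neqAle ij.
  by rewrite -addnS leq_add // ltn_neqAle ij.
rewrite (@big_nat_pair1 _ _ _ 0 0) //; last first.
  move=> i j iu jv ij; rewrite (h _ _ _).2 ?mulr0 // !size_drop.
  have [i0|] := posnP i; have [j0|] := posnP j.
  - by rewrite i0 j0 in ij.
  - by move=> j0; rewrite i0 subn0 ltn_add2l ltn_subrL j0 (leq_trans j0).
  - by move=> i0; rewrite j0 subn0 ltn_add2r ltn_subrL i0 (leq_trans i0).
  - move=> j0 i0; rewrite -addSn leq_add ?leq_subr //.
    by rewrite ltn_subrL i0 (leq_trans i0).
by rewrite !take_size !drop_size !take0 !drop0 y1 shuffle_sum0l x1 !mul1r !mulr1.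
Qed.

Lemma group_like_ext (T : R) (S : R -> R -> tseries R d) (om : R -> R -> R)
    (p : R) (N : nat) (C : nat -> R) :
  0 < p -> p < N.+1%:R ->
  nonneg_on T om -> superadditive T om -> small_near_diag T om ->
  (forall s r t, 0 <= s -> s <= r -> r <= t -> t <= T ->
    tmul (S s r) (S r t) = S s t) ->
  (forall s t, 0 <= s -> s <= t -> t <= T -> S s t [::] = 1) ->
  (forall s t u v, 0 <= s -> s <= t -> t <= T -> (size u + size v <= N)%N ->
    S s t u * S s t v = shuffle_sum u v (S s t)) ->
  (forall s t w, 0 <= s -> s <= t -> t <= T -> (0 < size w)%N ->
    `|S s t w| <= C (size w) * om s t `^ ((size w)%:R / p)) ->
  forall s t, 0 <= s -> s <= t -> t <= T -> group_like (S s t).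
Proof.
move=> p0 pN om0 omD oms chen S1 low bd.
suff H n u v s t : (size u + size v)%N = n -> 0 <= s -> s <= t -> t <= T ->
    defect (S s t) u v = 0.
  move=> s t s0 st tT; split; first exact: S1.
  by move=> u v; apply/eqP; rewrite -subr_eq0; apply/eqP; exact: H.
elim/ltn_ind: n u v s t => n IHn u v s t uvn.
have [nN|Nn] := leqP n N.
  by move=> s0 st tT; rewrite /defect low ?subrr // uvn.
(* The bounds [bd] start at level 1, so pairs with an empty word, for which the relation is trivial,
   are removed before they are used. *)
have defect_nil x : x [::] = 1 -> size u = 0%N \/ size v = 0%N -> defect x u v = 0.
  move=> x1 [/size0nil ->|/size0nil ->]; rewrite /defect x1.
    by rewrite mul1r shuffle_sum0l subrr.
  by rewrite mulr1 shuffle_sum0r subrr.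
have [u0|u0] := posnP (size u).
  by move=> s0 st tT; apply: defect_nil; [exact: S1|left].
have [v0|v0] := posnP (size v).
  by move=> s0 st tT; apply: defect_nil; [exact: S1|right].
have np : 1 < n%:R / p.
  by rewrite ltr_pdivlMr // mul1r (lt_le_trans pN) // ler_nat.
(* One summand for each half of the defect: the product of two coordinates, and at most 2^n
   coordinates of level n. *)
pose K := `|C (size u)| * `|C (size v)| + 2 ^+ n * `|C n|.
move: s t; apply: (@additive_defect_eq0 _ T om (n%:R / p) K) => //.
- by rewrite addr_ge0 // mulr_ge0 // exprn_ge0.
- move=> s r t s0 sr rt tT; have st := le_trans sr rt.
  rewrite -(chen s r t) // defect_tmul //.
  + by apply: S1 => //; exact: le_trans rt tT.
  + by apply: S1 => //; exact: le_trans s0 sr.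
  + move=> u' v'; rewrite uvn => h; split; apply: (IHn _ h) => //.
      exact: le_trans rt tT.
    exact: le_trans s0 sr.
- move=> s t s0 st tT; apply: le_trans (ler_normB _ _) _.
  have bd' w : (0 < size w)%N ->
      `|S s t w| <= `|C (size w)| * om s t `^ ((size w)%:R / p).
    move=> w0; apply: le_trans (bd s t w s0 st tT w0) _.
    by rewrite ler_wpM2r ?powR_ge0 // ler_norm.
  rewrite /K mulrDl; apply: lerD.
    rewrite normrM; apply: le_trans (ler_pM _ _ (bd' u u0) (bd' v v0)) _ => //.
    rewrite mulrACA -powRD; last first.
      by rewrite gt_eqF ?implybT // addr_gt0 ?divr_gt0 ?ltr0n.
    by rewrite -mulrDl -natrD uvn.
  rewrite -mulrA -uvn; apply: ler_norm_shuffle_sum => w sw.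
  by rewrite -sw; apply: bd'; rewrite sw addn_gt0 u0.
Qed.

End GroupLike.

(** * Projective norms and controls *)

Section ProjectiveNorm.
Variables (R : realType) (d n : nat).
Implicit Types a b : tensor R d n.

Lemma enorm_ge0 (v : 'rV[R]_d) : 0 <= enorm v.
Proof. exact: sqrtr_ge0. Qed.

Lemma enorm_delta i : enorm (delta_mx ord0 i : 'rV[R]_d) = 1.
Proof.
rewrite /enorm (bigD1 i) //= big1 ?addr0 => [|j ji].
  by rewrite mxE !eqxx expr1n sqrtr1.
by rewrite mxE (negbTE ji) andbF expr0n.
Qed.

Lemma ler_norm_coord_enorm (v : 'rV[R]_d) i : `|v ord0 i| <= enorm v.
Proof.
rewrite -sqrtr_sqr ler_sqrt; last by apply: sumr_ge0 => j _; exact: sqr_ge0.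
by rewrite (bigD1 i) //= lerDl; apply: sumr_ge0 => j _; exact: sqr_ge0.
Qed.

(** The expansion in basis tensors, whose factors have Euclidean norm 1. It also shows that the
    infimum in [pnorm] is taken over a nonempty set. *)
Lemma pnorm_reprs_l1 a : pnorm_reprs a (\sum_w `|a w|).
Proof.
exists #|{: n.-tuple 'I_d}|, (fun j => a (enum_val j)),
  (fun j i => delta_mx ord0 (tnth (enum_val j) i)); split.
  move=> w; rewrite -(big_enum_val (fun u : n.-tuple 'I_d => a u *
    \prod_i (delta_mx ord0 (tnth u i) : 'rV[R]_d) ord0 (tnth w i))) /=.
  rewrite (bigD1 w) //= [X in _ = _ + X]big1 ?addr0 => [|u uw].
    by rewrite big1 ?mulr1 // => i _; rewrite mxE !eqxx.
  have [i uwi] : exists i, tnth u i != tnth w i.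
    apply/existsP; apply: contraR uw => /existsPn h.
    by apply/eqP/eq_from_tnth => i; have := h i; rewrite negbK => /eqP.
  by rewrite (bigD1 i) //= mxE eq_sym (negbTE uwi) andbF mul0r mulr0.
rewrite -(big_enum_val (fun u : n.-tuple 'I_d => `|a u| *
    \prod_i enorm (delta_mx ord0 (tnth u i) : 'rV[R]_d))) /=.
apply: eq_bigr => u _; rewrite big1 ?mulr1 // => i _; exact: enorm_delta.
Qed.

Lemma pnorm_reprs_ge a c w : pnorm_reprs a c -> `|a w| <= c.
Proof.
move=> [m [l [v [-> ->]]]]; apply: le_trans (ler_norm_sum _ _ _) _.
apply: ler_sum => j _; rewrite normrM ler_wpM2l // normr_prod.
by apply: ler_prod => i _; rewrite normr_ge0 ler_norm_coord_enorm.
Qed.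

Lemma pnorm_reprs_ge0 a c : pnorm_reprs a c -> 0 <= c.
Proof.
move=> [m [l [v [_ ->]]]]; apply: sumr_ge0 => j _.
by rewrite mulr_ge0 // prodr_ge0 // => i _; exact: enorm_ge0.
Qed.

Lemma pnorm_ge0 a : 0 <= pnorm a.
Proof.
by apply: lb_le_inf => [|c /pnorm_reprs_ge0//]; exists (\sum_w `|a w|); exact: pnorm_reprs_l1.
Qed.

Lemma ler_coord_pnorm a w : `|a w| <= pnorm a.
Proof.
by apply: lb_le_inf => [|c /pnorm_reprs_ge//]; exists (\sum_w `|a w|); exact: pnorm_reprs_l1.
Qed.

Lemma pnorm_le_l1 a : pnorm a <= \sum_w `|a w|.
Proof.
apply: ge_inf; last exact: pnorm_reprs_l1.
by exists 0 => c /pnorm_reprs_ge0.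
Qed.

End ProjectiveNorm.

Section Levels.
Variables (R : realType) (d : nat).
Implicit Types x : tseries R d.

Lemma ler_coord_level x w : `|x w| <= pnorm (level x (size w)).
Proof. exact: (ler_coord_pnorm (level x (size w)) (in_tuple w)). Qed.

Lemma pnorm_level_le x n : pnorm (level x n) <= \sum_(w <- words d n) `|x w|.
Proof.
rewrite -(big_tuple_words n (fun w => `|x w|)); exact: pnorm_le_l1.
Qed.

End Levels.

(** * Positivity of the Gamma function *)

Section Gamma.
Variable R : realType.
Notation mu := (@lebesgue_measure R).

(** The inequality y <= e^y at y = t / (2a), raised to the power a. *)
Lemma powR_le_expR (a t : R) : 0 < a -> 0 <= t ->
  t `^ a <= (2 * a) `^ a * expR (t / 2).
Proof.
move=> a0 t0; have a20 : 0 < 2 * a by rewrite mulr_gt0.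
have -> : expR (t / 2) = expR (t / (2 * a)) `^ a.
  rewrite /powR gt_eqF ?expR_gt0 // expRK; congr expR.
  by field; rewrite gt_eqF.
rewrite -powRM ?(ltW a20) ?expR_ge0 //.
apply: ge0_ler_powR; rewrite ?nnegrE ?mulr_ge0 ?expR_ge0 ?(ltW a20) ?(ltW a0) //.
rewrite -ler_pdivrMl // mulrC; apply: le_trans (expR_ge1Dx _).
by rewrite ler_wpDl.
Qed.

(** A divergent integral would have the real value 0, so finiteness has to be shown too: a multiple
    of the exponential density of rate 1/2 dominates the integrand. On ]1, 2[ the integrand is at
    least e^(-2). *)
Lemma Gamma_fun_gt0 (a : R) : 0 <= a -> 0 < Gamma_fun (a + 1).
Proof.
move=> a0; rewrite /Gamma_fun addrK.
set f := fun t : R => t `^ a * expR (- t).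
have f0 t : 0 <= f t by rewrite mulr_ge0 ?powR_ge0 ?expR_ge0.
have mf (D : set R) : measurable_fun D (fun t => (f t)%:E).
  apply: measurable_funTS; apply/measurable_EFinP; apply: measurable_funM.
    exact: measurable_powR.
  by apply: (measurableT_comp (@measurable_expR R)); exact: oppr_measurable.
have mI : measurable (`]0, +oo[ : set R) by exact: measurable_itv.
have [K K0 fK] : exists2 K : R, 0 <= K & forall t, 0 <= t -> f t <= K * expR (- (t / 2)).
  have [a00|an0] := eqVneq a 0.
    exists 1 => // t t0; rewrite /f a00 powRr0 !mul1r ler_expR lerN2.
    by rewrite ler_pdivrMr // ler_peMr // ler1n.
  exists ((2 * a) `^ a); first exact: powR_ge0.
  move=> t t0; have {}an0 : 0 < a by rewrite lt_neqAle eq_sym an0.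
  apply: (@le_trans _ _ ((2 * a) `^ a * expR (t / 2) * expR (- t))).
    by rewrite ler_wpM2r ?expR_ge0 // powR_le_expR.
  rewrite -mulrA -expRD; apply: ler_wpM2l; first exact: powR_ge0.
  by rewrite ler_expR; lra.
have intf : mu.-integrable `]0, +oo[ (EFin \o f).
  apply: (@le_integrable _ _ _ mu _ mI _
    (fun t => ((2 * K)%:E * (exponential_pdf 2^-1 t)%:E)%E)).
  - exact: mf.
  - move=> t /=; rewrite in_itv /= andbT => t0.
    rewrite exponential_pdfE ?(ltW t0) // lee_fin ger0_norm //.
    rewrite ger0_norm; last by rewrite !mulr_ge0 ?expR_ge0 // invr_ge0.
    apply: le_trans (fK t (ltW t0)) _.
    rewrite mulrA [2 * K * _](_ : _ = K); last by field.
    by rewrite mulNr [t / 2]mulrC.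
  - apply: integrableZl => //; apply: (@integrableS _ _ _ _ setT) => //.
    by apply: integrable_exponential_pdf; rewrite invr_gt0.
rewrite /Rintegral fine_gt0 //; apply/andP; split; last first.
  by rewrite ltey; have := integrable_fin_num _ intf; rewrite fin_numE => /(_ mI)/andP[].
have mJ : measurable (`]1, 2[ : set R) by exact: measurable_itv.
apply: (@lt_le_trans _ _ (\int[mu]_(x in `]1%R, 2%R[) (expR (- 2))%:E)%E).
  rewrite integral_cst //.
  have mE : lebesgue_measure (`]1, 2[ : set R) = 1%:E.
    by rewrite lebesgue_measure_itv /= lte_fin ltr1n -EFinD; congr EFin; lra.
  by rewrite [X in (_ * X)%E](_ : _ = 1%:E) // mule1 lte_fin expR_gt0.
apply: (@le_trans _ _ (\int[mu]_(x in `]1%R, 2%R[) (f x)%:E)%E).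
  apply: ge0_le_integral => //.
  - exact: mf.
  - move=> t /=; rewrite in_itv /= lee_fin => /andP[t1 t2].
    apply: (@le_trans _ _ (1 * expR (- t))); first by rewrite mul1r ler_expR; lra.
    rewrite ler_wpM2r ?expR_ge0 // -[1](@powRr0 _ t).
    by rewrite ler_powR // ltW.
apply: ge0_subset_integral => //; first exact: mf.
  by move=> t _; rewrite lee_fin.
by apply: subset_itv; rewrite bnd_simp.
Qed.

Lemma frac_fact_gt0 (p : R) n : 1 <= p -> 0 < frac_fact p n.
Proof.
by move=> p1; apply: Gamma_fun_gt0; rewrite divr_ge0 // (le_trans _ p1).
Qed.

End Gamma.

Section Control.
Variables (R : realType) (d : nat).

Lemma is_control_small (T : R) w : is_control T w -> small_near_diag T w.
Proof.
move=> [wc w0 _ wd] r eps r0 rT eps0.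
have rr : simplex T (r, r) by rewrite /simplex /= lexx.
have /subspace_continuousP /(_ _ rr) := wc.
move=> /cvgrPdist_lt /(_ _ eps0); rewrite near_withinE /=.
move=> -[[A B] [[dA /= dA0 hA] [dB /= dB0 hB]] AB].
exists (Num.min dA dB) => [|s t s0 sr rt tT]; first by rewrite lt_min dA0.
rewrite lt_min => /andP[tA tB].
have := AB (s, t); rewrite /from_subspace /= (wd r) // sub0r normrN => h.
apply: le_lt_trans (ler_norm _) (h _ _).
- split; first by apply: hA => /=; rewrite ger0_norm ?subr_ge0 //; lra.
  by apply: hB => /=; rewrite distrC ger0_norm ?subr_ge0 //; lra.
- by split => //; split => //; exact: le_trans rt.
Qed.

Lemma control_bound (gam p w : R) n (a : tensor R d n) : 1 <= p -> 0 < gam ->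
  (0 < n)%N -> (frac_fact p n * gam * pnorm a) `^ (p / n%:R) <= w ->
  pnorm a <= (frac_fact p n * gam)^-1 * w `^ (n%:R / p).
Proof.
move=> p1 gam0 n0 h; have p0 : 0 < p by exact: lt_le_trans p1.
have n0' : 0 < n%:R :> R by rewrite ltr0n.
have K0 : 0 < frac_fact p n * gam by rewrite mulr_gt0 // frac_fact_gt0.
rewrite -ler_pdivrMl ?invr_gt0 // invrK.
rewrite -[leLHS](@powRr1 _ _ _); last by rewrite mulr_ge0 ?pnorm_ge0 // ltW.
have e : (p / n%:R) * (n%:R / p) = 1 by field; rewrite !gt_eqF.
rewrite -[X in _ `^ X <= _]e (powRrM _ (p / n%:R)); apply: ge0_ler_powR => //.
- by rewrite divr_ge0 // ltW.
- by rewrite nnegrE powR_ge0.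
- by rewrite nnegrE (le_trans _ h) // powR_ge0.
Qed.

Lemma signature_path_group_like (gam : R -> R) (p T : R)
    (X S : R -> R -> tseries R d) :
  1 <= p -> 0 < gam p ->
  (forall s t, 0 <= s -> s <= t -> t <= T -> X s t [::] = 1) ->
  is_signature_path gam p T X S ->
  (forall s t u v, 0 <= s -> s <= t -> t <= T ->
    (size u + size v <= Num.truncn p)%N ->
    X s t u * X s t v = shuffle_sum u v (X s t)) ->
  forall s t, 0 <= s -> s <= t -> t <= T -> group_like (S s t).
Proof.
move=> p1 gam0 X1 [SX chen [w [wctrl wb]]] low.
have XS s t u : 0 <= s -> s <= t -> t <= T -> (size u <= Num.truncn p)%N ->
    S s t u = X s t u.
  by move=> s0 st tT su; rewrite -SX // /truncate su.
have p0 : 0 < p by exact: lt_le_trans p1.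
apply: (@group_like_ext _ _ _ _ w p (Num.truncn p)
  (fun n => (frac_fact p n * gam p)^-1)) => //.
- by rewrite truncnS_gt.
- by case: wctrl.
- by case: wctrl.
- exact: is_control_small.
- by move=> s t s0 st tT; rewrite XS // X1.
- move=> s t u v s0 st tT uv; rewrite !XS //; last 2 first.
    exact: leq_trans (leq_addl _ _) uv.
    exact: leq_trans (leq_addr _ _) uv.
  by rewrite low //; apply: eq_shuffle_sum => u' su'; rewrite XS // su'.
- move=> s t u s0 st tT u0; apply: le_trans (ler_coord_level _ _) _.
  by apply: control_bound => //; exact: wb.
Qed.

End Control.

(** * Riemann-Stieltjes integrals *)

Section ContinuousOn.
Variable R : realType.
Implicit Types (a b : R) (f g : R -> R).

Definition continuous_on a b f := forall x eps, a <= x -> x <= b -> 0 < eps ->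
  exists2 delta, 0 < delta &
    forall y, a <= y -> y <= b -> `|y - x| < delta -> `|f y - f x| < eps.

Lemma within_continuous_on a b f :
  {within `[a, b], continuous f} -> continuous_on a b f.
Proof.
move=> /subspace_continuousP fc x eps ax xb eps0.
have /fc/cvgrPdist_lt/(_ _ eps0) : `[a, b] x by rewrite /= in_itv /= ax.
rewrite near_withinE => -[del /= del0 h]; exists del => // y ay yb yx.
rewrite distrC; apply: h; last by rewrite /= in_itv /= ay.
by rewrite /= distrC.
Qed.

Lemma continuous_onS a b a' b' f : a <= a' -> b' <= b ->
  continuous_on a b f -> continuous_on a' b' f.
Proof.
move=> aa' bb' fc x eps ax xb eps0.
have [del del0 h] := fc x eps (le_trans aa' ax) (le_trans xb bb') eps0.
exists del => // y ay yb; apply: h; [exact: le_trans ay|exact: le_trans bb'].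
Qed.

Lemma continuous_on_uniform a b f eps : a <= b -> continuous_on a b f -> 0 < eps ->
  exists2 delta, 0 < delta & forall x y, a <= x -> x <= b -> a <= y -> y <= b ->
    `|y - x| < delta -> `|f y - f x| < eps.
Proof.
move=> ab fc eps0.
(* Only [x] is confined to [s, t]; with [y] ranging over all of [a, b] the property passes through a
   junction point. *)
pose Q s t := exists2 delta, 0 < delta & forall x y, s <= x -> x <= t -> a <= y ->
  y <= b -> `|y - x| < delta -> `|f y - f x| < eps.
suff [del del0 h] : Q a b by exists del => // x y ax xb; exact: h.
apply: cousin => // [s r t as_ sr rt tb [d1 d10 h1] [d2 d20 h2]|r ar rb].
  exists (Num.min d1 d2) => [|x y sx xt ay yb]; first by rewrite lt_min d10.
  rewrite lt_min => /andP[yx1 yx2].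
  by have [xr|rx] := leP x r; [exact: h1|apply: h2 => //; exact: ltW].
have [del del0 h] := fc r (eps / 2) ar rb (divr_gt0 eps0 (ltr0Sn _ 1)).
exists (del / 2) => [|s t as_ sr rt tb st]; first by rewrite divr_gt0.
exists (del / 2) => [|x y sx xt ay yb yx]; first by rewrite divr_gt0.
have xr : `|x - r| < del / 2 by rewrite ltr_norml; apply/andP; split; lra.
have yr : `|y - r| < del.
  by rewrite -(subrK x y) -addrA (le_lt_trans (ler_normD _ _)) //; lra.
have fx : `|f r - f x| < eps / 2.
  rewrite distrC; apply: h; [exact: le_trans sx|exact: le_trans tb|].
  by apply: lt_le_trans xr _; lra.
have fy := h y ay yb yr.
by rewrite -(subrK (f r) (f y)) -addrA (le_lt_trans (ler_normD _ _)) //; lra.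
Qed.

Lemma continuous_on_bounded a b f : a <= b -> continuous_on a b f ->
  exists M, forall x, a <= x -> x <= b -> `|f x| <= M.
Proof.
move=> ab fc.
apply: (@cousin _ a b (fun s t => exists M, forall x, s <= x -> x <= t -> `|f x| <= M)) => //.
  move=> s r t _ sr rt _ [M1 h1] [M2 h2]; exists (Num.max M1 M2) => x sx xt.
  rewrite le_max; have [xr|rx] := leP x r; first by rewrite h1.
  by rewrite h2 ?orbT // ltW.
move=> r ar rb; have [del del0 h] := fc r 1 ar rb ltr01.
exists del => // s t as_ sr rt tb st; exists (`|f r| + 1) => x sx xt.
have : `|f x - f r| < 1.
  apply: h; [exact: le_trans sx|exact: le_trans tb|].
  by rewrite ltr_norml; apply/andP; split; lra.
rewrite -{2}(subrK (f r) (f x)) => fx; apply: le_trans (ler_normD _ _) _; lra.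
Qed.

(** The retraction of the line onto [a, b]. Composition with it extends functions given on [a, b],
    since a Stieltjes measure is built from a function on the whole line. *)
Definition clamp a b (u : R) := Num.max a (Num.min b u).

Lemma clamp_bounds a b u : a <= b -> a <= clamp a b u /\ clamp a b u <= b.
Proof. by move=> ab; rewrite /clamp le_max lexx ge_max ab ge_min lexx. Qed.

Lemma clamp_id a b u : a <= u -> u <= b -> clamp a b u = u.
Proof. by move=> au ub; rewrite /clamp (min_idPr ub) (max_idPr au). Qed.

Lemma clamp_homo a b : {homo clamp a b : u v / u <= v}.
Proof.
move=> u v uv; rewrite /clamp ge_max le_max lexx le_max /=.
by apply/orP; right; rewrite le_min !ge_min lexx uv orbT.
Qed.

Lemma clamp_lip a b u v : `|clamp a b u - clamp a b v| <= `|u - v|.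
Proof.
wlog uv : u v / u <= v.
  move=> H; have [/H//|/ltW/H] := leP u v.
  by rewrite distrC [in leRHS]distrC.
rewrite distrC [leRHS]distrC !ger0_norm ?subr_ge0 ?clamp_homo //.
rewrite /clamp; case: (leP a (Num.min b u)); case: (leP a (Num.min b v));
  by case: (leP b u); case: (leP b v); lra.
Qed.

Lemma continuous_clamp a b f : a <= b -> continuous_on a b f ->
  continuous (f \o clamp a b).
Proof.
move=> ab fc x; apply/cvgrPdist_lt => eps eps0.
have [ax xb] := clamp_bounds x ab.
have [del del0 h] := fc _ _ ax xb eps0.
near=> y; have [ay yb] := clamp_bounds y ab; rewrite distrC /=.
apply: h => //; apply: le_lt_trans (clamp_lip _ _ _ _) _.
rewrite distrC; near: y; exact: cvgr_dist_lt.
Unshelve. all: by end_near. Qed.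

Definition nondecreasing_on a b g := forall x y, a <= x -> x <= y -> y <= b -> g x <= g y.

Lemma lebesgue_stieltjes_itv (G : cumulative R R) s t : s <= t ->
  lebesgue_stieltjes_measure G `]s, t] = (G t - G s)%:E.
Proof.
move=> st; rewrite /lebesgue_stieltjes_measure /measure_extension/=.
by rewrite measurable_mu_extE/= ?wlength_itv_bnd//; exact: is_ocitv.
Qed.

(** [J s t] is the Lebesgue integral of [f] over ]s, t] for the Stieltjes measure of [g]. Additivity
    and the comparison with a constant integrand are what identifies it later as a limit of Riemann
    sums. *)
Lemma stieltjes_primitive a b f g : a <= b -> continuous_on a b f ->
  continuous_on a b g -> nondecreasing_on a b g ->
  exists J : R -> R -> R,
    (forall s r t, a <= s -> s <= r -> r <= t -> t <= b -> J s t = J s r + J r t) /\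
    (forall s t c e, a <= s -> s <= t -> t <= b ->
      (forall x, s <= x -> x <= t -> `|f x - c| <= e) ->
      `|J s t - c * (g t - g s)| <= e * (g t - g s)).
Proof.
move=> ab fc gc gm.
pose G := g \o clamp a b.
have Gc : continuous G by exact: continuous_clamp.
have Gnd : {homo G : x y / x <= y}.
  move=> x y xy; rewrite /G /=; apply: gm.
  - exact: (clamp_bounds x ab).1.
  - exact: clamp_homo.
  - exact: (clamp_bounds y ab).2.
have Grc : right_continuous G by exact: right_continuousW.
pose Gcum : cumulative R R := HB.pack_for (cumulative R R) G
  (isCumulative.Build R _ R G Gnd Grc).
pose mu := lebesgue_stieltjes_measure Gcum.
have muE s t : s <= t -> mu `]s, t] = (G t - G s)%:E.
  exact: lebesgue_stieltjes_itv.
pose F := f \o clamp a b.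
have mF : measurable_fun setT F by apply: continuous_measurable_fun; exact: continuous_clamp.
have [M FM] := continuous_on_bounded ab fc.
have intF s t : s <= t -> mu.-integrable `]s, t] (EFin \o F).
  move=> st; apply: measurable_bounded_integrable.
  - exact: measurable_itv.
  - by rewrite [X in (X < _)%E]muE // ltry.
  - exact: measurable_funTS.
  - exists M; split; first exact: num_real.
    move=> N MN x _; apply: le_trans (ltW MN); have [ax xb] := clamp_bounds x ab.
    exact: FM.
have GE x : a <= x -> x <= b -> G x = g x by move=> ax xb; rewrite /G /= clamp_id.
exists (fun s t => \int[mu]_(x in `]s, t]) F x); split.
  move=> s r t as_ sr rt tb.
  have E : `]s, t]%classic = `]s, r] `|` `]r, t] :> set R.
    by apply: itv_bndbnd_setU; rewrite bnd_simp.
  rewrite E Rintegral_setU //.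
  - by rewrite -E; apply: intF; exact: le_trans rt.
  - rewrite disj_set2E; apply/eqP/seteqP; split => // x [] /=.
    by rewrite !in_itv /= => /andP[_ xr] /andP[/lt_le_trans /(_ xr)]; rewrite ltxx.
move=> s t c e as_ st tb h.
have sb := le_trans st tb; have at_ := le_trans as_ st.
have mst : fine (mu `]s, t]) = g t - g s by rewrite muE //= !GE.
have intc r : mu.-integrable `]s, t] (EFin \o cst r).
  apply: measurable_bounded_integrable.
  - exact: measurable_itv.
  - by rewrite [X in (X < _)%E]muE // ltry.
  - exact: measurable_cst.
  - by exists `|r|; split; [exact: num_real|move=> N /ltW rN x _].
have mI : measurable (`]s, t] : set (measurableTypeR R)) by exact: measurable_itv.
rewrite -mst -!Rintegral_cst // -RintegralB //; [|exact: intF|exact: intc].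
have intB : mu.-integrable `]s, t] (EFin \o (fun x => F x - c)).
  rewrite (_ : _ \o _ = (EFin \o F) \- (EFin \o cst c))%E; last first.
    by apply/funext => x /=; rewrite EFinB.
  by apply: integrableB; [exact: mI|exact: intF|exact: intc].
apply: le_trans (le_normr_Rintegral _ intB) _ => //.
apply: le_Rintegral => //.
- exact: (integrable_norm intB).
- exact: intc.
- move=> x /=; rewrite in_itv /= => /andP[sx xt].
  rewrite /F /= clamp_id; first by apply: h => //; exact: ltW.
    by rewrite (le_trans as_) // ltW.
  exact: le_trans tb.
Qed.

End ContinuousOn.

Section RiemannStieltjes.
Variable R : realType.
Implicit Types (a b : R) (f g : R -> R).

(** Guarantees that [is_RS_integral] is never vacuous, whence the uniqueness of its value. *)
Lemma fine_partition a b delta : a <= b -> 0 < delta ->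
  exists (n : nat) (t : nat -> R), [/\ t 0%N = a, t n = b &
    forall i, (i < n)%N -> t i <= t i.+1 /\ t i.+1 - t i < delta].
Proof.
move=> ab d0.
pose n := (Num.truncn ((b - a) / delta)).+1.
have n0 : 0 < n%:R :> R by rewrite ltr0n.
exists n, (fun i => a + (b - a) * (i%:R / n%:R)).
split; [by rewrite mul0r mulr0 addr0|by rewrite divff ?gt_eqF //; ring|].
move=> i _; have st : (a + (b - a) * (i.+1%:R / n%:R)) - (a + (b - a) * (i%:R / n%:R)) =
   (b - a) / n%:R by rewrite -natr1; field; rewrite gt_eqF.
split; first by rewrite -subr_ge0 st divr_ge0 ?subr_ge0 // ltW.
rewrite st ltr_pdivrMr // mulrC -ltr_pdivrMr //.
exact: truncnS_gt.
Qed.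

Lemma is_RS_integral_unique a b f g I I' : a <= b ->
  is_RS_integral f g a b I -> is_RS_integral f g a b I' -> I = I'.
Proof.
move=> ab h h'; apply/eqP; rewrite -subr_eq0 -normr_le0.
apply/ler_addgt0Pl => e e0; rewrite addr0.
have e20 : 0 < e / 2 by rewrite divr_gt0.
have [d d0 hd] := h _ e20; have [d' d'0 hd'] := h' _ e20.
have [|n [t [t0 tn ts]]] := @fine_partition a b (Num.min d d') ab.
  by rewrite lt_min d0.
have := hd n t t t0 tn; have := hd' n t t t0 tn.
set S := \sum_(0 <= i < n) _ => h1 h2.
have {}h1 : `|S - I'| < e / 2.
  by apply: h1 => i /ts[]; rewrite lt_min => ? /andP[].
have {}h2 : `|S - I| < e / 2.
  by apply: h2 => i /ts[]; rewrite lt_min => ? /andP[].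
rewrite -(subrK S I) -addrA; apply: le_trans (ler_normD _ _) _.
by rewrite distrC; lra.
Qed.

Lemma RS_integral_eq a b f g I : a <= b -> is_RS_integral f g a b I ->
  RS_integral f g a b = I.
Proof.
move=> ab h; apply: (@is_RS_integral_unique a b f g) => //.
by rewrite /RS_integral; apply: getPex; exists I.
Qed.

Lemma partition_mono (n : nat) (t xi : nat -> R) :
  (forall i, (i < n)%N -> t i <= xi i /\ xi i <= t i.+1) ->
  forall i j, (i <= j)%N -> (j <= n)%N -> t i <= t j.
Proof.
move=> h i; elim=> [|j IHj]; first by rewrite leqn0 => /eqP ->.
rewrite leq_eqVlt => /predU1P[->//|ij] jn.
have [h1 h2] := h j jn.
by apply: le_trans (le_trans h1 h2); apply: IHj => //; exact: ltnW.
Qed.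

Lemma is_RS_integral_eq_on a b f f' g I :
  (forall x, a <= x -> x <= b -> f x = f' x) ->
  is_RS_integral f g a b I -> is_RS_integral f' g a b I.
Proof.
move=> ff' h eps eps0; have [d d0 hd] := h _ eps0; exists d => // n t xi t0 tn ts.
rewrite (_ : \sum_(0 <= i < n) _ = \sum_(0 <= i < n) f (xi i) * (g (t i.+1) - g (t i))).
  exact: hd.
have mono := @partition_mono n t xi (fun i iN => let: And3 a b _ := ts i iN in conj a b).
apply: eq_big_nat => i /andP[_ iN]; have [h1 h2 _] := ts i iN.
rewrite ff' //.
  by rewrite -t0 (le_trans _ h1) // mono // ltnW.
by rewrite -tn (le_trans h2) // mono.
Qed.

Lemma is_RS_integral_lin a b f1 f2 g I1 I2 c : is_RS_integral f1 g a b I1 ->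
  is_RS_integral f2 g a b I2 ->
  is_RS_integral (fun x => f1 x + c * f2 x) g a b (I1 + c * I2).
Proof.
move=> h1 h2 eps eps0.
have e20 : 0 < eps / 2 by rewrite divr_gt0.
have c0 : 0 < `|c| + 1 by rewrite ltr_wpDl.
have e30 : 0 < eps / 2 / (`|c| + 1) by rewrite divr_gt0.
have [d d0 hd] := h1 _ e20; have [d' d'0 hd'] := h2 _ e30.
exists (Num.min d d') => [|n t xi t0 tn ts]; first by rewrite lt_min d0.
have H1 := hd n t xi t0 tn; have H2 := hd' n t xi t0 tn.
rewrite (_ : \sum_(0 <= i < n) _ = \sum_(0 <= i < n) f1 (xi i) * (g (t i.+1) - g (t i)) +
  c * \sum_(0 <= i < n) f2 (xi i) * (g (t i.+1) - g (t i))); last first.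
  rewrite mulr_sumr -big_split; apply: eq_bigr => i _ /=; ring.
rewrite opprD addrACA -mulrBr; apply: le_lt_trans (ler_normD _ _) _.
rewrite [eps]splitr; apply: ltr_leD.
  by apply: H1 => i /ts[? ?]; rewrite lt_min => /andP[].
rewrite normrM; apply: le_trans (_ : (`|c| + 1) * (eps / 2 / (`|c| + 1)) <= _).
  apply: ler_pM => //; first by rewrite lerDl.
  by apply/ltW/H2 => i /ts[? ?]; rewrite lt_min => /andP[].
by rewrite mulrC divfK // gt_eqF.
Qed.

Lemma is_RS_integral0 a b g : is_RS_integral (fun=> 0) g a b 0.
Proof.
move=> eps eps0; exists 1 => // n t xi _ _ _.
by rewrite big1 ?subrr ?normr0 // => i _; rewrite mul0r.
Qed.

Lemma is_RS_integral_sum a b g m (c : nat -> R) (f : nat -> R -> R) (I : nat -> R) :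
  (forall k, (k < m)%N -> is_RS_integral (f k) g a b (I k)) ->
  is_RS_integral (fun x => \sum_(0 <= k < m) c k * f k x) g a b
    (\sum_(0 <= k < m) c k * I k).
Proof.
elim: m => [|m IHm] h.
  rewrite big_nil; apply: is_RS_integral_eq_on (@is_RS_integral0 a b g) => x _ _.
  by rewrite big_nil.
rewrite big_nat_recr //=.
apply: is_RS_integral_eq_on (@is_RS_integral_lin _ _ _ (f m) _ _ (I m) (c m) (IHm _) (h m _)).
- by move=> x _ _ /=; rewrite big_nat_recr.
- by move=> k km; apply: h; exact: ltnW.
- exact: ltnSn.
Qed.

(** Over a fine partition the local errors add up to at most eps * V a b, because [J] and [V] are
    both additive. *)
Lemma is_RS_integral_additive a b f g (J V : R -> R -> R) (K : R) : 0 <= K -> a <= b ->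
  (forall s r t, a <= s -> s <= r -> r <= t -> t <= b -> J s t = J s r + J r t) ->
  (forall s r t, a <= s -> s <= r -> r <= t -> t <= b -> V s t = V s r + V r t) ->
  (forall eps, 0 < eps -> exists2 delta, 0 < delta & forall s x t,
    a <= s -> s <= x -> x <= t -> t <= b -> t - s < delta ->
    `|f x * (g t - g s) - J s t| <= eps * V s t) ->
  V a b <= K ->
  is_RS_integral f g a b (J a b).
Proof.
move=> K0 ab Jadd Vadd h VK eps eps0.
have K1 : 0 < K + 1 by rewrite ltr_wpDl.
have [d d0 hd] := h _ (divr_gt0 eps0 K1); exists d => // n t xi t0 tn ts.
have mono := @partition_mono n t xi (fun i iN => let: And3 a b _ := ts i iN in conj a b).
have sumE (F : R -> R -> R) : (forall s r t, a <= s -> s <= r -> r <= t -> t <= b ->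
    F s t = F s r + F r t) -> forall m, (m <= n)%N ->
    \sum_(0 <= i < m) F (t i) (t i.+1) = F a (t m).
  move=> Fadd; elim=> [_|m IHm mn].
    rewrite big_nil t0; have := Fadd a a a; rewrite !lexx => /(_ isT isT isT ab).
    by lra.
  rewrite big_nat_recr //= IHm ?(ltnW mn) // -Fadd //.
  - by rewrite -t0 mono // ltnW.
  - by rewrite mono.
  - by rewrite -tn mono.
rewrite -[X in J _ X]tn -(sumE J) // -sumrB.
apply: le_lt_trans (ler_norm_sum _ _ _) _.
apply: (@le_lt_trans _ _ (\sum_(0 <= i < n) eps / (K + 1) * V (t i) (t i.+1))).
  rewrite big_nat [leRHS]big_nat; apply: ler_sum => i /andP[_ iN].
  have [h1 h2 h3] := ts i iN; apply: hd => //.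
    by rewrite -t0 mono // ltnW.
  by rewrite -tn mono.
rewrite -mulr_sumr (sumE V) // tn.
apply: (@le_lt_trans _ _ (eps / (K + 1) * K)).
  by rewrite ler_wpM2l // divr_ge0 // ltW.
by rewrite -mulrA gtr_pMr // mulrC ltr_pdivrMr // mul1r; lra.
Qed.

(* The integrator is given through its decomposition as a difference of two
   nondecreasing functions, and the total variation is replaced by the sum of
   their increments. *)
Lemma RS_integral_exists a b f g g1 g2 : a <= b -> continuous_on a b f ->
  continuous_on a b g1 -> continuous_on a b g2 ->
  nondecreasing_on a b g1 -> nondecreasing_on a b g2 ->
  (forall x, a <= x -> x <= b -> g x = g1 x - g2 x) ->
  let V s t := (g1 t - g1 s) + (g2 t - g2 s) in
  exists J : R -> R -> R,
    [/\ forall s r t, a <= s -> s <= r -> r <= t -> t <= b -> J s t = J s r + J r t,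
        forall s t M, a <= s -> s <= t -> t <= b ->
          (forall x, s <= x -> x <= t -> `|f x| <= M) -> `|J s t| <= M * V s t &
        forall s t, a <= s -> s <= t -> t <= b -> is_RS_integral f g s t (J s t)].
Proof.
move=> ab fc g1c g2c g1m g2m gE V.
have [J1 [J1add J1b]] := stieltjes_primitive ab fc g1c g1m.
have [J2 [J2add J2b]] := stieltjes_primitive ab fc g2c g2m.
have bd s t c e : a <= s -> s <= t -> t <= b ->
    (forall x, s <= x -> x <= t -> `|f x - c| <= e) ->
    `|J1 s t - J2 s t - c * (g t - g s)| <= e * V s t.
  move=> as_ st tb h.
  have at_ := le_trans as_ st; have sb := le_trans st tb.
  rewrite (_ : _ - _ = (J1 s t - c * (g1 t - g1 s)) - (J2 s t - c * (g2 t - g2 s))).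
    apply: le_trans (ler_normB _ _) _; rewrite /V [leRHS]mulrDr.
    by apply: lerD; [exact: J1b|exact: J2b].
  by rewrite !gE //; ring.
have Jadd s r t : a <= s -> s <= r -> r <= t -> t <= b ->
    J1 s t - J2 s t = J1 s r - J2 s r + (J1 r t - J2 r t).
  by move=> as_ sr rt tb; rewrite (J1add s r t) // (J2add s r t) //; ring.
exists (fun s t => J1 s t - J2 s t); split => //.
- move=> s t M as_ st tb h; have := @bd s t 0 M as_ st tb.
  by rewrite mul0r subr0; apply=> x sx xt; rewrite subr0 h.
move=> s t as_ st tb.
apply: (@is_RS_integral_additive s t f g (fun s t => J1 s t - J2 s t) V (`|V s t|)) => //.
- move=> s' r' t' h1 h2 h3 h4; apply: Jadd => //; last exact: le_trans tb.
  exact: le_trans h1.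
- by move=> s' r' t' _ _ _ _; rewrite /V; ring.
- move=> eps eps0.
  have [d d0 hd] := continuous_on_uniform ab fc eps0; exists d => // s' x t' h1 h2 h3 h4 h5.
  rewrite distrC; have as' := le_trans as_ h1; have tb' := le_trans h4 tb.
  apply: bd => //; first exact: le_trans h3.
  move=> y sy yt; apply/ltW/hd.
  + exact: le_trans h2.
  + exact: le_trans tb'.
  + exact: le_trans sy.
  + exact: le_trans tb'.
  + by rewrite ltr_norml; apply/andP; split; lra.
- exact: ler_norm.
Qed.

(** The two functions are (v + f) / 2 and (v - f) / 2 with v the total variation on [a, x]. They are
    monotone because increments of v dominate those of f, and continuous because v is. *)
Lemma jordan_decomposition a b f : a < b -> {within `[a, b], continuous f} ->
  bounded_variation a b f -> exists g1 g2,
  [/\ continuous_on a b g1, continuous_on a b g2, nondecreasing_on a b g1,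
     nondecreasing_on a b g2 & forall x, a <= x -> x <= b -> f x = g1 x - g2 x].
Proof.
move=> ab fc fbv.
have abW := ltW ab.
pose tv x := fine (total_variation a x f).
have tvc := within_continuous_on (total_variation_continuous ab fc fbv).
have fc' := within_continuous_on fc.
have fin x y : a <= x -> x <= y -> y <= b -> total_variation x y f \is a fin_num.
  move=> ax xy yb; apply/bounded_variationP => //.
  apply: (@bounded_variationl _ _ _ b) => //.
  by apply: (@bounded_variationr _ a) => //; exact: le_trans xy yb.
have tvinc x y : a <= x -> x <= y -> y <= b -> `|f y - f x| <= tv y - tv x.
  move=> ax xy yb; rewrite /tv (total_variationD f ax xy) fineD ?fin //; last first.
    exact: le_trans xy yb.
  rewrite addrAC subrr add0r -lee_fin fineK ?fin //; exact: total_variation_ge.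
have cont_comb c : continuous_on a b (fun x => tv x / 2 + c * f x).
  move=> x eps ax xb eps0.
  have c0 : 0 < `|c| + 1 by rewrite ltr_wpDl.
  have [d1 d10 h1] := tvc x eps ax xb eps0.
  have e2 : 0 < eps / 2 / (`|c| + 1) by rewrite !divr_gt0.
  have [d2 d20 h2] := fc' x _ ax xb e2.
  exists (Num.min d1 d2) => [|y ay yb]; first by rewrite lt_min d10.
  rewrite lt_min => /andP[yx1 yx2].
  have H1 := h1 y ay yb yx1; have H2 := h2 y ay yb yx2.
  rewrite (_ : _ - _ = (tv y - tv x) / 2 + c * (f y - f x)); last by field.
  apply: le_lt_trans (ler_normD _ _) _; rewrite [eps]splitr; apply: ltr_leD.
    by rewrite normrM [`|2^-1|]ger0_norm ?invr_ge0 // ltr_pM2r ?invr_gt0.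
  rewrite normrM; apply: le_trans (_ : (`|c| + 1) * (eps / 2 / (`|c| + 1)) <= _).
    by apply: ler_pM => //; [rewrite lerDl|exact: ltW].
  by rewrite mulrC divfK // gt_eqF.
exists (fun x => tv x / 2 + 2^-1 * f x), (fun x => tv x / 2 + (- 2^-1) * f x).
split; [exact: cont_comb|exact: cont_comb| | |by move=> x _ _; field].
- move=> x y ax xy yb; have := tvinc x y ax xy yb.
  by rewrite ler_norml => /andP[h1 h2]; lra.
- move=> x y ax xy yb; have := tvinc x y ax xy yb.
  by rewrite ler_norml => /andP[h1 h2]; lra.
Qed.

End RiemannStieltjes.

(** * Signatures of continuous paths of bounded variation *)

Section BVSignature.
Variables (R : realType) (d : nat).

Lemma bv_signature_group_like (T : R) (x : R -> 'rV[R]_d) : 0 < T ->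
  is_continuous_bv T x ->
  forall s t, 0 <= s -> s <= t -> t <= T -> group_like (bv_signature x s t).
Proof.
move=> T0 xbv.
have /choice[g1 /choice[g2 gP]] : forall i, exists g1 g2,
  [/\ continuous_on 0 T g1, continuous_on 0 T g2, nondecreasing_on 0 T g1,
     nondecreasing_on 0 T g2 & forall u, 0 <= u -> u <= T -> x u ord0 i = g1 u - g2 u].
  by move=> i; have [xc xv] := xbv i; exact: jordan_decomposition.
pose V i s t := (g1 i t - g1 i s) + (g2 i t - g2 i s).
(* This additive function dominates the variation of every coordinate and plays the part of the
   control, with p = 1. *)
pose om s t := \sum_i V i s t.
have V0 i s t : 0 <= s -> s <= t -> t <= T -> 0 <= V i s t.
  by move=> s0 st tT; have [_ _ m1 m2 _] := gP i; rewrite addr_ge0 // subr_ge0 ?m1 ?m2.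
have om0 : nonneg_on T om.
  by move=> s t s0 st tT; apply: sumr_ge0 => i _; exact: V0.
have omadd s r t : om s t = om s r + om r t.
  by rewrite /om -big_split; apply: eq_bigr => i _; rewrite /V /=; ring.
have Vom i s t : 0 <= s -> s <= t -> t <= T -> V i s t <= om s t.
  by move=> s0 st tT; rewrite /om (bigD1 i) //= lerDl; apply: sumr_ge0 => j _; exact: V0.
(* Continuity and bound are proved by one induction: the next iterated integral exists because its
   integrand is continuous. *)
have it_props w s : 0 <= s -> s <= T ->
    continuous_on s T (iterated_integral x w s) /\
    forall t, s <= t -> t <= T ->
      `|iterated_integral x w s t| <= om s t ^+ size w.
  elim: w s => [|i w IHw] s s0 sT /=.
    split; last by move=> t _ _; rewrite normr1.
    by move=> u eps _ _ eps0; exists 1 => // y _ _ _; rewrite subrr normr0.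
  have [wc wb] := IHw s s0 sT; have [c1 c2 m1 m2 gE] := gP i.
  have [|||||J [Jadd Jb JRS]] := @RS_integral_exists R s T (iterated_integral x w s)
    (fun u => x u ord0 i) (g1 i) (g2 i) sT wc.
  - exact: continuous_onS c1.
  - exact: continuous_onS c2.
  - by move=> u v su; apply: m1; exact: le_trans su.
  - by move=> u v su; apply: m2; exact: le_trans su.
  - by move=> u su; apply: gE; exact: le_trans su.
  have JE u : s <= u -> u <= T ->
      RS_integral (iterated_integral x w s) (fun u => x u ord0 i) s u = J s u.
    by move=> su uT; apply: RS_integral_eq => //; exact: JRS.
  have [M wM] := continuous_on_bounded sT wc.
  have M0 : 0 <= M by apply: le_trans (wM s _ _).
  split.
    move=> u eps su uT eps0.
    have M1 : 0 < M + 1 by rewrite ltr_wpDl.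
    have e0 : 0 < eps / (M + 1) / 2 by rewrite !divr_gt0.
    have [d1 d10 h1] := c1 u _ (le_trans s0 su) uT e0.
    have [d2 d20 h2] := c2 u _ (le_trans s0 su) uT e0.
    exists (Num.min d1 d2) => [|v sv vT]; first by rewrite lt_min d10.
    rewrite lt_min => /andP[vu1 vu2]; rewrite !JE //.
    have v0 := le_trans s0 sv; have u0 := le_trans s0 su.
    have H1 := h1 v v0 vT vu1; have H2 := h2 v v0 vT vu2.
    have JB a b : s <= a -> a <= b -> b <= T -> `|J s b - J s a| <= M * V i a b.
      move=> sa ab bT; rewrite (Jadd s a b) // addrAC subrr add0r.
      apply: Jb => // y ay yb; apply: wM; first exact: le_trans ay.
      exact: le_trans bT.
    have : `|J s v - J s u| <= M * (eps / (M + 1)).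
      have [uv|/ltW vu] := leP u v.
        apply: le_trans (JB u v su uv vT) _; rewrite ler_wpM2l // /V.
        by move: H1 H2; rewrite !ltr_norml => /andP[? ?] /andP[? ?]; lra.
      rewrite distrC; apply: le_trans (JB v u sv vu uT) _; rewrite ler_wpM2l // /V.
      by move: H1 H2; rewrite !ltr_norml => /andP[? ?] /andP[? ?]; lra.
    move=> h; apply: le_lt_trans h _.
    rewrite mulrCA gtr_pMr // ltr_pdivrMr // mul1r; lra.
  move=> t st tT; rewrite JE // exprSr.
  apply: le_trans (Jb s t (om s t ^+ size w) _ st tT _) _ => //.
    move=> u su ut; apply: le_trans (wb u su (le_trans ut tT)) _.
    apply: lerXn2r; rewrite ?nnegrE ?om0 //.
    - exact: le_trans tT.
    - by rewrite (omadd s u t) lerDl om0 //; exact: le_trans su.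
  by rewrite ler_wpM2l ?exprn_ge0 ?om0 // Vom.
have it_RS w i s : 0 <= s -> s <= T -> exists J : R -> R -> R,
    (forall s' r t, s <= s' -> s' <= r -> r <= t -> t <= T -> J s' t = J s' r + J r t) /\
    (forall u v, s <= u -> u <= v -> v <= T ->
      is_RS_integral (iterated_integral x w s) (fun u => x u ord0 i) u v (J u v)).
  move=> s0 sT; have [wc wb] := it_props w s s0 sT; have [c1 c2 m1 m2 gE] := gP i.
  have [|||||J [Jadd Jb JRS]] := @RS_integral_exists R s T (iterated_integral x w s)
    (fun u => x u ord0 i) (g1 i) (g2 i) sT wc.
  - exact: continuous_onS c1.
  - exact: continuous_onS c2.
  - by move=> u v su; apply: m1; exact: le_trans su.
  - by move=> u v su; apply: m2; exact: le_trans su.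
  - by move=> u su; apply: gE; exact: le_trans su.
  by exists J; split.
(* Chen's relation for words read from the outermost letter. The outer integral is split at r; over
   [r, t] the inner one is expanded by induction, and its factors over [s, r] are constants. *)
have it_chen w s r t : 0 <= s -> s <= r -> r <= t -> t <= T ->
    iterated_integral x w s t = \sum_(0 <= k < (size w).+1)
      iterated_integral x (drop k w) s r * iterated_integral x (take k w) r t.
  move=> s0; elim: w r t => [|i w IHw] r t sr rt tT /=.
    by rewrite big_nat1 mulr1.
  have r0 := le_trans s0 sr; have rT := le_trans rt tT; have sT := le_trans sr rT.
  have st := le_trans sr rt.
  have [J [Jadd JRS]] := it_RS w i s s0 sT.
  rewrite (RS_integral_eq st (JRS s t _ st tT)) // (Jadd s r t) //.
  rewrite big_nat_recl //= mulr1; congr (_ + _).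
    by rewrite (RS_integral_eq sr (JRS s r _ sr rT)).
  apply: is_RS_integral_unique (JRS r t sr rt tT) _ => //.
  apply: is_RS_integral_eq_on; last apply: is_RS_integral_sum.
    move=> u ru ut; symmetry; apply: IHw => //; exact: le_trans tT.
  move=> k km /=; have [J' [J'add J'RS]] := it_RS (take k w) i r r0 rT.
  by rewrite (RS_integral_eq rt (J'RS r t _ rt tT)) //; exact: J'RS.
(* With p = N = 1 the low-level relations to be supplied involve an empty word and are trivial. *)
apply: (@group_like_ext _ _ _ _ om 1 1 (fun=> 1)) => //.
- by rewrite ltr1n.
- by move=> s u t _ _ _ _; rewrite -omadd.
- move=> r eps r0 rT eps0.
  (* Each of the d summands of [om] consists of four such increments, so the total is at most eps *
     d / (d + 1), which is below eps even for d = 0. *)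
  have e0 : 0 < eps / (2 * d.+1%:R) / 2 by rewrite !divr_gt0 // mulr_gt0.
  have /choice[del delP] : forall i, exists del, 0 < del /\ forall u, 0 <= u -> u <= T ->
      `|u - r| < del -> `|g1 i u - g1 i r| < eps / (2 * d.+1%:R) / 2 /\
                        `|g2 i u - g2 i r| < eps / (2 * d.+1%:R) / 2.
    move=> i; have [c1 c2 _ _ _] := gP i.
    have [d1 d10 h1] := c1 r _ r0 rT e0; have [d2 d20 h2] := c2 r _ r0 rT e0.
    exists (Num.min d1 d2); split => [|u u0 uT]; first by rewrite lt_min d10.
    by rewrite lt_min => /andP[? ?]; split; [exact: h1|exact: h2].
  exists (\big[Num.min/1]_i del i).
    by apply: (@big_ind _ (fun y : R => 0 < y)) => // [a b a0 b0|i _]; [rewrite lt_min a0|exact: (delP i).1].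
  move=> s t s0 sr rt tT ts.
  apply: (@le_lt_trans _ _ (\sum_(i < d) eps / d.+1%:R)).
    apply: ler_sum => i _.
    have tsi : t - s < del i by apply: lt_le_trans ts _; exact: bigmin_le_cond.
    have [h1 h2] := (delP i).2 t (le_trans r0 rt) tT ltac:(rewrite ger0_norm ?subr_ge0//; lra).
    have [h3 h4] := (delP i).2 s s0 (le_trans sr rT) ltac:(rewrite distrC ger0_norm ?subr_ge0//; lra).
    have -> : eps / d.+1%:R = 4 * (eps / (2 * d.+1%:R) / 2).
      by field; rewrite addrC natr1 pnatr_eq0.
    set q := eps / (2 * d.+1%:R) / 2 in h1 h2 h3 h4 *.
    move: h1 h2 h3 h4; rewrite !ltr_norml /V.
    by move=> /andP[? ?] /andP[? ?] /andP[? ?] /andP[? ?]; lra.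
  rewrite sumr_const card_ord -[_ *+ d]mulr_natr mulrAC ltr_pdivrMr ?ltr0n //.
  by rewrite ltr_pM2l // ltr_nat.
- move=> s r t s0 sr rt tT; apply/funext => w; rewrite /tmul /bv_signature.
  rewrite (it_chen _ s r t) // size_rev [RHS]big_nat_rev /=; apply: eq_big_nat => k /andP[_ kw].
  rewrite add0n subSS rev_drop rev_take; congr (_ * _).
- move=> s t u v _ _ _; case: u => [|a u]; first by rewrite mul1r shuffle_sum0l.
  case: v => [|b v]; first by rewrite mulr1 shuffle_sum0r.
  by rewrite /= addnS.
- move=> s t w s0 st tT _; rewrite mul1r divr1 powR_mulrn ?om0 //.
  rewrite -size_rev; apply: (it_props _ _ _ _).2 => //; exact: le_trans tT.
Qed.

End BVSignature.

(** * Geometric rough paths *)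

Section Geometric.
Variables (R : realType) (d : nat).

Lemma pvar_term_le (p T s t : R) (X Y : R -> R -> tseries R d) n :
  0 <= s -> s < t -> t <= T ->
  (((pnorm (level (X s t \- Y s t) n)) `^ (p / n%:R))%:E <=
   ereal_sup [set (pvar_sum p T X Y n D)%:E | D in itv_partition 0%R T])%E.
Proof.
move=> s0 st tT.
(* The interval [s, t] is completed to a dissection of [0, T]. Since dissections increase strictly,
   [s] is left out if it is 0 and the final point [T] if t = T; [j] is the index of [s, t]. *)
pose D := (if s == 0 then [::] else [:: s]) ++ t :: (if t == T then [::] else [:: T]).
pose j := (s != 0 : nat).
have Dpart : itv_partition 0 T D.
  rewrite /itv_partition /D; case: (eqVneq s 0) => [s00|sn0];
    case: (eqVneq t T) => [->|tnT] /=; split => //.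
  - by rewrite andbT -s00 (lt_le_trans st).
  - by rewrite -{1}s00 st lt_neqAle tnT tT.
  - by rewrite lt_neqAle eq_sym sn0 s0 (lt_le_trans st).
  - by rewrite lt_neqAle eq_sym sn0 s0 st lt_neqAle tnT tT.
have jD : (j < size D)%N.
  by rewrite /D /j; case: eqVneq => _ /=; case: eqVneq.
have tj : nth T (0 :: D) j = s.
  by rewrite /D /j; case: eqVneq => [->|_].
have tj1 : nth T (0 :: D) j.+1 = t.
  by rewrite /D /j; case: eqVneq => _.
apply: (@le_trans _ _ (pvar_sum p T X Y n D)%:E); last first.
  by apply: ereal_sup_ubound; exists D.
rewrite lee_fin /pvar_sum (bigD1_seq j) ?mem_index_iota ?iota_uniq //=.
rewrite -[nth T D j]/(nth T (0 :: D) j.+1) tj tj1 lerDl.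
by apply: sumr_ge0 => i _; exact: powR_ge0.
Qed.

(** The level-n term is a power p/n under a p-th root, so the distance bounds the norm by eps^n; eps
    <= 1 makes the bound uniform in n. *)
Lemma pvar_distance_coord (p T s t eps : R) (X Y : R -> R -> tseries R d) w :
  1 <= p -> 0 <= s -> s < t -> t <= T -> 0 < eps -> eps <= 1 ->
  (0 < size w)%N -> (size w <= Num.truncn p)%N ->
  (pvar_distance p T X Y < eps%:E)%E -> `|X s t w - Y s t w| <= eps.
Proof.
move=> p1 s0 st tT eps0 eps1 w0 wN; have p0 : 0 < p by exact: lt_le_trans p1.
set n := size w in w0 wN *; have n0 : 0 < n%:R :> R by rewrite ltr0n.
rewrite /pvar_distance; set S := (\sum_(1 <= m < _) _)%E => dist.
have sup0 m : (0 <= ereal_sup [set (pvar_sum p T X Y m D)%:E | D in itv_partition 0%R T])%E.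
  by apply: le_trans (pvar_term_le p X Y m s0 st tT); rewrite lee_fin powR_ge0.
have S0 : (0 <= S)%E by apply: sume_ge0.
have leS : (((pnorm (level (X s t \- Y s t) n)) `^ (p / n%:R))%:E <= S)%E.
  apply: le_trans (pvar_term_le p X Y n s0 st tT) _.
  rewrite /S (bigD1_seq n) ?mem_index_iota ?iota_uniq ?w0 //=.
  by rewrite leeDl // sume_ge0.
have lt1 : (((pnorm (level (X s t \- Y s t) n)) `^ n%:R^-1)%:E <= eps%:E)%E.
  apply/ltW; apply: le_lt_trans dist.
  have -> : n%:R^-1 = p / n%:R * p^-1 by field; rewrite !gt_eqF.
  rewrite powRrM -poweR_EFin; apply: gt0_ler_poweR => //.
  - by rewrite invr_ge0 ltW.
  - by rewrite in_itv /= leey andbT lee_fin powR_ge0.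
  - by rewrite in_itv /= leey andbT.
rewrite lee_fin in lt1.
have -> : X s t w - Y s t w = (X s t \- Y s t) w by [].
apply: le_trans (ler_coord_level _ _) _; rewrite -/n.
rewrite -[leLHS](@powRr1 _ _ (pnorm_ge0 _)).
have e : n%:R^-1 * n%:R = 1 :> R by rewrite mulVf // gt_eqF.
rewrite -[X in _ `^ X <= _]e powRrM powR_mulrn ?powR_ge0 //.
apply: (@le_trans _ _ (eps ^+ n)).
  by apply: lerXn2r => //; rewrite nnegrE ?powR_ge0 // ltW.
by rewrite -[leRHS]expr1; apply: ler_wiXn2l => //; exact: ltW.
Qed.

Lemma cvg_shuffle_sum u v (y : nat -> seq 'I_d -> R) (x : seq 'I_d -> R) :
  (forall w, size w = (size u + size v)%N -> y m w @[m --> \oo] --> x w) ->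
  shuffle_sum u v (y m) @[m --> \oo] --> shuffle_sum u v x.
Proof.
move: u v y x; apply: shuffle_ind => [v|u|a u b v IHu IHv] y x h.
- by rewrite shuffle_sum0l; apply: h.
- under eq_fun do rewrite shuffle_sum0r.
  by rewrite shuffle_sum0r; apply: h; rewrite addn0.
- under eq_fun do rewrite shuffle_sum_cons.
  rewrite shuffle_sum_cons; apply: cvgD.
    by apply: (IHu (fun m => y m \o cons a)) => w sw; apply: h; rewrite /= sw.
  by apply: (IHv (fun m => y m \o cons b)) => w sw; apply: h; rewrite /= sw addnS.
Qed.

Lemma geometric_rough_path_shuffle (gam : R -> R) (p T : R) (X : R -> R -> tseries R d) :
  1 <= p -> 0 < gam p -> 0 < T -> is_geometric_rough_path gam p T X ->
  forall s t u v, 0 <= s -> s <= t -> t <= T -> (size u + size v <= Num.truncn p)%N ->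
    X s t u * X s t v = shuffle_sum u v (X s t).
Proof.
move=> p1 gam0 T0 [[_ _ X1 _ [om [octrl ob]]] Xg] s t u v s0 st tT uv.
case: u uv => [|a u] uv; first by rewrite X1 // mul1r shuffle_sum0l.
case: v uv => [|b v] uv; first by rewrite X1 // mulr1 shuffle_sum0r.
(* Dissections see only nondegenerate intervals, so s = t is treated apart: the control vanishes
   there, and with it the levels 1 to floor(p). *)
move: st; rewrite le_eqVlt => /predU1P[ts|st].
  rewrite -{t}ts in tT *.
  have X0 w : (0 < size w)%N -> (size w <= Num.truncn p)%N -> X s s w = 0.
    move=> w0 wN; apply/eqP; rewrite -normr_le0.
    apply: le_trans (ler_coord_level _ _) _.
    apply: le_trans (control_bound p1 gam0 w0 (ob s s _ s0 (lexx s) tT w0 wN)) _.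
    case: octrl => _ _ _ ->//; rewrite powR0 ?mulr0 //.
    by rewrite mulf_neq0 ?pnatr_eq0 -?lt0n // invr_neq0 // gt_eqF // (lt_le_trans _ p1).
  rewrite X0 // ?mul0r; last by apply: leq_trans uv; rewrite leq_addr.
  rewrite (@eq_shuffle_sum _ _ _ _ _ (fun w => 0 * X s s w)) ?shuffle_sumMl ?mul0r //.
  move=> w sw; rewrite mul0r X0 // ?sw //.
have eps0 m : 0 < (m.+1%:R^-1 : R) by rewrite invr_gt0.
have eps1 m : (m.+1%:R^-1 : R) <= 1 by rewrite invf_le1 ?ltr0n // ler1n.
have /choice[x xP] : forall m, exists x : R -> 'rV[R]_d, is_continuous_bv T x /\
    (pvar_distance p T X
       (fun s t => truncate (Num.truncn p) (bv_signature x s t)) < (m.+1%:R^-1)%:E)%E.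
  by move=> m; have [x xbv xd] := Xg _ (eps0 m); exists x.
have glx m : group_like (bv_signature (x m) s t).
  exact: bv_signature_group_like (xP m).1 _ _ s0 (ltW st) tT.
have cvx w : (0 < size w)%N -> (size w <= Num.truncn p)%N ->
    bv_signature (x m) s t w @[m --> \oo] --> X s t w.
  move=> w0 wN; apply/cvgrPdist_le => e e0.
  near=> m.
  have := pvar_distance_coord p1 s0 st tT (eps0 m) (eps1 m) w0 wN (xP m).2.
  rewrite /truncate wN => /le_trans; apply.
  near: m; apply: filterS (near_infty_natSinv_lt (PosNum e0)) => m.
  exact: ltW.
have c1 : (bv_signature (x m) s t (a :: u) * bv_signature (x m) s t (b :: v)) @[m --> \oo] -->
    X s t (a :: u) * X s t (b :: v).
  apply: cvgM; apply: cvx => //.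
    by apply: leq_trans uv; rewrite leq_addr.
  by apply: leq_trans uv; rewrite leq_addl.
have c2 : shuffle_sum (a :: u) (b :: v) (bv_signature (x m) s t) @[m --> \oo] -->
    shuffle_sum (a :: u) (b :: v) (X s t).
  by apply: cvg_shuffle_sum => w sw; apply: cvx; rewrite sw.
rewrite -(cvg_lim (@norm_hausdorff _ _) c1) -(cvg_lim (@norm_hausdorff _ _) c2).
by under eq_fun => m do rewrite (glx m).2.
Unshelve. all: by end_near. Qed.

Lemma rsig_group_like (gam : R -> R) (p : R) dO (Omega : measurableType dO)
    (X : random_geometric_rough_path d gam p Omega) omega :
  1 <= p -> 0 < gam p -> group_like (Defs.eseries (rsig X omega)).
Proof.
move=> p1 gam0; rewrite rsigE.
have T0 := rtime_gt0 X omega.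
apply: (signature_path_group_like p1 gam0 _ (rsig_pathP X omega)) => //.
- by case: (rpath_geometric X omega) => -[].
- exact: geometric_rough_path_shuffle (rpath_geometric X omega).
- exact: ltW.
Qed.

End Geometric.

(** * Developments *)

Section CauchyProduct.
Variable R : realType.
Implicit Types a b : nat -> R.

Definition cauchy_product a b n := \sum_(0 <= i < n.+1) a i * b (n - i)%N.

Lemma series_cauchy_product a b N :
  series (cauchy_product a b) N = \sum_(0 <= i < N) a i * series b (N - i)%N.
Proof.
elim: N => [|N IHN]; first by rewrite /series /= !big_nil.
rewrite /series /= big_nat_recr //= -[X in X + _]/(series (cauchy_product a b) N) IHN.
rewrite [RHS]big_nat_recr //= subSnn big_nat1.
rewrite /cauchy_product [X in _ + X]big_nat_recr //= subnn addrA; congr (_ + _).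
rewrite -big_split /=; apply: eq_big_nat => i /andP[_ iN].
by rewrite (subSn (ltnW iN)) [in RHS]big_nat_recr // mulrDr.
Qed.

(** The product of partial sums runs over a square of indices, the Cauchy product over a triangle.
    The triangle of size N contains the square of size N/2, so their difference is dominated by that
    of two squares for the absolute values, which tends to 0. *)
Lemma cvg_cauchy_product a b : cvgn [normed series a] -> cvgn [normed series b] ->
  series (cauchy_product a b) @ \oo --> limn (series a) * limn (series b).
Proof.
move=> na nb.
pose ta n := `|a n|; pose tb n := `|b n|.
have ca : cvgn (series a) by exact: normed_cvg.
have cb : cvgn (series b) by exact: normed_cvg.
have cab : series a n * series b n @[n --> \oo] --> limn (series a) * limn (series b).
  exact: cvgM.
have ndtb m n : (m <= n)%N -> series tb m <= series tb n.
  move=> mn; rewrite /series /= [leRHS](big_cat_nat _ (n := m)) //= lerDl.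
  by apply: sumr_ge0 => i _; exact: normr_ge0.
have diff N : `|series a N * series b N - series (cauchy_product a b) N| <=
    series ta N * series tb N - series (cauchy_product ta tb) N.
  rewrite !series_cauchy_product {1 3}/series /= !mulr_suml -!sumrB.
  apply: le_trans (ler_norm_sum _ _ _) _.
  rewrite big_nat [leRHS]big_nat; apply: ler_sum => i /andP[_ iN].
  rewrite -!mulrBr normrM ler_wpM2l //.
  rewrite /series /= !(big_cat_nat (n := (N - i)%N) (m := 0%N) (p := N)) ?leq_subr //=.
  rewrite !(addrC (\sum_(0 <= _ < _ - _) _)) !addrK.
  exact: ler_norm_sum.
have hN N : (N./2 <= N)%N.
  by rewrite -[X in (_ <= X)%N]odd_double_half -addnn addnA leq_addl.
have half N : series ta N./2 * series tb N./2 <= series (cauchy_product ta tb) N.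
  rewrite series_cauchy_product [leRHS](big_cat_nat _ (n := N./2)) //=.
  rewrite ler_wpDr //.
    apply: sumr_ge0 => i _; rewrite mulr_ge0 ?normr_ge0 //.
    by apply: sumr_ge0 => j _; exact: normr_ge0.
  rewrite {1}/series /= mulr_suml; apply: ler_sum_nat => i /andP[_ iN].
  rewrite ler_wpM2l ?normr_ge0 // ndtb //.
  rewrite leq_subRL; last exact: leq_trans (ltnW iN) _.
  rewrite (leq_trans (leq_add (ltnW iN) (leqnn _))) // addnn.
  by rewrite -[X in (_ <= X)%N](odd_double_half N) leq_addl.
have cta : series ta n @[n --> \oo] --> limn (series ta) by [].
have ctb : series tb n @[n --> \oo] --> limn (series tb) by [].
have ctab : series ta n * series tb n @[n --> \oo] --> limn (series ta) * limn (series tb).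
  exact: cvgM.
have chalf : n./2 @[n --> \oo] --> \oo.
  apply/cvgnyPge => A; near=> n; rewrite geq_half_double; near: n.
  exact: nbhs_infty_ge.
have ctab2 : series ta n./2 * series tb n./2 @[n --> \oo] --> limn (series ta) * limn (series tb).
  exact: (cvg_comp _ _ chalf ctab).
have e0 : series ta n * series tb n - series ta n./2 * series tb n./2 @[n --> \oo] --> (0 : R).
  by rewrite -[X in _ --> X](subrr (limn (series ta) * limn (series tb))); exact: cvgB.
have d0 : series a n * series b n - series (cauchy_product a b) n @[n --> \oo] --> (0 : R).
  apply: (@squeeze_cvgr _ _ _ _
    (fun n => - (series ta n * series tb n - series ta n./2 * series tb n./2))
    (fun n => series ta n * series tb n - series ta n./2 * series tb n./2)).
  - near=> n; rewrite -ler_norml; apply: le_trans (diff n) _.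
    by rewrite lerD2l lerN2 half.
  - by rewrite -[X in _ --> X]oppr0; exact: cvgN.
  - exact: e0.
rewrite -[X in _ --> X]subr0.
rewrite (_ : series _ = fun n => series a n * series b n -
  (series a n * series b n - series (cauchy_product a b) n)); last first.
  by apply/funext => n; rewrite opprB addrC subrK.
exact: cvgB.
Unshelve. all: by end_near. Qed.

End CauchyProduct.

Section WordProduct.
Variables (R : realType) (d k : nat).
Implicit Types (M : 'I_d -> 'M[R]_k) (w : seq 'I_d).

Definition word_prod M w := \big[mulmx/1%:M]_(i <- w) M i.

Lemma word_prod0 M : word_prod M [::] = 1%:M.
Proof. by rewrite /word_prod big_nil. Qed.

Lemma word_prod_cons M c w : word_prod M (c :: w) = M c *m word_prod M w.
Proof. by rewrite /word_prod big_cons. Qed.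

Definition letters_bound M := 1 + \sum_c \sum_i \sum_j `|M c i j|.

Lemma letters_bound_ge1 M : 1 <= letters_bound M.
Proof.
by rewrite lerDl; apply: sumr_ge0 => c _; apply: sumr_ge0 => i _; exact: sumr_ge0.
Qed.

Lemma ler_norm_word_prod M w i j : `|word_prod M w i j| <= letters_bound M ^+ size w.
Proof.
have L0 : 0 <= letters_bound M by apply: le_trans (letters_bound_ge1 M).
elim: w i j => [|c w IHw] i j.
  by rewrite word_prod0 mxE expr0; case: eqP; rewrite ?normr1 ?normr0.
rewrite word_prod_cons mxE exprS; apply: le_trans (ler_norm_sum _ _ _) _.
apply: (@le_trans _ _ (\sum_l `|M c i l| * letters_bound M ^+ size w)).
  by apply: ler_sum => l _; rewrite normrM ler_wpM2l.
rewrite -mulr_suml ler_wpM2r ?exprn_ge0 //.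
apply: (@le_trans _ _ (\sum_i \sum_j `|M c i j|)).
  by rewrite [leRHS](bigD1 i) //= lerDl; do !(apply: sumr_ge0 => ? _).
rewrite /letters_bound [X in 1 + X](bigD1 c) //= addrCA lerDl addr_ge0 //.
by do !(apply: sumr_ge0 => ? _).
Qed.

Definition level_dev M n (x : tseries R d) : 'M[R]_k :=
  \sum_(w <- words d n) x w *: word_prod M w.

Definition l1norm n (x : tseries R d) := \sum_(w <- words d n) `|x w|.

Lemma l1norm_ge0 n x : 0 <= l1norm n x.
Proof. by apply: sumr_ge0 => w _; exact: normr_ge0. Qed.

Lemma ler_norm_level_dev M n x i j :
  `|level_dev M n x i j| <= letters_bound M ^+ n * l1norm n x.
Proof.
rewrite /level_dev summxE /l1norm mulr_sumr; apply: le_trans (ler_norm_sum _ _ _) _.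
rewrite big_seq [leRHS]big_seq; apply: ler_sum => w; rewrite mem_words => /eqP <-.
by rewrite mxE normrM mulrC ler_wpM2r // ler_norm_word_prod.
Qed.

Lemma mx_tensor_powerE (F : 'rV[R]_d -> 'M[R]_k) n (x : tseries R d) :
  mx_tensor_power F (level x n) = level_dev (fun c => F (delta_mx ord0 c)) n x.
Proof.
exact: (big_tuple_words n (fun w => x w *: word_prod (fun c => F (delta_mx ord0 c)) w)).
Qed.

Lemma level_dev_scale M (lam : R) n x :
  level_dev (fun c => lam *: M c) n x = lam ^+ n *: level_dev M n x.
Proof.
have WE w : word_prod (fun c => lam *: M c) w = lam ^+ size w *: word_prod M w.
  elim: w => [|c w IHw]; first by rewrite !word_prod0 expr0 scale1r.
  by rewrite !word_prod_cons IHw -scalemxAr -scalemxAl scalerA exprSr.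
rewrite /level_dev scaler_sumr big_seq [RHS]big_seq; apply: eq_bigr => w.
by rewrite mem_words => /eqP <-; rewrite WE !scalerA mulrC.
Qed.

End WordProduct.

Section Summability.
Variables (R : realType) (d : nat).
Implicit Types x : Espace R d.

Lemma l1norm_le_pnorm n (x : tseries R d) :
  l1norm n x <= d%:R ^+ n * pnorm (level x n).
Proof.
rewrite /l1norm; apply: (@le_trans _ _ (\sum_(w <- words d n) pnorm (level x n))).
  rewrite big_seq [leRHS]big_seq; apply: ler_sum => w; rewrite mem_words => /eqP <-.
  exact: ler_coord_level.
by rewrite big_const_seq count_predT iter_addr_0 size_words -natrX mulr_natl.
Qed.

Lemma Espace_summable x (lam : R) : 0 <= lam ->
  cvgn (series (fun n => lam ^+ n * l1norm n (Defs.eseries x))).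
Proof.
move=> lam0.
(* Passing from the projective to the l1 norm costs d^n at level n, which the weight absorbs since E
   allows every weight. *)
have ld0 : 0 <= lam * d%:R by rewrite mulr_ge0.
have fin := eseriesP x ld0.
apply: nondecreasing_is_cvgn.
  move=> m n mn; rewrite /series /= [leRHS](big_cat_nat _ (n := m)) //= lerDl.
  by apply: sumr_ge0 => i _; rewrite mulr_ge0 ?exprn_ge0 ?l1norm_ge0.
exists (fine (weighted_norm (lam * d%:R) (Defs.eseries x))) => _ [N _ <-].
rewrite -lee_fin fineK; last first.
  rewrite ge0_fin_numE //; apply: nneseries_ge0 => n _ _.
  by rewrite lee_fin mulr_ge0 ?exprn_ge0 ?pnorm_ge0.
apply: le_trans (nneseries_lim_ge N _); last first.
  by move=> n _ _; rewrite lee_fin mulr_ge0 ?exprn_ge0 ?pnorm_ge0.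
rewrite sumEFin lee_fin; apply: ler_sum => n _.
by rewrite exprMn -mulrA ler_wpM2l ?exprn_ge0 ?l1norm_le_pnorm.
Qed.

Definition dev k (M : 'I_d -> 'M[R]_k) x i j : R :=
  limn (series (fun n => level_dev M n (Defs.eseries x) i j)).

Lemma developmentE k (F : 'rV[R]_d -> 'M[R]_k) x i j :
  development F x i j = dev (fun c => F (delta_mx ord0 c)) x i j.
Proof.
rewrite mxE /dev; congr (lim (_ @ \oo)); apply/funext => N; rewrite /series /=.
by apply: eq_bigr => n _; rewrite mx_tensor_powerE.
Qed.

Lemma normed_cvg_dev k (M : 'I_d -> 'M[R]_k) x i j :
  cvgn [normed series (fun n => level_dev M n (Defs.eseries x) i j)].
Proof.
apply: (@series_le_cvg _ _ (fun n => letters_bound M ^+ n * l1norm n (Defs.eseries x))).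
- by move=> n; exact: normr_ge0.
- by move=> n; rewrite mulr_ge0 ?l1norm_ge0 ?exprn_ge0 // (le_trans ler01) // letters_bound_ge1.
- by move=> n; exact: ler_norm_level_dev.
- by apply: Espace_summable; rewrite (le_trans ler01) // letters_bound_ge1.
Qed.

Lemma cvg_dev k (M : 'I_d -> 'M[R]_k) x i j :
  series (fun n => level_dev M n (Defs.eseries x) i j) @ \oo --> dev M x i j.
Proof. exact/normed_cvg/normed_cvg_dev. Qed.

End Summability.

Section Unshuffle.
Variable T : Type.

Lemma eq_unshuffle_sum (V : zmodType) w (G H : seq T -> seq T -> V) :
  (forall u v, G u v = H u v) -> unshuffle_sum w G = unshuffle_sum w H.
Proof.
elim: w G H => [|a w IHw] G H GH /=; first exact: GH.
by congr (_ + _); apply: IHw => u v.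
Qed.

Lemma mulmx_unshuffle_sum (R : pzRingType) m n p (B : 'M[R]_(m, n)) w
    (G : seq T -> seq T -> 'M[R]_(n, p)) :
  B *m unshuffle_sum w G = unshuffle_sum w (fun u v => B *m G u v).
Proof. by elim: w G => [//|a w IHw] G /=; rewrite mulmxDr !IHw. Qed.

End Unshuffle.

Section Tensor.
Variables (R : realType) (d k k' : nat).
Variables (M : 'I_d -> 'M[R]_k) (M' : 'I_d -> 'M[R]_k').

Definition tens_sum (c : 'I_d) : 'M[R]_(k * k') :=
  tensmx (M c) 1%:M + tensmx 1%:M (M' c).

Lemma tens_sum_so : (forall c, (M c)^T = - M c) -> (forall c, (M' c)^T = - M' c) ->
  forall c, (tens_sum c)^T = - tens_sum c.
Proof.
move=> MT MT' c; rewrite /tens_sum linearD /= !trmx_tens !trmx1 MT MT' opprD.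
by congr (_ + _); apply/matrixP => i j; rewrite !mxE ?mulNr ?mulrN.
Qed.

(** Each letter acts on one of the two tensor factors, so expanding the product distributes the
    letters over two subwords. *)
Lemma word_prod_tens_sum w : word_prod tens_sum w =
  unshuffle_sum w (fun u v => tensmx (word_prod M u) (word_prod M' v)).
Proof.
elim: w => [|c w IHw] /=.
  rewrite !word_prod0; apply/matrixP => p q.
  case: (mxtens_indexP p) => i i'; case: (mxtens_indexP q) => j j'.
  rewrite tensmxE !mxE (can_eq (@mxtens_indexK k k')) xpair_eqE.
  by case: (i == j); case: (i' == j'); rewrite ?mulr1 ?mulr0.
rewrite word_prod_cons IHw /tens_sum mulmxDl !mulmx_unshuffle_sum.
by congr (_ + _); apply: eq_unshuffle_sum => u v;
  rewrite tensmx_mul mul1mx word_prod_cons.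
Qed.

(** By adjointness the unshuffled words become shuffle sums of [x], which factor because [x] is
    group-like. *)
Lemma level_dev_tens_sum n (x : tseries R d) i i' j j' : group_like x ->
  level_dev tens_sum n x (mxtens_index (i, i')) (mxtens_index (j, j')) =
  cauchy_product (fun n => level_dev M n x i j) (fun n => level_dev M' n x i' j') n.
Proof.
move=> [_ xsh]; rewrite /level_dev.
under eq_bigr => w _ do rewrite word_prod_tens_sum.
rewrite big_words_unshuffle summxE; apply: eq_bigr => a _.
rewrite !summxE mulr_suml; apply: eq_bigr => u _.
rewrite summxE mulr_sumr; apply: eq_bigr => v _.
by rewrite -xsh !mxE !mxtens_indexK /=; ring.
Qed.

Lemma dev_tens_sum (x : Espace R d) i i' j j' : group_like (Defs.eseries x) ->
  dev tens_sum x (mxtens_index (i, i')) (mxtens_index (j, j')) =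
  dev M x i j * dev M' x i' j'.
Proof.
move=> gx.
have H := cvg_cauchy_product (@normed_cvg_dev R d k M x i j)
  (@normed_cvg_dev R d k' M' x i' j').
rewrite {2 3}/dev -(cvg_lim (@norm_hausdorff _ _) H) /dev.
congr (lim (series _ @ \oo)); apply/funext => n; exact: level_dev_tens_sum.
Qed.

End Tensor.

Section Orthogonality.
Variables (R : realType) (d k : nat) (M : 'I_d -> 'M[R]_k).
Hypothesis MT : forall c, (M c)^T = - M c.

(* The invariant vector sum_i e_i (x) e_i of the tensor square. *)
Let om : 'cV[R]_(k * k) :=
  \col_p ((mxtens_unindex p).1 == (mxtens_unindex p).2)%:R.

Lemma big_mxtens (F : 'I_(k * k) -> R) :
  \sum_p F p = \sum_i \sum_j F (mxtens_index (i, j)).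
Proof.
rewrite pair_big; apply: reindex => //=.
by exists (@mxtens_unindex k k) => p; rewrite (mxtens_indexK, mxtens_unindexK) //;
  case: p.
Qed.

(** The entry at (i, j) is M_ij + M_ji, so invariance of the vector is exactly antisymmetry. *)
Lemma tens_sum_invariant c : tens_sum M M c *m om = 0.
Proof.
apply/matrixP => p q; case: (mxtens_indexP p) => i j; rewrite ord1 !mxE big_mxtens.
rewrite (eq_bigr (fun a => tens_sum M M c (mxtens_index (i, j)) (mxtens_index (a, a)))); last first.
  move=> a _; rewrite (bigD1 a) //= big1 ?addr0 => [|b ba].
    by rewrite [om _ _]mxE mxtens_indexK /= eqxx mulr1.
  by rewrite [om _ _]mxE mxtens_indexK /= eq_sym (negbTE ba) mulr0.
under eq_bigr => a _ do rewrite mxE !tensmxE [1%:M _ _]mxE [1%:M i a]mxE.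
rewrite big_split /= (bigD1 j) //= eqxx mulr1 big1 ?addr0; last first.
  by move=> a aj; rewrite eq_sym (negbTE aj) mulr0.
rewrite (bigD1 i) //= eqxx mul1r big1 ?addr0; last first.
  by move=> a ai; rewrite eq_sym (negbTE ai) mul0r.
by have /matrixP/(_ j i) := MT c; rewrite !mxE => ->; rewrite addNr.
Qed.

Lemma word_prod_invariant w : w != [::] -> word_prod (tens_sum M M) w *m om = 0.
Proof.
elim: w => [//|c [|b w] IHw _].
  by rewrite word_prod_cons word_prod0 mulmx1 tens_sum_invariant.
by rewrite word_prod_cons -mulmxA IHw // mulmx0.
Qed.

(** Words of positive length kill the invariant vector, so the tensor square of the development
    fixes it. The entry (i, i) of this identity says that row i has norm 1. *)
Lemma dev_orthogonal (x : Espace R d) i : group_like (Defs.eseries x) ->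
  \sum_b dev M x i b ^+ 2 = 1.
Proof.
move=> gx.
pose u n := (level_dev (tens_sum M M) n (Defs.eseries x) *m om) (mxtens_index (i, i)) ord0.
have uE n : u n = \sum_b level_dev (tens_sum M M) n (Defs.eseries x)
    (mxtens_index (i, i)) (mxtens_index (b, b)).
  rewrite /u mxE big_mxtens; apply: eq_bigr => b _.
  rewrite (bigD1 b) //= big1 ?addr0 => [|b' bb'].
    by rewrite [om _ _]mxE mxtens_indexK /= eqxx mulr1.
  by rewrite [om _ _]mxE mxtens_indexK /= eq_sym (negbTE bb') mulr0.
have cu : series u n @[n --> \oo] --> \sum_b dev M x i b ^+ 2.
  have -> : series u = (fun n => \sum_b series (fun m => level_dev (tens_sum M M) m (Defs.eseries x)
    (mxtens_index (i, i)) (mxtens_index (b, b))) n).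
    apply/funext => n; rewrite /series /= exchange_big /=.
    by apply: eq_bigr => m _; rewrite uE.
  apply: cvg_big; first exact: add_continuous.
  move=> b _; rewrite expr2 -dev_tens_sum //; exact: cvg_dev.
have u0 n : (0 < n)%N -> u n = 0.
  move=> n0; rewrite /u /level_dev mulmx_suml summxE big_seq big1 // => w.
  rewrite mem_words => /eqP sw; rewrite -scalemxAl word_prod_invariant ?scaler0 ?mxE //.
  by rewrite -size_eq0 sw -lt0n.
have u1 : u 0%N = 1.
  rewrite /u /level_dev big_words0 word_prod0 gx.1 scale1r mul1mx mxE mxtens_indexK /=.
  by rewrite eqxx.
have su n : (0 < n)%N -> series u n = 1.
  case: n => // n _; rewrite /series /= big_nat_recl //= u1 big1 ?addr0 // => m _.
  exact: u0.
rewrite -(cvg_lim (@norm_hausdorff _ _) cu); apply/cvg_lim => //.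
apply: cvg_near_cst; near=> n; apply: su; near: n; exact: nbhs_infty_gt.
Unshelve. all: by end_near. Qed.

Lemma ler_norm_dev (x : Espace R d) i j : group_like (Defs.eseries x) -> `|dev M x i j| <= 1.
Proof.
move=> gx; rewrite -(@expr_le1 _ 2) ?normr_ge0 // real_normK ?num_real //.
rewrite -(dev_orthogonal i gx) (bigD1 j) //= lerDl; apply: sumr_ge0 => b _.
exact: sqr_ge0.
Qed.

End Orthogonality.

(** * Power series *)

Section LeadingTerm.
Variable R : realType.

(** For lam <= 1 every power beyond n is at most lam^(n+1), which bounds the remainder. This serves
    both the uniqueness of coefficients and the extraction of coordinates. *)
Lemma power_series_leading_term (t : nat -> R) n (lam y : R) :
  cvgn [normed series t] -> (forall m, (m < n)%N -> t m = 0) ->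
  0 <= lam -> lam <= 1 ->
  series (fun m => lam ^+ m * t m) @ \oo --> y ->
  `|y - lam ^+ n * t n| <= lam ^+ n.+1 * limn [normed series t].
Proof.
move=> nt t0 lam0 lam1 cy.
have nds N : [normed series t] N <= limn [normed series t].
  apply: nondecreasing_cvgn_le => // i j ij.
  rewrite /series /= [leRHS](big_cat_nat _ (n := i)) //= lerDl.
  by apply: sumr_ge0 => l _; exact: normr_ge0.
have cd : `|series (fun m => lam ^+ m * t m) N - lam ^+ n * t n| @[N --> \oo] -->
    `|y - lam ^+ n * t n|.
  by apply: cvg_norm; apply: cvgB => //; exact: cvg_cst.
rewrite -(cvg_lim (@norm_hausdorff _ _) cd); apply: limr_le; first exact: cvgP cd.
near=> N; have nN : (n < N)%N by near: N; exact: nbhs_infty_gt.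
apply: le_trans (ler_wpM2l (exprn_ge0 _ lam0) (nds N)).
rewrite /series /= (big_cat_nat _ (n := n.+1)) //= big_nat_recr //=.
rewrite big_nat big1 ?add0r => [|m /andP[_ mn]]; last by rewrite t0 // mulr0.
rewrite addrAC subrr add0r [X in _ <= _ * X](big_cat_nat _ (n := n.+1)) //= mulrDr.
rewrite ler_wpDl //.
  by rewrite mulr_ge0 ?exprn_ge0 // sumr_ge0 // => l _; exact: normr_ge0.
rewrite mulr_sumr; apply: le_trans (ler_norm_sum _ _ _) _.
apply: ler_sum_nat => m /andP[nm _]; rewrite normrM ger0_norm ?exprn_ge0 //.
by rewrite ler_wpM2r // ler_wiXn2l.
Unshelve. all: by end_near. Qed.

Lemma le_all_scaled_eq0 (x S : R) : (forall lam, 0 < lam -> lam <= 1 -> `|x| <= lam * S) -> x = 0.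
Proof.
move=> h; apply/eqP; rewrite -normr_le0; apply/ler_addgt0Pl => e e0; rewrite addr0.
have S0 : 0 <= S by have := h 1 ltr01 (lexx 1); rewrite mul1r; apply: le_trans.
have S1 : 0 < S + 1 by rewrite ltr_wpDl.
apply: le_trans (h (Num.min 1 (e / (S + 1))) _ _) _.
- by rewrite lt_min ltr01 divr_gt0.
- by rewrite ge_min lexx.
- apply: (@le_trans _ _ (e / (S + 1) * S)).
    by rewrite ler_wpM2r // ge_min lexx orbT.
  by rewrite -mulrA ger_pMr // mulrC ler_pdivrMr // mul1r lerDl.
Qed.

(** The sum is assumed to vanish only to the left of the centre, as this is what continuation from
    left to right provides. The coefficients are killed successively by letting the argument tend to
    0. *)
Lemma power_series_coef_eq0 (a : nat -> R) rho : 0 < rho ->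
  (forall z, 0 < z -> z < rho -> series (fun n => a n * (- z) ^+ n) @ \oo --> (0 : R)) ->
  forall n, a n = 0.
Proof.
move=> rho0 h.
pose r := rho / 2.
have r0 : 0 < r by rewrite divr_gt0.
have rrho : r < rho by rewrite /r; lra.
have [C Cb] : exists C, forall n, `|a n * (- r) ^+ n| <= C.
  have cs : cvgn (series (fun n => a n * (- r) ^+ n)) by apply: cvgP; exact: h.
  have [M [_ MP]] := cvg_seq_bounded (cvgP _ (cvg_series_cvg_0 cs)).
  by exists (M + 1) => n; apply: (MP (M + 1)) => //; rewrite ltrDl.
(* The terms are bounded at [r], so at half of it they are dominated by a geometric series of ratio
   1/2. *)
pose q := r / 2; pose t n := a n * (- q) ^+ n.
have tE n : t n = a n * (- r) ^+ n * 2^-1 ^+ n.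
  by rewrite /t -mulrA -exprMn mulNr.
have nt : cvgn [normed series t].
  apply: (@series_le_cvg _ _ (geometric C 2^-1)).
  - by move=> n; exact: normr_ge0.
  - by move=> n; rewrite /= mulr_ge0 ?exprn_ge0 ?invr_ge0 // (le_trans _ (Cb 0%N)).
  - move=> n; rewrite -[leLHS]/(`|t n|) tE normrM /= [`|_ ^+ n|]ger0_norm ?exprn_ge0 ?invr_ge0 //.
    by rewrite ler_wpM2r ?exprn_ge0 ?invr_ge0.
  - by apply: is_cvg_geometric_series; rewrite ger0_norm ?invr_ge0 // invf_lt1 // ltr1n.
have q0 : 0 < q by rewrite divr_gt0.
suff t0 n : t n = 0.
  move=> n; have /eqP := t0 n; rewrite mulf_eq0 expf_eq0 oppr_eq0 (gt_eqF q0) andbF orbF.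
  by move/eqP.
elim/ltn_ind: n => n IHn; apply: (@le_all_scaled_eq0 _ (limn [normed series t])) => lam lam0 lam1.
have := @power_series_leading_term t n lam 0 nt IHn (ltW lam0) lam1.
rewrite sub0r normrN normrM [`|lam ^+ n|]ger0_norm ?exprn_ge0 ?(ltW lam0) //.
rewrite exprSr -mulrA ler_pM2l ?exprn_gt0 //; apply.
rewrite (_ : (fun m => _) = (fun m => a m * (- (lam * q)) ^+ m)); last first.
  by apply/funext => m; rewrite /t -[in RHS]mulrN exprMn mulrCA.
apply: h; first by rewrite mulr_gt0.
apply: (@le_lt_trans _ _ q); first by rewrite ger_pMl.
by rewrite /q; lra.
Qed.

End LeadingTerm.

(** * Identity theorem for real analytic functions *)

Section Analytic.
Variable R : realType.
Implicit Types f g : R -> R.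

Definition analytic_at f (x : R) := exists (a : nat -> R) (rho : R), 0 < rho /\
  forall y, `|y - x| < rho -> series (fun n => a n * (y - x) ^+ n) @ \oo --> f y.

Lemma analytic_eq_extend f g a c : analytic_at f c -> analytic_at g c -> a < c ->
  (forall y, a <= y -> y < c -> f y = g y) ->
  exists2 rho, 0 < rho & forall y, `|y - c| < rho -> f y = g y.
Proof.
move=> [u [r1 [r10 h1]]] [v [r2 [r20 h2]]] ac fg.
have H z : `|z| < r1 -> `|z| < r2 ->
    series (fun n => (u n - v n) * z ^+ n) @ \oo --> f (c + z) - g (c + z).
  move=> z1 z2; have e : c + z - c = z by rewrite addrC addKr.
  have := h1 (c + z); have := h2 (c + z); rewrite !e => /(_ z2) H2 /(_ z1) H1.
  rewrite (_ : series _ = series (fun n => u n * z ^+ n) \- series (fun n => v n * z ^+ n)).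
    exact: cvgB.
  apply/funext => N; rewrite /series /= -sumrB; apply: eq_bigr => n _; exact: mulrBl.
have uv n : u n - v n = 0.
  apply: (@power_series_coef_eq0 R (fun n => u n - v n) (Num.min (Num.min r1 r2) (c - a))).
    by rewrite !lt_min r10 r20 subr_gt0.
  move=> z z0; rewrite !lt_min => /andP[/andP[z1 z2] z3].
  have := H (- z); rewrite normrN gtr0_norm // => /(_ z1 z2).
  rewrite fg ?subrr //; lra.
exists (Num.min r1 r2) => [|y]; first by rewrite lt_min r10.
rewrite lt_min => /andP[y1 y2]; apply/eqP; rewrite -subr_eq0; apply/eqP.
have := H _ y1 y2; rewrite (_ : c + (y - c) = y); last by rewrite addrC subrK.
rewrite (_ : series _ = fun=> 0).
  by move/(cvg_lim (@norm_hausdorff _ _)) => <-; rewrite lim_cst.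
by apply/funext => N; rewrite /series /= big1 // => n _; rewrite uv mul0r.
Qed.

(** At the supremum of the points up to which both functions agree, equality of the two expansions
    carries the agreement further, so the supremum is [b]. The initial interval of length [delta]
    keeps the supremum away from [a]. *)
Lemma analytic_eq_right f g a b delta : (forall x, analytic_at f x) ->
  (forall x, analytic_at g x) -> 0 < delta ->
  (forall y, a <= y -> y < a + delta -> f y = g y) -> a <= b -> f b = g b.
Proof.
move=> fa ga d0 fg ab.
have [bad|bd] := ltP b (a + delta); first exact: fg.
pose S := [set t | a <= t <= b /\ forall y, a <= y -> y <= t -> f y = g y].
have Sd : S (a + delta / 2).
  split; first by apply/andP; split; lra.
  by move=> y ay yd; apply: fg => //; lra.
have supS : has_sup S by split; [exists (a + delta / 2)|exists b => t [/andP[]]].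
pose c := sup S.
have cd : a + delta / 2 <= c by apply: ub_le_sup; [exact: supS.2|].
have cb : c <= b by apply: ge_sup; [exists (a + delta / 2)|move=> t [/andP[]]].
have fgc y : a <= y -> y < c -> f y = g y.
  move=> ay yc; have [t [_ St] ct] := @sup_adherent _ S (c - y) ltac:(lra) supS.
  by apply: St => //; apply/ltW; move: ct; rewrite -/c; lra.
have ac : a < c by lra.
have [rho rho0 h] := analytic_eq_extend (fa c) (ga c) ac fgc.
have fgr y : a <= y -> y < c + rho -> f y = g y.
  move=> ay yr; have [yc|cy] := ltP y c; first exact: fgc.
  by apply: h; rewrite ger0_norm ?subr_ge0 //; lra.
have St : S (Num.min b (c + rho / 2)).
  split; first by rewrite le_min ge_min lexx ab /=; lra.
  by move=> y ay; rewrite le_min => /andP[_ yc]; apply: fgr => //; lra.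
have : Num.min b (c + rho / 2) <= c by apply: ub_le_sup; [exact: supS.2|].
rewrite ge_min => /orP[bc|]; last lra.
by apply: fgr => //; lra.
Qed.

Lemma analytic_atN f x : analytic_at f (- x) -> analytic_at (f \o -%R) x.
Proof.
move=> [a [rho [rho0 h]]]; exists (fun n => (-1) ^+ n * a n), rho; split=> // y yx.
have e : - y - - x = - (y - x) by rewrite opprD.
have := h (- y); rewrite e normrN => /(_ yx).
rewrite (_ : (fun n => a n * _) = (fun n => (-1) ^+ n * a n * (y - x) ^+ n)) //.
by apply/funext => n; rewrite [in LHS]exprNn mulrCA mulrA.
Qed.

Lemma analytic_eq f g delta : (forall x, analytic_at f x) ->
  (forall x, analytic_at g x) -> 0 < delta ->
  (forall y, `|y| < delta -> f y = g y) -> forall x, f x = g x.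
Proof.
move=> fa ga d0 fg x; have [x0|x0] := leP 0 x.
  apply: (@analytic_eq_right f g 0 x delta) => // y y0; rewrite add0r => yd.
  by apply: fg; rewrite ger0_norm.
rewrite -[x]opprK.
apply: (@analytic_eq_right (f \o -%R) (g \o -%R) 0 (- x) delta) => //.
- by move=> y; exact: analytic_atN.
- by move=> y; exact: analytic_atN.
- by move=> y y0; rewrite add0r => yd; apply: fg; rewrite normrN ger0_norm.
- by rewrite oppr_ge0 ltW.
Qed.

End Analytic.

(** * Coordinates as limits of rescaled developments *)

Section CoordinateExtraction.
Variables (R : realType) (d : nat) (w : seq 'I_d).
Local Notation n := (size w).

(* The word w is the only one of length n that labels a walk from 0 to n in the
   path graph on {0, .., n} whose edge {a, a + 1} is labelled by w_a. *)
Definition letter_mx (c : 'I_d) : 'M[R]_n.+1 :=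
  \matrix_(a, b) (((b == a.+1 :> nat) && (nth c w a == c))%:R -
                  ((a == b.+1 :> nat) && (nth c w b == c))%:R).

Lemma letter_mx_so c : (letter_mx c)^T = - letter_mx c.
Proof. by apply/matrixP => a b; rewrite !mxE opprB. Qed.

Lemma letter_mx_far c (a b : 'I_n.+1) : (a.+1 < b)%N -> letter_mx c a b = 0.
Proof.
move=> ab; rewrite mxE gtn_eqF //= [X in _ - X](_ : _ = 0) ?subrr //.
by rewrite ltn_eqF // (ltn_trans (ltnSn a)) // (ltn_trans ab).
Qed.

(** A step raises the index by at most one. Hence [b] is out of reach in fewer than b - a steps, and
    in exactly b - a steps every step goes up and compares a letter of [v] with the one of [w]. *)
Lemma letter_mx_prod v (a b : 'I_n.+1) :
  ((a + size v < b)%N -> word_prod letter_mx v a b = 0) /\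
  ((a + size v)%N = b -> word_prod letter_mx v a b = (v == take (size v) (drop a w))%:R).
Proof.
elim: v a => [|c v IHv] a /=.
  rewrite addn0 word_prod0 mxE take0 eqxx; split; last by move=> /val_inj ->; rewrite eqxx.
  by move=> ab; rewrite (_ : a == b = false) //; apply/negbTE; rewrite -val_eqE /= ltn_eqF.
rewrite word_prod_cons mxE addnS; split.
  move=> ab; apply: big1 => l _; have [la|al] := leqP l a.+1.
    by rewrite (IHv l).1 ?mulr0 // (leq_ltn_trans _ ab) // -addSn leq_add2r.
  by rewrite letter_mx_far ?mul0r.
move=> ab.
have an : (a < n)%N.
  by rewrite -ltnS (leq_trans _ (ltn_ord b)) // -ab !ltnS leq_addr.
have a1 : (a.+1 < n.+1)%N by [].
rewrite (bigD1 (Ordinal a1)) //= [X in _ + X]big1 ?addr0; last first.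
  move=> l la; have [/letter_mx_far ->|] := ltnP a.+1 l; first by rewrite mul0r.
  rewrite leq_eqVlt => /orP[/eqP e|lt]; first by rewrite -val_eqE /= e eqxx in la.
  by rewrite (IHv l).1 ?mulr0 // -ab ltnS leq_add2r -ltnS.
rewrite (IHv (Ordinal a1)).2 /= ?addSn // mxE /= eqxx /=.
rewrite [X in _ - X](_ : _ = 0); last by rewrite ltn_eqF.
by rewrite subr0 (drop_nth c an) /= eqseq_cons [c == _]eq_sym -natrM mulnb.
Qed.

Lemma level_dev_letter_mx m (x : tseries R d) :
  ((m < n)%N -> level_dev letter_mx m x ord0 ord_max = 0) /\
  level_dev letter_mx n x ord0 ord_max = x w.
Proof.
rewrite /level_dev !summxE; split.
  move=> mn; rewrite big_seq big1 // => v; rewrite mem_words => /eqP sv.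
  by rewrite mxE (letter_mx_prod v _ _).1 ?mulr0 //= add0n sv.
rewrite (bigD1_seq w) ?words_uniq ?mem_words //= mxE.
rewrite (letter_mx_prod w _ _).2 /= ?add0n // drop0 take_size eqxx mulr1.
rewrite big_seq_cond big1 ?addr0 // => v; rewrite mem_words => /andP[/eqP sv vw].
rewrite mxE (letter_mx_prod v _ _).2 /= ?add0n // drop0 sv take_size.
by rewrite (negbTE vw) mulr0.
Qed.

(** Scaling the letters by lam multiplies level m by lam^m. In the corner entry the levels below n
    vanish and level n is the coordinate at [w], so after division by lam^n the error is of order
    lam. *)
Lemma cvg_dev_letter_mx (x : Espace R d) :
  m.+1%:R ^+ n * dev (fun c => m.+1%:R^-1 *: letter_mx c) x ord0 ord_max @[m --> \oo]
  --> Defs.eseries x w.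
Proof.
set t := fun m => level_dev letter_mx m (Defs.eseries x) ord0 ord_max.
have tn : t n = Defs.eseries x w by exact: (level_dev_letter_mx 0 _).2.
have t0 m : (m < n)%N -> t m = 0 by exact: (level_dev_letter_mx m _).1.
have nt : cvgn [normed series t] by exact: normed_cvg_dev.
pose S := limn [normed series t].
have bd m : `|Defs.eseries x w - m.+1%:R ^+ n *
    dev (fun c => m.+1%:R^-1 *: letter_mx c) x ord0 ord_max| <= m.+1%:R^-1 * S.
  have m0 : 0 < m.+1%:R :> R by rewrite ltr0n.
  have := @power_series_leading_term R t n m.+1%:R^-1
    (dev (fun c => m.+1%:R^-1 *: letter_mx c) x ord0 ord_max) nt t0 _ _ _.
  rewrite invr_ge0 (ltW m0) invf_le1 // ler1n => /(_ isT isT) H.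
  rewrite distrC -tn -(@ler_pM2l _ (m.+1%:R^-1 ^+ n)) ?exprn_gt0 ?invr_gt0 //.
  rewrite -[X in X * `|_|]ger0_norm ?exprn_ge0 ?invr_ge0 ?(ltW m0) // -normrM mulrBr.
  rewrite mulrA -exprMn mulVf ?gt_eqF // expr1n mul1r mulrA -exprSr; apply: H.
  have := @cvg_dev R d n.+1 (fun c => m.+1%:R^-1 *: letter_mx c) x ord0 ord_max.
  rewrite (_ : (fun k => level_dev _ k _ _ _) = (fun k => m.+1%:R^-1 ^+ k * t k)) //.
  by apply/funext => k; rewrite level_dev_scale mxE.
have S0 : m.+1%:R^-1 * S @[m --> \oo] --> (0 : R).
  rewrite -[X in _ --> X](mul0r S); apply: cvgMl; exact: cvg_harmonic.
apply/cvgrPdist_le => e e0.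
move/cvgrPdist_le : S0 => /(_ e e0); apply: filterS => m.
rewrite sub0r normrN => h; apply: le_trans (bd m) _.
exact: le_trans (ler_norm _) h.
Qed.

End CoordinateExtraction.

(** * The Borel sets of E *)

Section EspaceBorel.
Variables (R : realType) (d : nat).
Local Notation E := (Espace R d).
Local Notation ser := (@Defs.eseries R d).

Lemma ler_coord_weighted_norm (z : tseries R d) w :
  (`|z w|%:E <= weighted_norm 1 z)%E.
Proof.
apply: (@le_trans _ _ (pnorm (level z (size w)))%:E).
  by rewrite lee_fin ler_coord_level.
have nn n : (0 <= ((1 : R) ^+ n * pnorm (level z n))%:E)%E.
  by rewrite lee_fin expr1n mul1r pnorm_ge0.
rewrite /weighted_norm; apply: le_trans (nneseries_lim_ge (size w).+1 _); last by move=> n _ _.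
rewrite big_nat_recr //= expr1n mul1r leeDr //.
by apply: sume_ge0 => n _.
Qed.

Lemma open_coord_gt w c : open [set x : E | c < ser x w].
Proof.
move=> x /= cx; exists 1%N, (ser x w - c); split; first by rewrite subr_gt0.
move=> y /(_ 1%N (leqnn 1)) h /=.
have := le_lt_trans (ler_coord_weighted_norm (ser y \- ser x) w) h.
rewrite lte_fin /= ltr_norml => /andP[]; lra.
Qed.

Lemma measurable_coord w : measurable_fun setT (fun x : Eborel R d => ser x w).
Proof.
apply: (measurability _ (RGenOInfty.measurableE R)) => //.
move=> /= _ [_ [c ->] <-]; rewrite setTI; apply: sub_sigma_algebra.
rewrite (_ : _ @^-1` _ = [set x : E | c < ser x w]); first exact: open_coord_gt.
by apply/seteqP; split=> x /=; rewrite in_itv /= andbT.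
Qed.

Lemma measurable_level_dev dT (T : measurableType dT) k (M : 'I_d -> 'M[R]_k) n i j (f : T -> tseries R d) :
  (forall w, measurable_fun setT (fun x => f x w)) ->
  measurable_fun setT (fun x => level_dev M n (f x) i j).
Proof.
move=> mf; rewrite (_ : (fun x => _) = (fun x => \sum_(w <- words d n) f x w * word_prod M w i j)).
  by apply: measurable_sum => w; apply: measurable_funM => //; exact: measurable_cst.
by apply/funext => x; rewrite /level_dev summxE; apply: eq_bigr => w _; rewrite mxE.
Qed.

Lemma measurable_dev k (M : 'I_d -> 'M[R]_k) i j :
  measurable_fun setT (fun x : Eborel R d => dev M x i j).
Proof.
apply: (@measurable_fun_cvg _ _ _ setT
  (fun N (x : Eborel R d) => series (fun n => level_dev M n (ser x) i j) N)).
- move=> N; apply: measurable_sum => n; apply: measurable_level_dev; exact: measurable_coord.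
- by move=> x _; exact: cvg_dev.
Qed.

(** The l1 norm is visibly a measurable function of the coordinates and satisfies the triangle
    inequality termwise. With weight m it dominates all seminorms of weight j <= m at once. *)
Definition l1weight m (z : tseries R d) : \bar R :=
  (\sum_(n <oo) (m%:R ^+ n * l1norm n z)%:E)%E.

Lemma l1weight_term_ge0 m (z : tseries R d) n : (0 <= (m%:R ^+ n * l1norm n z)%:E)%E.
Proof. by rewrite lee_fin mulr_ge0 ?exprn_ge0 ?l1norm_ge0. Qed.

Lemma l1weightD m (z z' : tseries R d) :
  (l1weight m (z \+ z')%R <= l1weight m z + l1weight m z')%E.
Proof.
rewrite /l1weight -nneseriesD; [|by move=> n _ _; exact: l1weight_term_ge0..].
apply: lee_nneseries => n _; first by move=> _; exact: l1weight_term_ge0.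
rewrite -EFinD lee_fin -mulrDr ler_wpM2l ?exprn_ge0 //.
by rewrite /l1norm -big_split; apply: ler_sum => w _; exact: ler_normD.
Qed.

Lemma weighted_norm_le_l1weight j m (z : tseries R d) : (j <= m)%N ->
  (weighted_norm j%:R z <= l1weight m z)%E.
Proof.
move=> jm; apply: lee_nneseries => n _.
  by move=> _; rewrite lee_fin mulr_ge0 ?exprn_ge0 ?pnorm_ge0.
rewrite lee_fin; apply: ler_pM; rewrite ?exprn_ge0 ?pnorm_ge0 //.
  by apply: lerXn2r; rewrite ?nnegrE ?ler0n ?ler_nat.
exact: pnorm_level_le.
Qed.

Lemma l1normN n (z z' : tseries R d) : l1norm n (z \- z')%R = l1norm n (z' \- z)%R.
Proof. by apply: eq_bigr => w _; rewrite /= distrC. Qed.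

(** Finitely supported rational series, coded by lists so that they are indexed by a countable
    type. *)
Definition rat_series (l : seq (seq 'I_d * rat)) : tseries R d :=
  fun w => \sum_(p <- l | p.1 == w) ratr p.2.

Lemma rat_series_dense (x : E) m (eps : R) : 0 < eps ->
  exists l, (l1weight m (ser x \- rat_series l)%R < eps%:E)%E.
Proof.
move=> eps0.
have cx := @Espace_summable R d x m%:R (ler0n _ _).
set a := fun n => m%:R ^+ n * l1norm n (ser x) in cx.
have a0 n : 0 <= a n by rewrite mulr_ge0 ?exprn_ge0 ?l1norm_ge0.
have nda : nondecreasing_seq (series a).
  by apply/nondecreasing_series => n _ _.
have e4 : 0 < eps / 4 by rewrite divr_gt0.
have [N _ NP] : \forall N \near \oo, `|limn (series a) - series a N| < eps / 4.
  by have /cvgrPdist_lt/(_ _ e4) := cx.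
have tail K : \sum_(N <= n < N + K) a n <= eps / 4.
  have h : series a (N + K)%N - series a N <= limn (series a) - series a N.
    by rewrite lerD2r; exact: nondecreasing_cvgn_le.
  have : `|limn (series a) - series a N| < eps / 4 by apply: NP => /=.
  move/(le_lt_trans (ler_norm _))/(le_lt_trans h)/ltW.
  by rewrite /series /= (big_cat_nat _ (n := N)) ?leq_addr //= addrAC subrr add0r.
(* The weighted number of words shorter than [N]: precision [eta] in each coordinate costs at most
   eps/4 there, and the tail another eps/4. *)
pose Kc : R := \sum_(0 <= n < N) m%:R ^+ n * (d ^ n)%:R.
have Kc0 : 0 <= Kc by apply: sumr_ge0 => n _; rewrite mulr_ge0 ?exprn_ge0.
pose eta := eps / 4 / (Kc + 1).
have Kc1 : 0 < Kc + 1 by rewrite ltr_wpDl.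
have eta0 : 0 < eta by rewrite divr_gt0.
have /choice[r rP] : forall w, exists r : rat, `|ser x w - ratr r| < eta.
  move=> w; have [r] := @rat_in_itvoo R (ser x w - eta) (ser x w + eta) ltac:(lra).
  rewrite in_itv /= => /andP[r1 r2]; exists r.
  by rewrite ltr_norml; apply/andP; split; lra.
pose ws := undup (flatten [seq words d n | n <- iota 0 N]).
have wsP w : (w \in ws) = (size w < N)%N.
  rewrite mem_undup; apply/flatten_mapP/idP => [[n]|wN].
    by rewrite mem_iota mem_words add0n => /andP[_ nN] /eqP ->.
  by exists (size w); rewrite ?mem_words // mem_iota add0n.
exists [seq (w, r w) | w <- ws].
have serE w : rat_series [seq (w, r w) | w <- ws] w = if (size w < N)%N then ratr (r w) else 0.
  rewrite /rat_series big_map /= -wsP.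
  case: ifPn => wws.
    rewrite big_mkcond (bigD1_seq w) //= ?undup_uniq // eqxx.
    by rewrite big1 ?addr0 // => u /negbTE ->.
  rewrite big1_seq // => u /andP[/eqP -> uws].
  by rewrite uws in wws.
apply: (@le_lt_trans _ _ (eps / 2)%:E); last by rewrite lte_fin; lra.
apply: lime_le.
  by apply: is_cvg_nneseries => n _ _; exact: l1weight_term_ge0.
near=> L; rewrite sumEFin lee_fin.
have NL : (N <= L)%N by near: L; exact: nbhs_infty_ge.
rewrite (big_cat_nat _ (n := N)) //=.
have -> : eps / 2 = eps / 4 + eps / 4 by field.
apply: lerD.
  apply: (@le_trans _ _ (eta * Kc)); last first.
    by rewrite /eta -mulrA ger_pMr // mulrC ler_pdivrMr // mul1r lerDl.
  rewrite mulr_sumr; apply: ler_sum_nat => n /andP[_ nN].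
  rewrite mulrCA ler_wpM2l ?exprn_ge0 // /l1norm.
  apply: (@le_trans _ _ (\sum_(w <- words d n) eta)).
    rewrite big_seq [leRHS]big_seq; apply: ler_sum => w; rewrite mem_words => /eqP sw.
    by rewrite /= serE sw nN ltW.
  by rewrite big_const_seq count_predT iter_addr_0 size_words mulr_natr.
rewrite -[X in \sum_(N <= _ < X) _](subnKC NL); apply: le_trans (tail (L - N)%N).
apply: ler_sum_nat => n /andP[Nn _]; rewrite ler_wpM2l ?exprn_ge0 // /l1norm.
rewrite big_seq [leRHS]big_seq; apply: ler_sum => w; rewrite mem_words => /eqP sw.
by rewrite /= serE sw ltnNge Nn /= subr0.
Unshelve. all: by end_near. Qed.

(* E is second countable, with a base given by countably many balls that are
   measurable for any sigma-algebra making the coordinates measurable. *)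
Lemma open_measurable_of_coords (G : set (set E)) :
  (forall w, measurable_fun setT (fun x : g_sigma_algebraType G => ser x w)) ->
  forall A : set E, open A -> <<s G >> A.
Proof.
move=> mG A oA.
pose B l m (k : nat) : set E := [set y | (l1weight m (ser y \- rat_series l)%R < (k.+1%:R^-1)%:E)%E].
have mB l m k : (measurable : set (set (g_sigma_algebraType G))) (B l m k).
  have mf : measurable_fun setT (fun y : g_sigma_algebraType G => l1weight m (ser y \- rat_series l)%R).
    apply: (@ge0_emeasurable_sum _ _ _ _ (fun n (y : g_sigma_algebraType G) =>
      (m%:R ^+ n * l1norm n (ser y \- rat_series l)%R)%:E) xpredT).
      by move=> n y _ _; exact: l1weight_term_ge0.
    move=> n _; apply/measurable_EFinP; apply: measurable_funM; first exact: measurable_cst.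
    apply: measurable_sum => w; apply: measurableT_comp => //.
    by apply: measurable_funB => //; exact: measurable_cst.
  have := emeasurable_fun_infty_o measurableT mf (k.+1%:R^-1)%:E.
  by rewrite setTI.
(* Balls not contained in [A] are replaced by the empty set, so that the union runs over a fixed
   countable type. *)
pose F (p : seq (seq 'I_d * rat) * nat * nat) : set E :=
  if `[< B p.1.1 p.1.2 p.2 `<=` A >] then B p.1.1 p.1.2 p.2 else set0.
have -> : A = \bigcup_p F p.
  apply/seteqP; split => [x Ax|x [p _]]; last by rewrite /F; case: asboolP => // + Bx; apply.
  have [m [eps [eps0 h]]] := oA x Ax.
  (* Half of eps, because the triangle inequality passes through the rational centre. *)
  have [k _ kP] := near_infty_natSinv_lt (PosNum (divr_gt0 eps0 (ltr0Sn R 1))).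
  have {kP} keps : k.+1%:R^-1 < eps / 2 by apply: kP => /=.
  have k0 : 0 < k.+1%:R^-1 :> R by rewrite invr_gt0.
  have [l lP] := rat_series_dense x m k0.
  exists (l, m, k) => //; rewrite /F; case: asboolP => //=; case=> y yB; apply: h => j jm.
  apply: le_lt_trans (weighted_norm_le_l1weight _ jm) _.
  have -> : (ser y \- ser x)%R = ((ser y \- rat_series l) \+ (rat_series l \- ser x))%R.
    by apply/funext => w /=; rewrite addrA subrK.
  apply: le_lt_trans (l1weightD _ _ _) _.
  have -> : l1weight m (rat_series l \- ser x)%R = l1weight m (ser x \- rat_series l)%R.
    by apply: eq_eseriesr => n _; rewrite l1normN.
  apply: (@lt_trans _ _ (k.+1%:R^-1 + k.+1%:R^-1)%:E); last by rewrite lte_fin [ltRHS]splitr ltrD.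
  by rewrite EFinD; apply: lteD.
apply: (@countable_bigcupT_measurable _ (g_sigma_algebraType G)); first exact: countableP.
by move=> p; rewrite /F; case: asboolP => // _; exact: measurable0.
Qed.

End EspaceBorel.

(** * Determination of laws by bounded multiplicative families *)

Section SignIteration.
Variable R : realType.
Implicit Types t : R.

(** The Newton-Schulz iteration for the sign. It is an odd polynomial that preserves [-1, 1] and
    fixes exactly -1, 0 and 1. *)
Definition sign_step t := (3 * t - t ^+ 3) / 2.

Lemma sign_step_itv t : 0 < t -> t <= 1 -> t <= sign_step t /\ sign_step t <= 1.
Proof.
move=> t0 t1; split; rewrite -subr_ge0.
  have -> : sign_step t - t = t * (1 - t) * (1 + t) / 2 by rewrite /sign_step; field.
  by rewrite divr_ge0 // mulr_ge0 ?mulr_ge0 //; lra.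
have -> : 1 - sign_step t = (1 - t) ^+ 2 * (2 + t) / 2 by rewrite /sign_step; field.
by rewrite divr_ge0 // mulr_ge0 ?sqr_ge0 //; lra.
Qed.

Lemma iter_sign_stepN n t : iter n sign_step (- t) = - iter n sign_step t.
Proof. by elim: n => [//|n IHn]; rewrite !iterS IHn /sign_step; field. Qed.

Lemma iter_sign_step0 n : iter n sign_step 0 = 0.
Proof. by elim: n => [//|n IHn]; rewrite iterS IHn /sign_step; field. Qed.

Lemma iter_sign_step_itv n t : 0 < t -> t <= 1 ->
  t <= iter n sign_step t /\ iter n sign_step t <= 1.
Proof.
move=> t0 t1; elim: n => [//|n [h1 h2]]; rewrite iterS.
have [h3 h4] := sign_step_itv (lt_le_trans t0 h1) h2; split => //.
exact: le_trans h3.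
Qed.

Lemma iter_sign_step_le1 n t : `|t| <= 1 -> `|iter n sign_step t| <= 1.
Proof.
have pos u : 0 < u -> u <= 1 -> `|iter n sign_step u| <= 1.
  move=> u0 u1; have [h1 h2] := iter_sign_step_itv n u0 u1.
  by rewrite ger0_norm // (le_trans (ltW u0)).
rewrite ler_norml => /andP[t1 t2]; have [t0|t0|->] := ltgtP t 0.
- by have := pos (- t); rewrite iter_sign_stepN normrN; apply; lra.
- exact: pos.
- by rewrite iter_sign_step0 normr0.
Qed.

(** On ]0, 1] the iterates increase to a positive fixed point, which can only be 1; oddness gives
    the negative side. *)
Lemma cvg_iter_sign_step t : `|t| <= 1 -> iter n sign_step t @[n --> \oo] --> Num.sg t.
Proof.
have pos u : 0 < u -> u <= 1 -> iter n sign_step u @[n --> \oo] --> (1 : R).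
  move=> u0 u1.
  have nd : nondecreasing_seq (fun n => iter n sign_step u).
    apply/nondecreasing_seqP => n; rewrite iterS.
    have [h1 h2] := iter_sign_step_itv n u0 u1.
    exact: (sign_step_itv (lt_le_trans u0 h1) h2).1.
  have cv : cvgn (fun n => iter n sign_step u).
    apply: nondecreasing_is_cvgn => //; exists 1 => _ [n _ <-].
    exact: (iter_sign_step_itv n u0 u1).2.
  set l := limn (fun n => iter n sign_step u) in cv *.
  have ul : u <= l by exact: (nondecreasing_cvgn_le nd cv 0%N).
  have cs : sign_step (iter n sign_step u) @[n --> \oo] --> sign_step l.
    apply: cvgMl; apply: cvgB; first exact: cvgMr.
    by rewrite !exprS expr0 mulr1; under eq_fun do rewrite !exprS expr0 mulr1;
      apply: cvgM => //; exact: cvgM.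
  have e : sign_step l = l.
    rewrite -(cvg_lim (@norm_hausdorff _ _) cs); apply/cvg_lim => //.
    have := cv; rewrite -(cvg_shiftS (fun n => iter n sign_step u)); exact.
  have l1 : l = 1.
    have : l * (1 - l) * (1 + l) = 0.
      have -> : l * (1 - l) * (1 + l) = 2 * (sign_step l - l) by rewrite /sign_step; field.
      by rewrite e subrr mulr0.
    move/eqP; rewrite !mulf_eq0 => /orP[/orP[]|] /eqP h; lra.
  by rewrite -l1.
rewrite ler_norml => /andP[t1 t2]; have [t0|t0|->] := ltgtP t 0.
- rewrite ltr0_sg // (_ : (fun n => _) = (fun n => - iter n sign_step (- t))).
    by apply: cvgN; apply: pos; lra.
  by apply/funext => n; rewrite iter_sign_stepN opprK.
- by rewrite gtr0_sg //; exact: pos.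
- rewrite sgr0 (_ : (fun n => _) = fun=> 0); first exact: cvg_cst.
  by apply/funext => n; exact: iter_sign_step0.
Qed.

End SignIteration.

Section BoundedExpectation.
Variables (R : realType) (dO : measure_display) (Omega : measurableType dO).
Variable P : probability Omega R.
Implicit Types u v : Omega -> R.

Lemma bounded_integrable u C : measurable_fun setT u -> (forall w, `|u w| <= C) ->
  P.-integrable setT (EFin \o u).
Proof.
move=> mu uC; apply: measurable_bounded_integrable => //.
- by apply: le_lt_trans (probability_le1 P measurableT) _; rewrite ltry.
- exists C; split; first exact: num_real.
  by move=> M /ltW CM w _; exact: le_trans (uC w) CM.
Qed.

Lemma bounded_cvg_Rintegral (un : nat -> Omega -> R) u C :
  (forall n, measurable_fun setT (un n)) -> (forall n w, `|un n w| <= C) ->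
  (forall w, un n w @[n --> \oo] --> u w) ->
  \int[P]_w un n w @[n --> \oo] --> \int[P]_w u w.
Proof.
move=> mu ub uc.
have mlim : measurable_fun setT u.
  by apply: (@measurable_fun_cvg _ _ _ setT un) => // w _; exact: uc.
have bu w : `|u w| <= C.
  rewrite -(cvg_lim (@norm_hausdorff _ _) (cvg_norm (uc w))).
  by apply: limr_le; [apply: cvgP; exact: (cvg_norm (uc w))|near=> n; exact: ub].
have fin : (\int[P]_w (u w)%:E)%E \is a fin_num.
  by apply: integrable_fin_num => //; exact: bounded_integrable bu.
apply: fine_cvg; rewrite fineK //.
apply: (@dominated_cvg _ _ _ P setT measurableT
  (fun n w => (un n w)%:E) (fun w => (u w)%:E) (fun=> C%:E)) => //.
- by move=> n; apply/measurable_EFinP.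
- by move=> w _; apply: cvg_EFin; [near=> n|exact: uc].
- by apply: (@bounded_integrable _ `|C|) => // w.
- by move=> n w _; rewrite lee_fin.
Unshelve. all: by end_near. Qed.

End BoundedExpectation.

Section Multipliers.
Variables (R : realType) (dT : measure_display) (T : measurableType dT).
Variables (dO dO' : measure_display).
Variables (Omega : measurableType dO) (Omega' : measurableType dO').
Variables (P : probability Omega R) (P' : probability Omega' R).
Variables (X : {mfun Omega >-> T}) (Y : {mfun Omega' >-> T}).
Variable F : set (T -> R).
Hypothesis mF : forall f, F f -> measurable_fun setT f.
Hypothesis F1X : forall f w, F f -> `|f (X w)| <= 1.
Hypothesis F1Y : forall f w, F f -> `|f (Y w)| <= 1.
Hypothesis FM : forall f g, F f -> F g -> exists h, [/\ F h,
  forall w, h (X w) = f (X w) * g (X w) & forall w, h (Y w) = f (Y w) * g (Y w)].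
Hypothesis FE : forall f, F f -> \int[P]_w f (X w) = \int[P']_w f (Y w).
Hypothesis F1 : exists f, [/\ F f, forall w, f (X w) = 1 & forall w, f (Y w) = 1].
Implicit Types (a b f g h : T -> R).

(** Bounds are imposed along [X] and [Y] only, since developments are controlled on group-like
    elements and not on all of E. *)
Definition bounded_on_laws h :=
  exists C, (forall w, `|h (X w)| <= C) /\ (forall w, `|h (Y w)| <= C).

Definition same_correlations h := [/\ measurable_fun setT h, bounded_on_laws h &
  forall f, F f -> \int[P]_w (h (X w) * f (X w)) = \int[P']_w (h (Y w) * f (Y w))].

(** Functions with equal correlations need not be stable under products, whereas multipliers are, by
    composition. *)
Definition multiplier a := [/\ measurable_fun setT a, bounded_on_laws a &
  forall h, same_correlations h -> same_correlations (fun x => a x * h x)].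

Lemma bounded_on_lawsM a b : bounded_on_laws a -> bounded_on_laws b ->
  bounded_on_laws (fun x => a x * b x).
Proof.
move=> [C [h1 h2]] [C' [h1' h2']]; exists (C * C').
by split => w; rewrite normrM ler_pM.
Qed.

Lemma bounded_on_lawsD a b : bounded_on_laws a -> bounded_on_laws b ->
  bounded_on_laws (fun x => a x + b x).
Proof.
move=> [C [h1 h2]] [C' [h1' h2']]; exists (C + C').
by split => w; apply: le_trans (ler_normD _ _) _; rewrite lerD.
Qed.

Lemma measurable_law dU (U : measurableType dU) (Z : {mfun U >-> T}) a :
  measurable_fun setT a -> measurable_fun setT (fun w => a (Z w)).
Proof. by move=> ma; apply: measurableT_comp. Qed.

Lemma integrable_correlation h f : measurable_fun setT h -> bounded_on_laws h -> F f ->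
  P.-integrable setT (EFin \o (fun w => h (X w) * f (X w))) /\
  P'.-integrable setT (EFin \o (fun w => h (Y w) * f (Y w))).
Proof.
move=> mh [C [hX hY]] Ff; split; apply: (@bounded_integrable _ _ _ _ _ C).
- by apply: measurable_funM; apply: measurable_law => //; exact: mF.
- move=> w; rewrite normrM -[C]mulr1; apply: ler_pM => //; exact: F1X.
- by apply: measurable_funM; apply: measurable_law => //; exact: mF.
- move=> w; rewrite normrM -[C]mulr1; apply: ler_pM => //; exact: F1Y.
Qed.

Lemma same_correlationsD h h' : same_correlations h -> same_correlations h' ->
  same_correlations (fun x => h x + h' x).
Proof.
move=> [mh bh eh] [mh' bh' eh']; split.
- exact: measurable_funD.
- exact: bounded_on_lawsD.
- move=> f Ff; have [i1 i1'] := integrable_correlation mh bh Ff.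
  have [i2 i2'] := integrable_correlation mh' bh' Ff.
  under eq_Rintegral => w _ do rewrite mulrDl.
  under [RHS]eq_Rintegral => w _ do rewrite mulrDl.
  by rewrite !RintegralD // eh // eh'.
Qed.

Lemma multiplier_cst c : multiplier (fun=> c).
Proof.
split; [exact: measurable_cst|by exists (`|c|); split|].
move=> h [mh bh eh]; split.
- by apply: measurable_funM => //; exact: measurable_cst.
- by apply: bounded_on_lawsM => //; exists `|c|.
- move=> f Ff; have [i1 i1'] := integrable_correlation mh bh Ff.
  under eq_Rintegral => w _ do rewrite -mulrA.
  under [RHS]eq_Rintegral => w _ do rewrite -mulrA.
  by rewrite !RintegralZl // eh.
Qed.

Lemma multiplierD a b : multiplier a -> multiplier b -> multiplier (fun x => a x + b x).
Proof.
move=> [ma ba ha] [mb bb hb]; split.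
- exact: measurable_funD.
- exact: bounded_on_lawsD.
- move=> h hh; rewrite (_ : (fun x => _) = (fun x => a x * h x + b x * h x)).
    by apply: same_correlationsD; [exact: ha|exact: hb].
  by apply/funext => x; rewrite mulrDl.
Qed.

Lemma multiplierM a b : multiplier a -> multiplier b -> multiplier (fun x => a x * b x).
Proof.
move=> [ma ba ha] [mb bb hb]; split.
- exact: measurable_funM.
- exact: bounded_on_lawsM.
- move=> h hh; rewrite (_ : (fun x => _) = (fun x => a x * (b x * h x))).
    by apply: ha; exact: hb.
  by apply/funext => x; rewrite mulrA.
Qed.

Lemma multiplierF f : F f -> multiplier f.
Proof.
move=> Ff; have bf : bounded_on_laws f by exists 1; split => w; [exact: F1X|exact: F1Y].
split => //; first exact: mF.
move=> h [mh bh eh]; split.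
- by apply: measurable_funM => //; exact: mF.
- exact: bounded_on_lawsM.
- move=> g Fg; have [k [Fk kX kY]] := FM Ff Fg.
  under eq_Rintegral => w _ do rewrite mulrAC -kX mulrC.
  under [RHS]eq_Rintegral => w _ do rewrite mulrAC -kY mulrC.
  exact: eh.
Qed.

Lemma multiplier_lim (an : nat -> T -> R) a (C : R) : (forall n, multiplier (an n)) ->
  measurable_fun setT a ->
  (forall n w, `|an n (X w)| <= C) -> (forall n w, `|an n (Y w)| <= C) ->
  (forall w, an n (X w) @[n --> \oo] --> a (X w)) ->
  (forall w, an n (Y w) @[n --> \oo] --> a (Y w)) -> multiplier a.
Proof.
move=> man ma bX bY cX cY.
have ba : bounded_on_laws a.
  exists C; split => w.
    rewrite -(cvg_lim (@norm_hausdorff _ _) (cvg_norm (cX w))).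
    by apply: limr_le; [apply: cvgP; exact: (cvg_norm (cX w))|near=> n; exact: bX].
  rewrite -(cvg_lim (@norm_hausdorff _ _) (cvg_norm (cY w))).
  by apply: limr_le; [apply: cvgP; exact: (cvg_norm (cY w))|near=> n; exact: bY].
split => // h [mh bh eh]; split; [exact: measurable_funM|exact: bounded_on_lawsM|].
move=> f Ff; have [D [hX hY]] := bh.
have intlim dU (U : measurableType dU) (Q : probability U R) (Z : {mfun U >-> T}) :
    (forall w, `|f (Z w)| <= 1) -> (forall n w, `|an n (Z w)| <= C) ->
    (forall w, `|h (Z w)| <= D) -> (forall w, an n (Z w) @[n --> \oo] --> a (Z w)) ->
    \int[Q]_w (an n (Z w) * h (Z w) * f (Z w)) @[n --> \oo] -->
    \int[Q]_w (a (Z w) * h (Z w) * f (Z w)).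
  move=> f1 anC hD ana; apply: (@bounded_cvg_Rintegral _ _ _ _ _ _ (C * D)).
  - move=> n; have [man' _ _] := man n.
    by apply: measurable_funM; [apply: measurable_funM|]; apply: measurable_law => //; exact: mF.
  - move=> n w; rewrite !normrM -[C * D]mulr1; apply: ler_pM => //.
    exact: ler_pM.
  - move=> w; apply: cvgMl; exact: cvgMl.
have lX := intlim _ _ P X (fun w => F1X w Ff) bX hX cX.
have lY := intlim _ _ P' Y (fun w => F1Y w Ff) bY hY cY.
rewrite -(cvg_lim (@norm_hausdorff _ _) lX) -(cvg_lim (@norm_hausdorff _ _) lY).
congr (lim (_ @ \oo)); apply/funext => n; have [_ _ hn] := man n.
by have [_ _ en] := hn h (And3 mh bh eh); exact: en.
Unshelve. all: by end_near. Qed.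

Lemma multiplier_sign_step a : multiplier a -> multiplier (fun x => sign_step (a x)).
Proof.
move=> ma; rewrite /sign_step.
rewrite (_ : (fun x => _) = (fun x => (3 / 2) * a x + (- 2^-1) * (a x * (a x * a x)))).
  apply: multiplierD; apply: multiplierM => //; try exact: multiplier_cst.
  by apply: multiplierM => //; exact: multiplierM.
by apply/funext => x; field.
Qed.

Lemma multiplier_gt f c : F f -> multiplier (\1_[set x | c < f x]).
Proof.
move=> Ff; have c0 : 0 < 1 + `|c| by rewrite ltr_wpDr.
(* Rescaled so that |f| <= 1 implies |t| <= 1, with the sign of f - c. *)
pose t x := (f x - c) / (1 + `|c|).
have mt n : multiplier (fun x => iter n (@sign_step R) (t x)).
  elim: n => [|n IHn] /=; last exact: multiplier_sign_step.
  rewrite (_ : (fun x => _) = (fun x => (1 + `|c|)^-1 * f x + - c / (1 + `|c|))).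
    apply: multiplierD; last exact: multiplier_cst.
    by apply: multiplierM; [exact: multiplier_cst|exact: multiplierF].
  by apply/funext => x; rewrite /t; field; rewrite gt_eqF.
have t1 x : `|f x| <= 1 -> `|t x| <= 1.
  move=> fx; rewrite /t normrM normfV [`|1 + _|]gtr0_norm // ler_pdivrMr // mul1r.
  by apply: le_trans (ler_normB _ _) _; rewrite lerD2r.
(* (s^2 + s) / 2 sends the signs 1, 0, -1 to 1, 0, 0, so the limit is the indicator of the strict
   inequality. *)
pose an n x := (iter n (@sign_step R) (t x) ^+ 2 + iter n (@sign_step R) (t x)) / 2.
have anb n x : `|f x| <= 1 -> `|an n x| <= 1.
  move=> /t1 /(iter_sign_step_le1 n); rewrite /an; set y := iter _ _ _ => y1.
  rewrite normrM normfV [`|2|]ger0_norm // ler_pdivrMr // mul1r.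
  apply: le_trans (ler_normD _ _) _; rewrite -[2]/(1 + 1); apply: lerD => //.
  by rewrite normrX exprn_ile1.
have anc x : `|f x| <= 1 -> an n x @[n --> \oo] --> (\1_[set x | c < f x] x : R).
  move=> /t1 /cvg_iter_sign_step ct.
  have -> : \1_[set x | c < f x] x = (Num.sg (t x) ^+ 2 + Num.sg (t x)) / 2 :> R.
    rewrite indicE /t sgrM [Num.sg _^-1]gtr0_sg ?invr_gt0 // mulr1.
    have [cf|fc|cf] := ltgtP c (f x).
    - by rewrite mem_set //= gtr0_sg ?subr_gt0 // expr1n; field.
    - rewrite memNset /= ?ltr0_sg ?subr_lt0 // ?sqrrN ?expr1n ?subrr ?mul0r //.
      by apply/negP; rewrite -leNgt ltW.
    - by rewrite memNset /= -?cf ?subrr ?sgr0 ?expr0n ?addr0 ?mul0r //; apply/negP; rewrite ltxx.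
  by apply: cvgMl; apply: cvgD => //; rewrite expr2; exact: cvgM.
apply: (@multiplier_lim an _ 1).
- move=> n; rewrite (_ : an n = (fun x => 2^-1 *
    (iter n (@sign_step R) (t x) * iter n (@sign_step R) (t x) +
     iter n (@sign_step R) (t x)))).
    apply: multiplierM; first exact: multiplier_cst.
    by apply: multiplierD => //; exact: multiplierM.
  by apply/funext => x; rewrite /an expr2 mulrC.
- apply: measurable_indic; rewrite -[X in measurable X]setTI.
  rewrite (_ : [set x | c < f x] = f @^-1` `]c, +oo[).
    by apply: mF.
  by apply/seteqP; split => x /=; rewrite in_itv /= andbT.
- by move=> n w; apply: anb; exact: F1X.
- by move=> n w; apply: anb; exact: F1Y.
- by move=> w; apply: anc; exact: F1X.
- by move=> w; apply: anc; exact: F1Y.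
Qed.

Definition multiplier_sets : set (set T) :=
  [set B | measurable B /\ multiplier (\1_B : T -> R)].

(** Complements and finite unions are polynomial in indicators, and countable unions are bounded
    limits of finite ones. Stability under products makes this a sigma-algebra and not just a Dynkin
    system. *)
Lemma multiplier_sets_sigma_algebra : sigma_algebra setT multiplier_sets.
Proof.
have ms0 : multiplier_sets set0.
  split; first exact: measurable0.
  rewrite (_ : \1_set0 = fun=> 0); first exact: multiplier_cst.
  by apply/funext => x; rewrite indicE in_set0.
have msU A B : multiplier_sets A -> multiplier_sets B -> multiplier_sets (A `|` B).
  move=> [mA hA] [mB hB]; split; first exact: measurableU.
  rewrite (_ : \1_(A `|` B) = (fun x : T => \1_A x + (\1_B x + (-1) * (\1_A x * \1_B x)) : R)).
    apply: multiplierD => //; apply: multiplierD => //.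
    by apply: multiplierM; [exact: multiplier_cst|exact: multiplierM].
  apply/funext => x; rewrite !indicE in_setU.
  by case: (x \in A); case: (x \in B) => /=; ring.
split => //.
- move=> A [mA hA]; split; first exact: measurableD.
  rewrite (_ : \1__ = (fun x : T => 1 + (-1) * \1_A x : R)).
    by apply: multiplierD; [|apply: multiplierM => //]; exact: multiplier_cst.
  by apply/funext => x; rewrite !indicE in_setD in_setT /=; case: (x \in A) => /=; ring.
- move=> A msA; split; first by apply: bigcupT_measurable => n; exact: (msA n).1.
  pose U n := \big[setU/set0]_(i < n) A i.
  have msUn n : multiplier_sets (U n).
    elim: n => [|n IHn]; first by rewrite /U big_ord0.
    by rewrite /U big_ord_recr; exact: msU.
  have b1 (B : set T) x : `|\1_B x : R| <= 1.
    by rewrite indicE; case: (x \in B); rewrite ?normr1 ?normr0.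
  have cU x : \1_(U n) x @[n --> \oo] --> (\1_(\bigcup_k A k) x : R).
    have [xA|xA] := pselect ((\bigcup_k A k) x).
      have [k _ Ak] := xA; apply: cvg_near_cst; near=> n.
      rewrite !indicE !mem_set //; rewrite /U -bigcup_mkord; exists k => //=.
      near: n; exact: nbhs_infty_gt.
    apply: cvg_near_cst; near=> n; rewrite !indicE !memNset //.
    by rewrite /U -bigcup_mkord => -[k _ Ak]; apply: xA; exists k.
  apply: (@multiplier_lim (fun n => \1_(U n)) _ 1) => //.
  - by move=> n; exact: (msUn n).2.
  - by apply: measurable_indic; apply: bigcupT_measurable => n; exact: (msA n).1.
Unshelve. all: by end_near. Qed.

Lemma measurable_multiplier_sets f : F f ->
  measurable_fun setT (f : g_sigma_algebraType multiplier_sets -> R).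
Proof.
move=> Ff; apply: (measurability _ (RGenOInfty.measurableE R)) => //.
move=> /= _ [_ [c ->] <-]; rewrite setTI; apply: sub_sigma_algebra.
have -> : f @^-1` `]c, +oo[ = [set x | c < f x].
  by apply/seteqP; split=> x /=; rewrite in_itv /= andbT.
split; last exact: multiplier_gt.
rewrite (_ : [set x | c < f x] = setT `&` f @^-1` `]c, +oo[); first exact: mF.
by rewrite setTI; apply/seteqP; split=> x /=; rewrite in_itv /= andbT.
Qed.

(** The indicator multiplies the constant 1, and the result is paired with the member of [F] that
    equals 1 along both laws. *)
Lemma multiplier_sets_law A : multiplier_sets A -> P (X @^-1` A) = P' (Y @^-1` A).
Proof.
move=> [mA hA].
have c1 : same_correlations (fun=> 1).
  split; [exact: measurable_cst|by exists 1; split => w; rewrite normr1|].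
  move=> f Ff; under eq_Rintegral => w _ do rewrite mul1r.
  by under [RHS]eq_Rintegral => w _ do rewrite mul1r; exact: FE.
have [f [Ff fX fY]] := F1.
have [_ _ hh] := hA; have [_ _ /(_ f Ff)] := hh _ c1.
have E dU (U : measurableType dU) (Q : probability U R) (Z : {mfun U >-> T}) :
    (forall w, f (Z w) = 1) -> \int[Q]_w (\1_A (Z w) * 1 * f (Z w)) = fine (Q (Z @^-1` A)).
  move=> fZ; rewrite /Rintegral; congr fine.
  rewrite -(setIT (Z @^-1` A)) -integral_indic //; last first.
    by rewrite -[X in measurable X]setTI; exact: measurable_funP.
  by apply: eq_integral => w _; rewrite fZ !mulr1 !indicE; congr ((_ : bool)%:R%:E).
rewrite !E // => h.
have mXA : measurable (X @^-1` A) by rewrite -[X in measurable X]setTI; exact: measurable_funP.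
have mYA : measurable (Y @^-1` A) by rewrite -[X in measurable X]setTI; exact: measurable_funP.
by rewrite -(fineK (fin_num_measure P _ mXA)) -(fineK (fin_num_measure P' _ mYA)) h.
Qed.

End Multipliers.

(** * Characteristic functions near zero *)

Lemma nneseries_EFin_cvg (R : realType) (a : nat -> R) :
  cvgn (series a) -> (\sum_(n <oo) (a n)%:E = (limn (series a))%:E)%E.
Proof.
move=> ca; rewrite -EFin_lim //; congr (limn _); apply/funext => n.
by rewrite /= /series /= sumEFin.
Qed.

Section Moments.
Variables (R : realType) (d : nat) (dO : measure_display) (Omega : measurableType dO).
Variables (P : probability Omega R) (S : Omega -> Espace R d).
Local Notation ser := (@Defs.eseries R d).
Variable ES : tseries R d.
Hypothesis Sgl : forall o, group_like (ser (S o)).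
Hypothesis Sint : forall w, P.-integrable setT (fun o => (ser (S o) w)%:E).
Hypothesis ESE : forall w, \int[P]_o ser (S o) w = ES w.

Lemma measurable_sig w : measurable_fun setT (fun o => ser (S o) w).
Proof. by apply/measurable_EFinP; case/integrableP: (Sint w). Qed.

Lemma Rintegral_shuffle_sum u v (F : Omega -> seq 'I_d -> R) :
  (forall w, P.-integrable setT (fun o => (F o w)%:E)) ->
  P.-integrable setT (fun o => (shuffle_sum u v (F o))%:E) /\
  \int[P]_o shuffle_sum u v (F o) = shuffle_sum u v (fun w => \int[P]_o F o w).
Proof.
move: u v F; apply: shuffle_ind => [v|u|a u b v IHu IHv] F Fint.
- by split; [exact: Fint|].
- split; last by rewrite shuffle_sum0r; apply: eq_Rintegral => o _; rewrite shuffle_sum0r.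
  by under eq_fun do rewrite shuffle_sum0r; exact: Fint.
- have [i1 e1] := IHu (fun o => F o \o cons a) (fun w => Fint _).
  have [i2 e2] := IHv (fun o => F o \o cons b) (fun w => Fint _).
  split.
    under eq_fun do rewrite shuffle_sum_cons EFinD.
    exact: integrableD.
  under eq_Rintegral => o _ do rewrite shuffle_sum_cons.
  by rewrite RintegralD // e1 e2.
Qed.

Variables (C B : R).
Hypothesis C0 : 0 <= C.
Hypothesis B0 : 0 <= B.
Hypothesis ESb : forall w, `|ES w| <= C * B ^+ size w.

(* The square of a coordinate of a group-like element is a sum of 4^n
   coordinates of level 2n, so moments of the signature are controlled by the
   expected signature. *)
Lemma first_absolute_moment w :
  (\int[P]_o (`|ser (S o) w|)%:E <= ((1 + C) * (1 + 4 * B ^+ 2) ^+ size w)%:E)%E.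
Proof.
have [i2 e2] := Rintegral_shuffle_sum w w Sint.
have E2 : \int[P]_o (ser (S o) w ^+ 2) <= C * (4 * B ^+ 2) ^+ size w.
  rewrite (@eq_Rintegral _ _ _ _ _ (fun o => shuffle_sum w w (ser (S o)))); last first.
    by move=> o _; rewrite expr2 (Sgl o).2.
  rewrite e2; apply: le_trans (ler_norm _) _.
  apply: le_trans (@ler_norm_shuffle_sum _ _ w w _ (C * B ^+ (size w + size w)) _) _.
    by move=> u su; rewrite ESE -su; exact: ESb.
  by rewrite addnn -mul2n !exprM -natrX mulrCA -exprMn.
have int2 : P.-integrable setT (fun o => (ser (S o) w ^+ 2)%:E).
  by under eq_fun => o do rewrite expr2 (Sgl o).2; exact: i2.
have int1 : P.-integrable setT (fun o => (1 : R)%:E).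
  by apply: (@bounded_integrable _ _ _ P (fun=> 1) 1) => // o; rewrite normr1.
(* From |y| <= 1 + y^2; then 1 + C (4 B^2)^n <= (1 + C) (1 + 4 B^2)^n. *)
apply: (@le_trans _ _ (\int[P]_o ((1 + ser (S o) w ^+ 2)%:E))%E).
  apply: ge0_le_integral => //.
  - by apply/measurable_EFinP; apply: measurableT_comp => //; exact: measurable_sig.
  - apply/measurable_EFinP; apply: measurable_funD; first exact: measurable_cst.
    by apply: measurable_funX; exact: measurable_sig.
  - move=> o _; rewrite lee_fin -[X in _ <= 1 + X]real_normK ?num_real //.
    set y := `|_|; have : 0 <= (y - 1) ^+ 2 + y ^+ 2 + 1.
      by rewrite !addr_ge0 ?sqr_ge0.
    by rewrite sqrrB !expr1n mulr1; lra.
rewrite -[leLHS]fineK; last first.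
  apply: integrable_fin_num => //.
  by under eq_fun do rewrite EFinD; exact: integrableD.
rewrite lee_fin -[leLHS]/(\int[P]_o (1 + ser (S o) w ^+ 2)) RintegralD //.
have -> : \int[P]_o 1 = 1 :> R.
  by rewrite Rintegral_cst //; have /= -> := probability_setT P; rewrite mulr1.
rewrite mulrDl.
have B1 : 1 <= 1 + 4 * B ^+ 2 by rewrite lerDl mulr_ge0 ?sqr_ge0.
apply: lerD; first by rewrite mul1r exprn_ege1.
apply: le_trans E2 _; rewrite ler_wpM2l // lerXn2r ?nnegrE ?mulr_ge0 ?sqr_ge0 //.
  by rewrite (le_trans ler01).
by rewrite lerDr.
Qed.

Lemma Rintegral_level_dev k (M : 'I_d -> 'M[R]_k) n i j :
  P.-integrable setT (fun o => (level_dev M n (ser (S o)) i j)%:E) /\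
  \int[P]_o level_dev M n (ser (S o)) i j = level_dev M n ES i j.
Proof.
have E (x : tseries R d) : level_dev M n x i j = \sum_(w <- words d n) word_prod M w i j * x w.
  by rewrite /level_dev summxE; apply: eq_bigr => w _; rewrite mxE mulrC.
under eq_fun do rewrite E.
rewrite (@eq_Rintegral _ _ _ _ _
  (fun o => \sum_(w <- words d n) word_prod M w i j * ser (S o) w)); last first.
  by move=> o _; exact: E.
rewrite E; elim: (words d n) => [|w ws [IHi IHe]].
  split; last first.
    rewrite big_nil (@eq_Rintegral _ _ _ _ _ (fun=> 0)) ?Rintegral_cst ?mul0r //.
    by move=> o _; rewrite big_nil.
  under eq_fun do rewrite big_nil.
  by apply: (@bounded_integrable _ _ _ P (fun=> 0) 0) => // o; rewrite normr0.
have i1 : P.-integrable setT (fun o => (word_prod M w i j * ser (S o) w)%:E).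
  by under eq_fun do rewrite EFinM; apply: integrableZl.
split.
  by under eq_fun do rewrite big_cons EFinD; exact: integrableD.
rewrite (@eq_Rintegral _ _ _ _ _ (fun o => word_prod M w i j * ser (S o) w +
   \sum_(w <- ws) word_prod M w i j * ser (S o) w)); last by move=> o _; rewrite big_cons.
by rewrite RintegralD // IHe RintegralZl ?ESE ?big_cons //; exact: Sint.
Qed.

(** Dominated convergence for the partial sums: the dominating function [g] sums the l1 norms of the
    levels, and its integral is bounded by a geometric series whose ratio is the left-hand side of
    the hypothesis. *)
Lemma expected_dev k (M : 'I_d -> 'M[R]_k) (lam : R) i j :
  `|lam| * letters_bound M * d%:R * (1 + 4 * B ^+ 2) < 1 ->
  \int[P]_o dev (fun c => lam *: M c) (S o) i j =
  limn (series (fun n => level_dev (fun c => lam *: M c) n ES i j)).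
Proof.
move=> lamb.
pose mu := `|lam| * letters_bound M.
have mu0 : 0 <= mu by rewrite mulr_ge0 // (le_trans ler01) // letters_bound_ge1.
have dom n o : `|level_dev (fun c => lam *: M c) n (ser (S o)) i j| <=
    mu ^+ n * l1norm n (ser (S o)).
  rewrite level_dev_scale mxE normrM normrX exprMn -mulrA ler_wpM2l ?exprn_ge0 //.
  exact: ler_norm_level_dev.
pose g o : \bar R := (\sum_(n <oo) (mu ^+ n * l1norm n (ser (S o)))%:E)%E.
have t0 n o : (0 <= (mu ^+ n * l1norm n (ser (S o)))%:E)%E.
  by rewrite lee_fin mulr_ge0 ?exprn_ge0 ?l1norm_ge0.
have mt n : measurable_fun setT (fun o => (mu ^+ n * l1norm n (ser (S o)))%:E).
  apply/measurable_EFinP; apply: measurable_funM; first exact: measurable_cst.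
  apply: measurable_sum => w; apply: measurableT_comp => //; exact: measurable_sig.
have mg : measurable_fun setT g.
  by apply: (@ge0_emeasurable_sum _ _ _ _ (fun n o => (mu ^+ n * l1norm n (ser (S o)))%:E) xpredT).
have g0 o : (0 <= g o)%E by apply: nneseries_ge0 => n _ _.
(* At level n the matrices contribute mu^n, the words d^n, and each first absolute moment (1 + 4
   B^2)^n up to a constant. *)
pose rho := mu * d%:R * (1 + 4 * B ^+ 2).
have rho0 : 0 <= rho.
  by rewrite mulr_ge0 ?(mulr_ge0 mu0) ?addr_ge0 ?mulr_ge0 ?sqr_ge0.
have intt n : (\int[P]_o (mu ^+ n * l1norm n (ser (S o)))%:E <= ((1 + C) * rho ^+ n)%:E)%E.
  under eq_integral => o _ do rewrite EFinM.
  rewrite ge0_integralZl //; last 3 first.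
  - apply/measurable_EFinP; apply: measurable_sum => w.
    by apply: measurableT_comp => //; exact: measurable_sig.
  - by move=> o _; rewrite lee_fin l1norm_ge0.
  - by rewrite lee_fin exprn_ge0.
  have -> : (1 + C) * rho ^+ n = mu ^+ n * ((1 + C) * (1 + 4 * B ^+ 2) ^+ n * (d ^ n)%:R).
    by rewrite /rho !exprMn natrX; ring.
  rewrite EFinM; apply: lee_wpmul2l; first by rewrite lee_fin exprn_ge0.
  under eq_integral => o _ do rewrite -sumEFin.
  rewrite ge0_integral_sum //; last first.
    by move=> w; apply/measurable_EFinP; apply: measurableT_comp => //; exact: measurable_sig.
  apply: (@le_trans _ _ (\sum_(w <- words d n) ((1 + C) * (1 + 4 * B ^+ 2) ^+ n)%:E)%E).
    rewrite big_seq [leRHS]big_seq; apply: lee_sum => w; rewrite mem_words => /eqP <-.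
    exact: first_absolute_moment.
  by rewrite sumEFin lee_fin big_const_seq count_predT iter_addr_0 size_words mulr_natr.
have crho : cvgn (series (fun n => (1 + C) * rho ^+ n)).
  by apply: is_cvg_geometric_series; rewrite ger0_norm.
have intg : P.-integrable setT g.
  apply/integrableP; split => //.
  under eq_integral => o _ do rewrite gee0_abs //.
  rewrite integral_nneseries //.
  apply: (@le_lt_trans _ _ (\sum_(n <oo) ((1 + C) * rho ^+ n)%:E)%E).
    by apply: lee_nneseries => n _; [move=> _; exact: integral_ge0|exact: intt].
  by rewrite nneseries_EFin_cvg // ltry.
have gb N o : (`|\sum_(0 <= n < N) level_dev (fun c => lam *: M c) n (ser (S o)) i j|%:E <= g o)%E.
  apply: le_trans (nneseries_lim_ge N _); last by move=> n _ _.
  rewrite sumEFin lee_fin; apply: le_trans (ler_norm_sum _ _ _) _.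
  by apply: ler_sum => n _.
pose f N o := (series (fun n => level_dev (fun c => lam *: M c) n (ser (S o)) i j) N)%:E.
have mf N : measurable_fun setT (f N).
  apply/measurable_EFinP; apply: measurable_sum => n.
  by apply: measurable_level_dev => w; exact: measurable_sig.
have cf o : f N o @[N --> \oo] --> (dev (fun c => lam *: M c) (S o) i j)%:E.
  by apply: cvg_EFin; [near=> N|exact: cvg_dev].
have mlim : measurable_fun setT (fun o => (dev (fun c => lam *: M c) (S o) i j)%:E).
  by apply: (emeasurable_fun_cvg f) => // o _; exact: cf.
have [idev _ cdev] := dominated_convergence measurableT mf mlim
  (aeW _ (fun o _ => cf o)) intg (aeW _ (fun o N _ => gb N o)).
have intf N : (\int[P]_o f N o = (series (fun n => level_dev (fun c => lam *: M c) n ES i j) N)%:E)%E.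
  rewrite /f /series; elim: N => [|N IHN] /=.
    by under eq_integral do rewrite big_nil; rewrite integral0 big_nil.
  under eq_integral do rewrite big_nat_recr //= EFinD.
  have [i1 e1] := Rintegral_level_dev (fun c => lam *: M c) N i j.
  rewrite integralD //; last first.
    apply: (le_integrable measurableT _ _ intg) => [|o _]; first exact: mf.
    by rewrite (gee0_abs (g0 o)); exact: gb.
  by rewrite IHN big_nat_recr //= EFinD -e1 fineK // integrable_fin_num.
have fin := integrable_fin_num measurableT idev.
move: cdev; rewrite -(fineK fin) => /fine_cvg cdev.
apply/esym/cvg_lim => //; rewrite (_ : series _ = fun N => fine (\int[P]_o f N o)%E) //.
by apply/funext => N; rewrite intf.
Unshelve. all: by end_near. Qed.

End Moments.

Section LettersMap.
Variables (R : realType) (d k : nat) (A : 'I_d -> 'M[R]_k).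

(** Links the two descriptions of a development: [ROC] quantifies over linear maps, while the
    computations use the images of basis vectors. *)
Definition letters_map (v : 'rV[R]_d) : 'M[R]_k := \sum_c v ord0 c *: A c.

Fact letters_map_is_linear : linear letters_map.
Proof.
move=> a u v; rewrite /letters_map scaler_sumr -big_split; apply: eq_bigr => c _.
by rewrite !mxE scalerDl scalerA.
Qed.

HB.instance Definition _ := GRing.isLinear.Build R 'rV[R]_d 'M[R]_k *:%R
  letters_map letters_map_is_linear.

Lemma letters_map_delta c : letters_map (delta_mx ord0 c) = A c.
Proof.
rewrite /letters_map (bigD1 c) //= mxE !eqxx scale1r big1 ?addr0 // => b bc.
by rewrite mxE (negbTE bc) andbF scale0r.
Qed.

Lemma letters_map_so : (forall c, (A c)^T = - A c) -> forall v, so (letters_map v).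
Proof.
move=> AT v; rewrite /so /= /letters_map linear_sum -sumrN; apply: eq_bigr => c _.
by rewrite linearZ /= AT scalerN.
Qed.

End LettersMap.

(** * The function phi under the conditions on the expected signature *)

Section CharacteristicFunction.
Variables (R : realType) (d : nat) (gam : R -> R) (p : R).
Variables (dO : measure_display) (Omega : measurableType dO).
Variables (P : probability Omega R) (X : random_geometric_rough_path d gam p Omega).
Hypotheses (p1 : 1 <= p) (gam0 : 0 < gam p) (XROC : ROC P X).

Lemma phiE k (F : 'rV[R]_d -> 'M[R]_k) i j :
  phi P X F i j = \int[P]_o dev (fun c => F (delta_mx ord0 c)) (rsig X o) i j.
Proof.
rewrite mxE unlock; congr fine; apply: eq_integral => o _.
by rewrite developmentE.
Qed.

(** A convergent series has bounded terms: any lam > 0 where the series of norms converges gives B =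
    1 / lam. *)
Lemma ESig_geometric_bound : exists C B : R,
  [/\ 0 <= C, 0 <= B & forall w, `|ESig P X w| <= C * B ^+ size w].
Proof.
have [_ r2 _] := XROC.
have [lam lam0 clam] : exists2 lam : R, 0 < lam &
    cvgn (series (fun n => pnorm (level (ESig P X) n) * lam ^+ n)).
  have /ereal_sup_gt[_ [lam [lam0 clam] <-]] := r2.
  by rewrite lte_fin => lam0'; exists lam.
have [M [_ MP]] := cvg_seq_bounded (cvgP _ (cvg_series_cvg_0 clam)).
have MP' n : `|pnorm (level (ESig P X) n) * lam ^+ n| <= M + 1.
  by apply: (MP (M + 1)) => //; rewrite ltrDl.
exists (M + 1), lam^-1; split.
- exact: le_trans (MP' 0%N).
- by rewrite invr_ge0 ltW.
- move=> w; apply: le_trans (ler_coord_level _ _) _.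
  rewrite exprVn ler_pdivlMr ?exprn_gt0 //; apply: le_trans (MP' (size w)).
  exact: ler_norm.
Qed.

Lemma phi_near0 k (A : 'I_d -> 'M[R]_k) : exists2 delta : R, 0 < delta &
  forall lam i j, `|lam| < delta -> phi P X (fun v => lam *: letters_map A v) i j =
    limn (series (fun n => level_dev (fun c => lam *: A c) n (ESig P X) i j)).
Proof.
have [C [B [C0 B0 Eb]]] := ESig_geometric_bound.
have [ESex _ _] := XROC.
pose K := letters_bound A * d%:R * (1 + 4 * B ^+ 2).
have K0 : 0 <= K.
  apply: mulr_ge0; last by rewrite addr_ge0 // mulr_ge0 ?sqr_ge0.
  by rewrite mulr_ge0 // (le_trans ler01) // letters_bound_ge1.
have K1 : 0 < K + 1 by rewrite ltr_wpDl.
exists (K + 1)^-1 => [|lam i j lamd]; first by rewrite invr_gt0.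
rewrite phiE (_ : (fun c => _) = (fun c => lam *: A c)); last first.
  by apply/funext => c; rewrite letters_map_delta.
apply: (@expected_dev _ _ _ _ P (fun o => rsig X o) (ESig P X) _ _ _ C B) => //.
- by move=> o; exact: rsig_group_like.
- by move=> w; rewrite /ESig unlock.
rewrite -!mulrA -/K; apply: (@le_lt_trans _ _ ((K + 1)^-1 * K)).
  rewrite [letters_bound A * _]mulrA -/K; apply: ler_wpM2r => //; exact: ltW.
by rewrite mulrC ltr_pdivrMr // mul1r ltrDl.
Qed.

(** The bounded set is taken to be {x}, as x lies in its own interval of analyticity. *)
Lemma phi_analytic k (A : 'I_d -> 'M[R]_k) i j x : (0 < k)%N ->
  (forall c, (A c)^T = - A c) ->
  analytic_at (fun lam => phi P X (fun v => lam *: letters_map A v) i j) x.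
Proof.
move=> k0 AT; have [_ _ /(_ [set x] k (letters_map A))] := XROC.
case=> //.
- exists `|x|; split; first exact: num_real.
  by move=> y xy z /= ->; exact: ltW.
- exact: letters_map_so.
move=> r r0 /(_ x erefl i j); apply; rewrite /= in_itv /=.
by apply/andP; split; lra.
Qed.

End CharacteristicFunction.

(** * Equality of the laws *)

Theorem proposition2p8 (R : realType) (d : nat)
  (gam : R -> R) (gam_gt0 : forall p : R, 1 <= p -> 0 < gam p)
  (p q : R) (p_ge1 : 1 <= p) (q_ge1 : 1 <= q)
  (dO dO' : measure_display)
  (Omega : measurableType dO) (Omega' : measurableType dO')
  (P : probability Omega R) (P' : probability Omega' R)
  (X : random_geometric_rough_path d gam p Omega)
  (Y : random_geometric_rough_path d gam q Omega') :
  ROC P X -> ROC P' Y ->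
  ESig P' Y = ESig P X ->
  forall A : set (Eborel R d), measurable A -> sig_law P' Y A = sig_law P X A.
Proof.
move=> XROC YROC ESE A mA.
have glX o := rsig_group_like X o p_ge1 (gam_gt0 p p_ge1).
have glY o := rsig_group_like Y o q_ge1 (gam_gt0 q q_ge1).
pose F : set (Eborel R d -> R) := [set f | exists (k : nat) (M : 'I_d -> 'M[R]_k) i j,
  [/\ (0 < k)%N, (forall c, (M c)^T = - M c) & f = fun x => dev M x i j]].
have mF f : F f -> measurable_fun setT f.
  by move=> [k [M [i [j [_ _ ->]]]]]; exact: measurable_dev.
have F1X f o : F f -> `|f (rsig X o)| <= 1.
  by move=> [k [M [i [j [_ MT ->]]]]]; exact: ler_norm_dev.
have F1Y f o : F f -> `|f (rsig Y o)| <= 1.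
  by move=> [k [M [i [j [_ MT ->]]]]]; exact: ler_norm_dev.
have FM f g : F f -> F g -> exists h, [/\ F h,
    forall o, h (rsig X o) = f (rsig X o) * g (rsig X o) &
    forall o, h (rsig Y o) = f (rsig Y o) * g (rsig Y o)].
  move=> [k [M [i [j [k0 MT ->]]]]] [k' [M' [i' [j' [k0' MT' ->]]]]].
  exists (fun x => dev (tens_sum M M') x (mxtens_index (i, i')) (mxtens_index (j, j'))); split.
  - exists (k * k')%N, (tens_sum M M'), (mxtens_index (i, i')), (mxtens_index (j, j')); split => //.
      by rewrite muln_gt0 k0.
    exact: tens_sum_so.
  - by move=> o; exact: dev_tens_sum.
  - by move=> o; exact: dev_tens_sum.
have FE f : F f -> \int[P]_o f (rsig X o) = \int[P']_o f (rsig Y o).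
  move=> [k [M [i [j [k0 MT ->]]]]].
  have phi1 lam : phi P X (fun v => lam *: letters_map M v) i j =
      phi P' Y (fun v => lam *: letters_map M v) i j.
    have [d1 d10 h1] := phi_near0 p_ge1 (gam_gt0 p p_ge1) XROC M.
    have [d2 d20 h2] := phi_near0 q_ge1 (gam_gt0 q q_ge1) YROC M.
    move: lam; apply: (@analytic_eq _ _ _ (Num.min d1 d2)).
    - by move=> x; exact: phi_analytic.
    - by move=> x; exact: phi_analytic.
    - by rewrite lt_min d10.
    - by move=> lam; rewrite lt_min => /andP[l1 l2]; rewrite h1 // h2 // ESE.
  have := phi1 1; rewrite !phiE.
  rewrite (_ : (fun c => _) = M) //.
  by apply/funext => c; rewrite scale1r letters_map_delta.
have F1 : exists f, [/\ F f, forall o, f (rsig X o) = 1 & forall o, f (rsig Y o) = 1].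
  (* Only level 0 contributes to the development of the zero map of size 1, which supplies the
     constant 1 on group-like elements. *)
  pose Z : 'I_d -> 'M[R]_1 := fun=> 0.
  have devZ (x : Espace R d) : group_like (Defs.eseries x) -> dev Z x ord0 ord0 = 1.
    move=> [x1 _]; apply/cvg_lim => //; apply: cvg_near_cst; near=> n.
    have n0 : (0 < n)%N by near: n; exact: nbhs_infty_gt.
    rewrite -(prednK n0) /series /= big_nat_recl //= big1 ?addr0 => [|m _].
      by rewrite /level_dev big_words0 x1 word_prod0 scale1r mxE.
    rewrite /level_dev big_wordsS big1 ?mxE // => c _; apply: big1 => w _.
    by rewrite word_prod_cons mul0mx scaler0.
  exists (fun x => dev Z x ord0 ord0); split.
  - by exists 1%N, Z, ord0, ord0; split => // c; rewrite trmx0 oppr0.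
  - by move=> o; exact: devZ.
  - by move=> o; exact: devZ.
pose G : set (set (Eborel R d)) := multiplier_sets P P' (rsig X) (rsig Y) F.
have sG : sigma_algebra setT G by exact: multiplier_sets_sigma_algebra.
(* Rescaled letter matrices are still antisymmetric, so the approximants of a coordinate belong to
   [F] up to a constant factor. *)
have mcoord w : measurable_fun setT (fun x : g_sigma_algebraType G => Defs.eseries x w).
  apply: (@measurable_fun_cvg _ _ _ setT (fun m (x : g_sigma_algebraType G) =>
    m.+1%:R ^+ size w * dev (fun c => m.+1%:R^-1 *: letter_mx R w c) x ord0 ord_max)).
  - move=> m; apply: measurable_funM; first exact: measurable_cst.
    apply: (measurable_multiplier_sets mF F1X F1Y FM).
    exists (size w).+1, (fun c => m.+1%:R^-1 *: letter_mx R w c), ord0, ord_max; split => // c.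
    by rewrite linearZ /= letter_mx_so scalerN.
  - by move=> x _; exact: cvg_dev_letter_mx.
suff GA : G A.
  have GE := multiplier_sets_law FE F1 GA.
  exact: esym GE.
(* [G] is its own generated sigma-algebra, so it contains all Borel sets once it contains the open
   ones. *)
move: A mA; rewrite -(sigma_algebra_id sG); apply: smallest_sub.
  exact: smallest_sigma_algebra.
exact: open_measurable_of_coords mcoord.
Unshelve. all: by end_near. Qed.
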